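(* Let $n=3r_0+1$ with $r_0$ an integer and $n\ge 7$, and let $G$ be a connected graph with $n$ vertices and less than $r_0+6$ cycles. Then $$m'(G)\le c(n,r_0-1)=8\cdot 3^{r_0-2}+2^{r_0-2},$$ with equality if and only if $G\cong C(n,r_0-1)$, where $C(n,r_0-1)=K_3*\bigl((r_0-2)K_3\uplus 2K_2\bigr)$.
   Context: All graphs are finite and simple. A maximum independent set is an independent set of vertices of largest cardinality among all independent sets of $G$; $m'(G)$ is the number of maximum independent sets of $G$. ''Number of cycles'' means the number of distinct cycle subgraphs. $\uplus$ is disjoint union, $tH$ is the disjoint union of $t$ copies of $H$ (empty if $t=0$), and $K_m$ is the complete graph on $m$ vertices. If $H$ is a graph all of whose components are complete, $K_m*H$ is the graph obtained from the disjoint union of $K_m$ and $H$ by picking a vertex $v_0$ of $K_m$ and joining it by an edge to exactly one vertex in each component of $H$. *)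

(* Defs.v *)
From mathcomp Require Import all_boot.

Set Implicit Arguments.
Unset Strict Implicit.
Unset Printing Implicit Defensive.

Record sgraph := SGraph {
  svertex :> finType;
  sedge : rel svertex;
  sedge_sym : symmetric sedge;
  sedge_irr : irreflexive sedge }.

Definition sg_iso (G H : sgraph) : Prop :=
  exists2 f : G -> H, bijective f & {mono f : x y / sedge x y}.

Definition sg_connected (G : sgraph) : Prop :=
  forall x y : G, connect (@sedge G) x y.

Definition independent (G : sgraph) (S : {set G}) : bool :=
  [forall x in S, forall y in S, ~~ sedge x y].

Definition maximum_independent (G : sgraph) (S : {set G}) : bool :=
  independent S && [forall S' : {set G}, independent S' ==> (#|S'| <= #|S|)].

Definition num_max_indep (G : sgraph) : nat :=
  #|[set S : {set G} | maximum_independent S]|.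

Definition cycle_edges (G : sgraph) (c : seq G) : {set {set G}} :=
  [set [set x; next c x] | x in c].

(* A cycle subgraph is identified with its edge set, so that the vertex        *)
(* sequences obtained from one another by rotation or reversal are counted     *)
(* once. The library's cycles may have length at most 2, hence the bound       *)
(* 2 < k; since c has no repeated vertex, k <= #|G| is no restriction.         *)
Definition is_cycle_subgraph (G : sgraph) (F : {set {set G}}) : bool :=
  [exists k : 'I_#|G|.+1, exists c : k.-tuple G,
     [&& 2 < k, cycle (@sedge G) c, uniq c & F == cycle_edges c]].

Definition num_cycles (G : sgraph) : nat :=
  #|[set F : {set {set G}} | is_cycle_subgraph F]|.

Section CompleteGraph.
Variable m : nat.
Definition complete_edge : rel 'I_m := fun x y => x != y.
Fact complete_sym : symmetric complete_edge.
Proof. by move=> x y; rewrite /complete_edge eq_sym. Qed.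
Fact complete_irr : irreflexive complete_edge.
Proof. by move=> x; rewrite /complete_edge eqxx. Qed.
Definition complete_graph := SGraph complete_sym complete_irr.
End CompleteGraph.

Section DisjointUnion.
Variables G H : sgraph.
Definition union_edge : rel (G + H)%type := fun u v =>
  match u, v with
  | inl x, inl y => sedge x y
  | inr x, inr y => sedge x y
  | _, _ => false
  end.
Fact union_sym : symmetric union_edge.
Proof. by move=> [x|x] [y|y] //=; apply: sedge_sym. Qed.
Fact union_irr : irreflexive union_edge.
Proof. by move=> [x|x] /=; apply: sedge_irr. Qed.
Definition disjoint_union := SGraph union_sym union_irr.
End DisjointUnion.

Section Copies.
Variables (t : nat) (H : sgraph).
Definition copies_edge : rel ('I_t * H)%type := fun u v =>
  (u.1 == v.1) && sedge u.2 v.2.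
Fact copies_sym : symmetric copies_edge.
Proof. by move=> u v; rewrite /copies_edge eq_sym sedge_sym. Qed.
Fact copies_irr : irreflexive copies_edge.
Proof. by move=> u; rewrite /copies_edge sedge_irr andbF. Qed.
Definition copies := SGraph copies_sym copies_irr.
End Copies.

(* K_m * H. The distinguished vertex v_0 of K_m is 0, and                      *)
(* roots (@sedge H) contains exactly one vertex of each component of H. When   *)
(* all components of H are complete, other choices give isomorphic graphs.     *)
Section Star.
Variables (m : nat) (H : sgraph).
Definition star_edge : rel (complete_graph m + H)%type := fun u v =>
  match u, v with
  | inl i, inl j => sedge i j
  | inr x, inr y => sedge x y
  | inl i, inr x | inr x, inl i =>
      (val i == 0) && (x \in roots (@sedge H))
  end.
Fact star_sym : symmetric star_edge.
Proof. by move=> [x|x] [y|y] //; apply: sedge_sym. Qed.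
Fact star_irr : irreflexive star_edge.
Proof. by move=> [x|x]; apply: sedge_irr. Qed.
Definition star := SGraph star_sym star_irr.
End Star.

(* C(n, r0 - 1) for n = 3 r0 + 1, with r0 >= 2. *)
Definition extremal_graph (r0 : nat) : sgraph :=
  star 3 (disjoint_union (copies (r0 - 2) (complete_graph 3))
                         (copies 2 (complete_graph 2))).

(* Main.v *)
Require Import Defs.
From mathcomp Require Import all_boot zify.

Set Implicit Arguments.
Unset Strict Implicit.
Unset Printing Implicit Defensive.

(** Independent sets are counted inside subsets A of a fixed vertex type:
    cnt e A k is the number of independent k-subsets of A, and alpha_le e A k
    says that A has no larger ones. Vertices are then deleted by shrinking A,
    and edges by changing the relation e.

    The bound is proved for all connected A at once, in a form [cnt_bound] fit
    for induction. With n vertices and c cycles the bound is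
      n = 3s     : 2 * 3^(s-1), plus 2^(s-1) if c >= s;
      n = 3s + 1 : 8 * 3^(s-2) + 2^(s-2) if c < s + 6, else 3^s + 2^(s-1);
      n = 3s + 2 : 4 * 3^(s-1), plus 2^(s-1) if s <= c <= s + 6,
                   plus 3 * 2^(s-2) if c > s + 6,
    apart from a few small n. The case n = 3s + 1 with few cycles is the wanted
    one; the others are what its induction calls upon.

    Every connected graph on at least five vertices admits one of six
    reductions ([reduce]): deleting an edge without raising the independence
    number, deleting a noncut vertex of degree at least 4, merging the two
    nonadjacent neighbours of a vertex of degree 2, a combination of a deletion
    with such a merge at two adjacent vertices of degree 3, or splitting off
    one or two cliques that hang at a vertex u. They exist because some vertex
    u and connected piece R of A \ u can be chosen with R as large as possible,
    and then no vertex outside u and R disconnects A ([end_piece]). Each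
    reduction bounds the count by counts in smaller graphs. Cycles are lost at
    a controlled rate: a noncut vertex of degree d lies on at least d(d-1)/2
    of them ([ncyc_noncut]), and merging creates none because every cycle of
    the merged graph lifts ([ncyc_fold]). The remaining terms are estimated by
    the Moon-Moser number g ([cnt_le_g]). When n = 1 modulo 3 and cycles are
    few this estimate is too weak by a factor 8/9. Fortunately a graph on 3s
    vertices either is a disjoint union of triangles or has at most 8/9 of
    g (3s) maximum independent sets ([triangles_or_few]); and if what remains
    after deleting a closed neighbourhood is a disjoint union of triangles,
    then each of these gives a cycle and six or seven more appear
    ([ncyc_del_triangles], [ncyc_cone_triangles]), contrary to the assumption.

    For equality, all reductions but one turn out to be strict in the range of
    cycle numbers at hand, so that an extremal graph arises from a smaller one
    by hanging an edge or a triangle at a vertex p. Equality also forces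
    the sets that avoid p to be almost as numerous as the Moon-Moser number
    allows, which makes p the centre of the smaller graph ([bouquet_centre]).
    Hence the extremal graphs are bouquets: a triangle with further triangles
    and edges joined to one of its vertices, exactly two edges if n = 1 modulo
    3 ([cnt_bound_eq]). A labelling of the vertices identifies a bouquet with
    the graph of the theorem, and back; the count of a bouquet with t triangles
    and b edges is 2 * 3^t * 2^b + 2^t, the sets that avoid and that contain
    the centre ([bouquet_total]). *)

(** * Counting independent sets *)

(** Linear arithmetic slows down badly in the presence of many membership and
    adjacency hypotheses, which are booleans too; they are cleared first. *)
Ltac narith := repeat match goal with
  | H : ?T |- _ => lazymatch T with
      | is_true (leq _ _) => fail | is_true (andb (leq _ _) _) => fail
      | @eq nat _ _ => fail | is_true (@eq_op _ (_ : nat) _) => fail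
      | _ -> is_true (leq _ _) => fail | nat => fail
      | _ => clear H end end; lia.

Section Counting.
Variables (V : finType).
Implicit Types (e : rel V) (A B C S T W : {set V}) (x y v : V) (k : nat).

Definition indep e S := [forall x in S, forall y in S, ~~ e x y].

Definition indep_sets e A k :=
  [set S : {set V} | [&& S \subset A, indep e S & #|S| == k]].

Definition cnt e A k := #|indep_sets e A k|.

(** An upper bound instead of the independence number itself: cnt e A k then
    counts the maximum independent sets of A or is 0, and the induction never
    has to know which. *)
Definition alpha_le e A k :=
  forall S, S \subset A -> indep e S -> #|S| <= k.

(** Neighbourhoods, open and closed, relative to A. *)
Definition nb e A x := [set y in A | e x y].

Definition cn e A x := x |: nb e A x.

Lemma indepP e S :
  reflect (forall x y, x \in S -> y \in S -> e x y = false) (indep e S).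
Proof.
apply: (iffP forall_inP) => [H x y xS yS|H x xS].
  by apply: negbTE; move/forall_inP: (H x xS); apply.
by apply/forall_inP => y yS; rewrite H.
Qed.

Lemma indepS e S T : S \subset T -> indep e T -> indep e S.
Proof.
move=> /subsetP sST /indepP H; apply/indepP => x y /sST xT /sST yT.
exact: H.
Qed.

Lemma in_nb e A x y : (y \in nb e A x) = (y \in A) && e x y.
Proof. by rewrite inE. Qed.

Lemma in_cn e A x y : (y \in cn e A x) = (y == x) || (y \in A) && e x y.
Proof. by rewrite !inE. Qed.

Lemma nb_sub e A x : nb e A x \subset A.
Proof. by apply/subsetP => y; rewrite inE => /andP[]. Qed.

Lemma cn_sub e A x : x \in A -> cn e A x \subset A.
Proof. by move=> xA; rewrite subUset sub1set xA nb_sub. Qed.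

Lemma alpha_leS e A B k : A \subset B -> alpha_le e B k -> alpha_le e A k.
Proof. by move=> sAB H S sSA; apply: H; apply: subset_trans sAB. Qed.

Lemma cntS e A B k : A \subset B -> cnt e A k <= cnt e B k.
Proof.
move=> sAB; apply: subset_leq_card; apply/subsetP => S.
by rewrite !inE => /and3P[sSA -> ->]; rewrite (subset_trans sSA sAB).
Qed.

Lemma cnt_sub_rel e e' A k : subrel e' e -> cnt e A k <= cnt e' A k.
Proof.
move=> sub; apply: subset_leq_card; apply/subsetP => S.
rewrite !inE => /and3P[-> /indepP H ->]; rewrite andbT /=.
apply/indepP => x y xS yS; apply/negP => /sub; by rewrite H.
Qed.

Lemma cnt0 e A : cnt e A 0 = 1.
Proof.
rewrite /cnt (_ : indep_sets e A 0 = [set set0]) ?cards1 //.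
apply/setP => S; rewrite !inE cards_eq0; apply/and3P/eqP => [[_ _ /eqP]//|->].
by split=> //; [apply: sub0set | apply/indepP => x y; rewrite inE].
Qed.

Lemma cnt_big e A k j : alpha_le e A k -> k < j -> cnt e A j = 0.
Proof.
move=> al kj; apply/eqP; rewrite cards_eq0; apply/eqP/setP => S.
rewrite !inE; apply/and3P => -[sSA iS /eqP cS].
by move: (al S sSA iS); rewrite cS leqNgt kj.
Qed.

Lemma cnt_witness e A k : 0 < cnt e A k ->
  exists S, [/\ S \subset A, indep e S & #|S| = k].
Proof.
rewrite /cnt card_gt0 => /set0Pn[S]; rewrite inE => /and3P[? ? /eqP ?].
by exists S.
Qed.

Lemma cnt_ge1 e A S : S \subset A -> indep e S -> 0 < cnt e A #|S|.
Proof.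
by move=> sSA iS; rewrite card_gt0; apply/set0Pn; exists S; rewrite inE sSA iS eqxx.
Qed.

Lemma eq_cnt e e' A k :
  (forall x y, x \in A -> y \in A -> e x y = e' x y) -> cnt e A k = cnt e' A k.
Proof.
move=> H; rewrite /cnt; congr #|pred_of_set _|; apply/setP => S; rewrite !inE.
case sSA: (S \subset A) => //=; congr (_ && _).
move/subsetP: sSA => sSA.
apply/indepP/indepP => I x y xS yS; first by rewrite -H ?sSA ?I.
by rewrite H ?sSA ?I.
Qed.

End Counting.

Section Counting2.
Variables (V : finType) (e : rel V).
Hypotheses (es : symmetric e) (ei : irreflexive e).
Implicit Types (A B C S T W : {set V}) (x y v : V) (k : nat).
Local Notation indep := (indep e).
Local Notation cnt := (cnt e).
Local Notation alpha_le := (alpha_le e).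
Local Notation nb := (nb e).
Local Notation cn := (cn e).

Lemma nb_irr A x : x \notin nb A x.
Proof. by rewrite inE ei andbF. Qed.

Lemma card_cn A x : #|cn A x| = #|nb A x|.+1.
Proof. by rewrite cardsU1 nb_irr. Qed.

Lemma card_del_cn A x : x \in A -> #|A :\: cn A x| = #|A| - #|nb A x|.+1.
Proof.
by move=> xA; rewrite cardsD (setIidPr (cn_sub e xA)) card_cn.
Qed.

Lemma indep_add A S v : S \subset A :\: cn A v -> indep S -> indep (v |: S).
Proof.
move=> /subsetP sS /indepP iS; apply/indepP => x y.
have aux z : z \in S -> e v z = false.
  move=> /sS; rewrite !inE => /andP[/norP[_ /nandP[/negP nzA zA|]]] //.
  by move=> /negbTE.
rewrite !inE => /orP[/eqP->|xS] /orP[/eqP->|yS].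
- exact: ei.
- exact: aux.
- by rewrite es aux.
- exact: iS.
Qed.

Lemma notin_del_cn A S v : S \subset A :\: cn A v -> v \notin S.
Proof. by move=> /subsetP sS; apply/negP => /sS; rewrite !inE eqxx. Qed.

Lemma alpha_del A k v :
  v \in A -> alpha_le A k.+1 -> alpha_le (A :\: cn A v) k.
Proof.
move=> vA al S sS iS; have := al (v |: S).
rewrite cardsU1 (notin_del_cn sS) /= add1n ltnS; apply.
  by rewrite subUset sub1set vA (subset_trans sS) // subsetDl.
exact: (indep_add sS).
Qed.

Lemma indep_sets_with A v k : v \in A ->
  [set S in indep_sets e A k.+1 | v \in S] =
  [set v |: S | S in indep_sets e (A :\: cn A v) k].
Proof.
move=> vA; apply/setP => S; apply/idP/imsetP.
  rewrite !inE => /andP[/and3P[sSA /indepP iS /eqP cS] vS].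
  exists (S :\ v); last by rewrite setD1K.
  rewrite inE; apply/and3P; split.
  - apply/subsetP => x; rewrite !inE => /andP[xv xS].
    by rewrite (negbTE xv) (subsetP sSA) // iS.
  - by apply/indepP => x y; rewrite !inE => /andP[_ xS] /andP[_ yS]; apply: iS.
  - by apply/eqP; move: cS; rewrite (cardsD1 v) vS => -[].
case=> T; rewrite !inE => /and3P[sT iT /eqP cT] ->.
rewrite !inE eqxx andbT (indep_add sT iT) cardsU1 (notin_del_cn sT) cT eqxx.
by rewrite subUset sub1set vA (subset_trans sT) // subsetDl.
Qed.

Lemma cnt_with A v k : v \in A ->
  #|[set S in indep_sets e A k.+1 | v \in S]| = cnt (A :\: cn A v) k.
Proof.
move=> vA; rewrite indep_sets_with // card_in_imset // => S T.
rewrite !inE => /and3P[sS _ _] /and3P[sT _ _] eqST.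
by rewrite -(setU1K (notin_del_cn sS)) eqST setU1K // (notin_del_cn sT).
Qed.

Lemma cnt_del A v k : v \in A ->
  cnt A k.+1 = cnt (A :\ v) k.+1 + cnt (A :\: cn A v) k.
Proof.
move=> vA; rewrite -cnt_with // {1}/cnt -(cardsID [set S : {set V} | v \in S]).
rewrite addnC; congr (_ + _); rewrite /cnt; apply: eq_card => S; rewrite !inE.
  by rewrite subsetD1; case: (v \in S); rewrite ?andbF ?andbT.
by [].
Qed.

Lemma nb_del A v x : x != v -> v \in cn A x -> A :\: cn A x = (A :\ v) :\: cn (A :\ v) x.
Proof.
move=> xv; rewrite in_cn eq_sym (negbTE xv) /= => /andP[vA exv].
apply/setP => y; rewrite !inE; case: (eqVneq y v) => [->|] //=.
by rewrite exv vA orbT andbF.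
Qed.

Lemma del_cn_sub A v x : (A :\ v) :\: cn (A :\ v) x \subset A :\: cn A x.
Proof.
apply/subsetP => y; rewrite !inE => /and3P[/norP[yx H] yv yA].
by move: H; rewrite yv yA (negbTE yx) /= => ->.
Qed.

(** Vertices of C are removed one at a time; a set is counted once for each
    vertex of C that it contains, hence the inequality. *)
Lemma cnt_cover A C k : C \subset A ->
  cnt A k.+1 <= \sum_(x in C) cnt (A :\: cn A x) k + cnt (A :\: C) k.+1.
Proof.
move: {2}#|C| (erefl #|C|) => n; elim: n A C => [|n IH] A C cC sCA.
  by move/eqP: cC; rewrite cards_eq0 => /eqP->; rewrite big_set0 setD0.
have [v vC] : exists v, v \in C by apply/set0Pn; rewrite -card_gt0 cC.
have vA := subsetP sCA _ vC.
rewrite (cnt_del _ vA) (big_setD1 v) //= addnC -addnA leq_add2l.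
have -> : A :\: C = (A :\ v) :\: (C :\ v).
  by apply/setP => x; rewrite !inE; case: eqVneq => [->|] //=; rewrite vC.
apply: leq_trans (IH _ (C :\ v) _ _) _.
- by move: cC; rewrite (cardsD1 v) vC => -[].
- by apply: setSD.
rewrite leq_add2r; apply: leq_sum => x _; exact: cntS (del_cn_sub _ _ _).
Qed.

(** In a clique the vertex of C in a given set is unique. *)
Lemma cnt_clique A C k : C \subset A ->
  (forall x y, x \in C -> y \in C -> x != y -> e x y) ->
  cnt A k.+1 = \sum_(x in C) cnt (A :\: cn A x) k + cnt (A :\: C) k.+1.
Proof.
move: {2}#|C| (erefl #|C|) => n; elim: n A C => [|n IH] A C cC sCA clC.
  by move/eqP: cC; rewrite cards_eq0 => /eqP->; rewrite big_set0 setD0.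
have [v vC] : exists v, v \in C by apply/set0Pn; rewrite -card_gt0 cC.
have vA := subsetP sCA _ vC.
rewrite (cnt_del _ vA) (big_setD1 v) //= addnC -addnA; congr (_ + _).
have -> : A :\: C = (A :\ v) :\: (C :\ v).
  by apply/setP => x; rewrite !inE; case: eqVneq => [->|] //=; rewrite vC.
rewrite (IH _ (C :\ v)).
- congr (_ + _); apply: eq_bigr => x; rewrite !inE => /andP[xv xC].
  by rewrite -nb_del // in_cn vA clC ?orbT.
- by move: cC; rewrite (cardsD1 v) vC => -[].
- by apply: setSD.
by move=> x y; rewrite !inE => /andP[_ xC] /andP[_ yC]; apply: clC.
Qed.

(** A maximum independent set meets every closed neighbourhood, so that the
    second term of [cnt_cover] vanishes. *)
Lemma cnt_nbhd A v k : v \in A -> alpha_le A k.+1 ->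
  cnt A k.+1 <= \sum_(x in cn A v) cnt (A :\: cn A x) k.
Proof.
move=> vA al; apply: leq_trans (cnt_cover k (cn_sub e vA)) _.
by rewrite (cnt_big (alpha_del vA al)) ?addn0.
Qed.

Lemma cnt_simplicial A v k : v \in A -> alpha_le A k.+1 ->
  (forall x y, x \in cn A v -> y \in cn A v -> x != y -> e x y) ->
  cnt A k.+1 = \sum_(x in cn A v) cnt (A :\: cn A x) k.
Proof.
move=> vA al cl; rewrite (cnt_clique k (cn_sub e vA) cl).
by rewrite (cnt_big (alpha_del vA al)) ?addn0.
Qed.

Lemma alpha_le0 A : alpha_le A 0 -> A = set0.
Proof.
move=> al; apply/setP => x; rewrite inE; apply/negP => xA.
have i1: indep [set x].
  by apply/indepP => y z; rewrite !inE => /eqP-> /eqP->; apply: ei.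
by have := al [set x]; rewrite cards1 sub1set xA => /(_ isT i1).
Qed.

End Counting2.

(** * The Moon-Moser bound and disjoint triangles *)

(** The Moon-Moser number: the largest number of maximal independent sets of a
    graph on n vertices, with g (n + 3) = 3 * g n for n >= 2. *)
Fixpoint g n := match n with
  | 0 | 1 => 1 | 2 => 2 | 3 => 3 | 4 => 4
  | S (S (S (S (S m) as q))) => 3 * g q
  end.

Lemma gS m : g m.+4.+1 = 3 * g m.+2. Proof. by []. Qed.

Lemma g_ind (P : nat -> Prop) :
  P 0 -> P 1 -> P 2 -> P 3 -> P 4 -> (forall m, P m.+2 -> P m.+4.+1) ->
  forall n, P n.
Proof.
move=> P0 P1 P2 P3 P4 PS n; elim/ltn_ind: n => n IH.
case: n IH => [|[|[|[|[|m]]]]] // IH.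
by apply: PS; apply: IH; rewrite !ltnS leqW // leqW.
Qed.

Lemma g0 s : g (3 * s) = 3 ^ s.
Proof.
elim: s => // s IH; rewrite mulnS expnS -IH; case: s {IH} => [|s] //.
by rewrite (_ : 3 + 3 * s.+1 = (3 * s).+1.+4.+1) ?gS; last lia; congr (3 * g _); lia.
Qed.

Lemma g2 s : g (3 * s + 2) = 2 * 3 ^ s.
Proof.
elim: s => // s IH; rewrite expnS mulnCA -IH.
by rewrite (_ : 3 * s.+1 + 2 = (3 * s).+4.+1) ?gS; last lia; congr (3 * g _); lia.
Qed.

Lemma g1 s : g (3 * s + 4) = 4 * 3 ^ s.
Proof.
elim: s => // s IH; rewrite expnS mulnCA -IH.
by rewrite (_ : 3 * s.+1 + 4 = (3 * s).+2.+4.+1) ?gS; last lia; congr (3 * g _); lia.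
Qed.

(** One step of the induction for [cnt_le_g]: a closed neighbourhood of j
    vertices leaves j branches on the remaining m vertices. *)
Lemma g_small j m : 0 < j <= 4 -> j * g m <= g (m + j).
Proof.
move=> jP; have: j \in [:: 1; 2; 3; 4] by rewrite !inE; lia.
move: {jP} j; apply/allP; elim/g_ind: m => // m /and5P[H1 H2 H3 H4 _].
apply/and5P; split=> //; move: H1 H2 H3 H4; rewrite !addnS !addn0 !gS; lia.
Qed.

Lemma g_mono m n : m <= n -> g m <= g n.
Proof.
move=> /subnKC <-; elim: (n - m) => [|d IH]; first by rewrite addn0.
apply: leq_trans IH _; rewrite addnS.
by have := @g_small 1 (m + d) isT; rewrite mul1n addn1.
Qed.

Lemma g_gt0 n : 0 < g n.
Proof. exact: leq_trans (g_mono (leq0n n)). Qed.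

Lemma g_mul j m : 0 < j -> j * g m <= g (m + j).
Proof.
elim/ltn_ind: j => j IH j0; case: (leqP j 4) => j4; first by apply: g_small; lia.
case: j IH j0 j4 => [|[|i]] // IH _ j4.
apply: leq_trans (_ : 2 * (i * g m) <= _); first by rewrite mulnA leq_mul2r; lia.
rewrite -(addn2 i) addnA; apply: leq_trans (@g_small 2 (m + i) isT).
by rewrite leq_mul2l /=; apply: IH; lia.
Qed.

Lemma cards3 (V : finType) (x y z : V) : uniq [:: x; y; z] -> #|[set x; y; z]| = 3.
Proof.
rewrite /= !inE negb_or => /and3P[/andP[xy xz] yz _].
by rewrite setUC cardsU1 cards2 !inE xy negb_or !(eq_sym z) xz yz.
Qed.

Lemma g_vals : (g 0 = 1) * (g 1 = 1) * (g 2 = 2) * (g 3 = 3) * (g 4 = 4).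
Proof. by []. Qed.

Global Opaque g.

Section MoonMoser.
Variables (V : finType) (e : rel V).
Hypotheses (es : symmetric e) (ei : irreflexive e).
Implicit Types (A B C S T W : {set V}) (x y v : V) (k : nat).
Local Notation indep := (indep e).
Local Notation cnt := (cnt e).
Local Notation alpha_le := (alpha_le e).
Local Notation nb := (nb e).
Local Notation cn := (cn e).

Lemma min_degree A : A != set0 ->
  exists2 v, v \in A & forall x, x \in A -> #|nb A v| <= #|nb A x|.
Proof.
case/set0Pn=> x0 x0A.
by case: (arg_minnP (fun x => #|nb A x|) x0A) => v vA H; exists v.
Qed.

Lemma nb_lt A v : v \in A -> #|nb A v| < #|A|.
Proof. by move=> vA; rewrite -(card_cn ei); apply/subset_leq_card/cn_sub. Qed.

(** Branch over the closed neighbourhood of a vertex of minimum degree: every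
    branch loses at least as many vertices as there are branches. *)
Theorem cnt_le_g A k : alpha_le A k -> cnt A k <= g #|A|.
Proof.
move: {2}#|A|.+1 (ltnSn #|A|) => n; elim: n A k => // n IH A [|k] nA al.
  by rewrite cnt0 g_gt0.
have [->|A0] := eqVneq A set0.
  by rewrite (cnt_big (k := 0)) // => S; rewrite subset0 => /eqP->; rewrite cards0.
have [v vA vmin] := min_degree A0.
apply: leq_trans (cnt_nbhd es ei vA al) _.
apply: leq_trans (_ : \sum_(x in cn A v) g (#|A| - #|nb A v|.+1) <= _).
  apply: leq_sum => x xC; have xA := subsetP (cn_sub e vA) _ xC.
  have := vmin x xA; have := nb_lt xA; have := card_del_cn ei xA => cd lt1 lt2.
  apply: leq_trans (IH _ k _ (alpha_del es ei xA al)) _; first lia.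
  by apply: g_mono; lia.
rewrite sum_nat_const (card_cn ei).
apply: leq_trans (g_mul _ _) _ => //; rewrite subnK //; exact: nb_lt.
Qed.

Lemma cnt_le_gn A k n : alpha_le A k -> #|A| <= n -> cnt A k <= g n.
Proof. by move=> al H; apply: leq_trans (cnt_le_g al) (g_mono H). Qed.

(** The disjoint unions of triangles, described locally. *)
Definition triangles A := forall x, x \in A ->
  exists y z, [/\ y != z, e y z & nb A x = [set y; z]].

Lemma trianglesP A : triangles A -> A != set0 ->
  exists x y z, [/\ uniq [:: x; y; z], [set x; y; z] \subset A,
    (forall u w, u \in [set x; y; z] -> w \in A ->
       e u w = (w \in [set x; y; z]) && (w != u)),
    triangles (A :\: [set x; y; z])
    & #|A| = #|A :\: [set x; y; z]| + 3].
Proof.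
move=> tA /set0Pn[x xA]; have [y [z [yz eyz nx]]] := tA x xA.
have /setP/(_ y) := nx; rewrite !inE eqxx /= => /andP[yA exy].
have /setP/(_ z) := nx; rewrite !inE eqxx orbT /= => /andP[zA exz].
have xy : x != y by apply: contraTneq exy => ->; rewrite ei.
have xz : x != z by apply: contraTneq exz => ->; rewrite ei.
have nbeq v a b : v \in A -> a != b -> a \in nb A v -> b \in nb A v -> nb A v = [set a; b].
  move=> vA ab av bv; have [c [d [cd _ E]]] := tA v vA.
  apply/eqP; rewrite eq_sym eqEcard subUset !sub1set av bv E !cards2 cd ab /=.
  by [].
have ny : nb A y = [set x; z] by apply: nbeq; rewrite ?inE ?xA ?zA ?eyz ?(es y x) ?exy.
have nz : nb A z = [set x; y].
  by apply: nbeq; rewrite ?inE ?xA ?yA ?(es z x) ?(es z y) ?exz ?eyz.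
have closed u w : u \in [set x; y; z] -> w \in A ->
    e u w = (w \in [set x; y; z]) && (w != u).
  move: nx ny nz => /setP/(_ w) n1 /setP/(_ w) n2 /setP/(_ w) n3 uT wA.
  move: uT n1 n2 n3; rewrite !inE wA /= -!orbA.
  case/or3P=> /eqP-> n1 n2 n3; rewrite ?n1 ?n2 ?n3.
  - case: (eqVneq w x) => [->|] /=; last by rewrite andbT.
    by rewrite (negbTE xy) (negbTE xz).
  - case: (eqVneq w y) => [->|] /=; last by rewrite andbT.
    by rewrite eq_sym (negbTE xy) (negbTE yz).
  - case: (eqVneq w z) => [->|] /=; last by rewrite orbF andbT.
    by rewrite eq_sym (negbTE xz) eq_sym (negbTE yz).
have sT : [set x; y; z] \subset A by rewrite !subUset !sub1set xA yA zA.
exists x, y, z; split=> //.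
- by rewrite /= !inE negb_or xy xz yz.
- move=> u; rewrite inE => /andP[uT uA]; have [c [d [cd ecd E]]] := tA u uA.
  exists c, d; split=> //; rewrite -E; apply/setP => w; rewrite !inE.
  case wA: (w \in A); rewrite ?andbF //= andbT.
  case euw: (e u w); rewrite ?andbF //= andbT.
  apply/negP => wT; have := closed w u; rewrite !inE wT es euw => /(_ isT uA).
  by move: uT; rewrite !inE => /negbTE->.
rewrite -(cardsID [set x; y; z] A) (setIidPr sT) addnC; congr (_ + _).
by rewrite cards3 //= !inE negb_or xy xz yz.
Qed.

Lemma triangles_ind (P : {set V} -> Prop) :
  P set0 ->
  (forall A x y z, triangles A -> uniq [:: x; y; z] -> [set x; y; z] \subset A ->
    (forall u w, u \in [set x; y; z] -> w \in A ->
       e u w = (w \in [set x; y; z]) && (w != u)) ->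
    triangles (A :\: [set x; y; z]) ->
    #|A| = #|A :\: [set x; y; z]| + 3 ->
    P (A :\: [set x; y; z]) -> P A) ->
  forall A, triangles A -> P A.
Proof.
move=> P0 PS A; move: {2}#|A|.+1 (ltnSn #|A|) => n; elim: n A => // n IH A nA tA.
have [->//|A0] := eqVneq A set0.
have [x [y [z [u1 s1 c1 t1 card1]]]] := trianglesP tA A0.
by apply: (PS A x y z) => //; apply: IH => //; lia.
Qed.

Lemma triangles_indep A S : triangles A -> S \subset A -> indep S -> 3 * #|S| <= #|A|.
Proof.
move=> tA; elim/triangles_ind: A / tA S => [S|A x y z _ _ sT cl _ -> IH S sSA iS].
  by rewrite subset0 => /eqP->; rewrite cards0.
have := IH (S :\: [set x; y; z]) (setSD _ sSA) (indepS (subsetDl _ _) iS).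
have le1 : #|S :&: [set x; y; z]| <= 1.
  rewrite leqNgt; apply/negP => /card_gt1P[a [b [aI bI ab]]].
  move: aI bI; rewrite !inE => /andP[aS aT] /andP[bS bT].
  have := cl a b; rewrite !inE aT (subsetP sSA) // => /(_ isT isT).
  by rewrite bT eq_sym ab; move/indepP: iS => ->.
by have := cardsID [set x; y; z] S; lia.
Qed.

(** Pick in each triangle a vertex outside W. *)
Lemma triangles_transversal A W : triangles A ->
  (forall x y z, uniq [:: x; y; z] -> [set x; y; z] \subset A -> e x y -> e y z -> e x z ->
      ~~ ([set x; y; z] \subset W)) ->
  exists S, [/\ S \subset A :\: W, indep S & 3 * #|S| = #|A|].
Proof.
move=> tA; elim/triangles_ind: A / tA W => [|A x y z _ un sT cl _ card1 IH] W HW.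
  exists set0; split; rewrite ?sub0set ?cards0 //.
  by apply/indepP => x y; rewrite inE.
have [|S [sS iS cS]] := IH W.
  move=> a b c u1 s1 e1 e2 e3; apply: HW => //; exact: subset_trans s1 (subsetDl _ _).
have adj u w : u \in [set x; y; z] -> w \in [set x; y; z] -> u != w -> e u w.
  move=> uT wT uw; rewrite cl ?wT 1?eq_sym //; exact: (subsetP sT).
have: ~~ ([set x; y; z] \subset W).
  move: (un); rewrite /= !inE negb_or => /and3P[/andP[xy xz] yz _].
  by apply: HW => //; apply: adj; rewrite ?inE ?eqxx ?orbT.
case/subsetPn => u uT uW; exists (u |: S); split.
- rewrite subUset sub1set inE uW (subsetP sT) //=.
  by apply: subset_trans sS _; rewrite setDDl setUC -setDDl subsetDl.
- apply: (indep_add es ei (A := A)) => //.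
  apply/subsetP => w /(subsetP sS); rewrite in_setD => /andP[_].
  rewrite in_setD => /andP[wT wA]; rewrite in_setD in_cn wA cl // (negbTE wT).
  by rewrite /= orbF andbT; apply: contraNneq wT => ->.
rewrite cardsU1 (_ : u \notin S) ?card1; first by rewrite add1n mulnS cS addnC.
by apply/negP => /(subsetP sS); rewrite !inE; move: uT; rewrite !inE => ->; rewrite andbF.
Qed.

End MoonMoser.

(** * Merging the neighbours of a vertex of degree two *)

Section Fold.
Variables (V : finType) (e : rel V).
Hypotheses (es : symmetric e) (ei : irreflexive e).
Implicit Types (A B C S T W : {set V}) (x y v : V) (k : nat).

(** The relation after the path a, v, b has been contracted into a. It is used on
    A minus v and b, where a takes over the neighbours of b. *)
Definition fold a b : rel V :=
  fun x y => [|| e x y, (x == a) && e b y | (y == a) && e b x].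

Lemma fold_sym a b : symmetric (fold a b).
Proof. by move=> x y; rewrite /fold es; case: (e y x) => //=; rewrite orbC. Qed.

Lemma fold_irr a b : e b a = false -> irreflexive (fold a b).
Proof.
by move=> eba x; rewrite /fold ei /=; case: eqP => //= ->; rewrite eba.
Qed.

Lemma fold_off a b x y : x != a -> y != a -> fold a b x y = e x y.
Proof. by rewrite /fold => /negbTE-> /negbTE->; rewrite !orbF. Qed.

Lemma fold_at a b y : e b a = false -> fold a b a y = e a y || e b y.
Proof. by rewrite /fold eqxx => eba; rewrite eba andbF orbF. Qed.

Lemma indep_fold a b S : a \notin S -> indep (fold a b) S = indep e S.
Proof.
move=> aS; apply/indepP/indepP => H x y xS yS; have := H x y xS yS;
by rewrite fold_off //; apply: contraNneq aS => <-.
Qed.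

Variables (A : {set V}) (k : nat) (v a b : V).
Hypotheses (vA : v \in A) (ab : a != b) (eab : e a b = false)
  (nv : nb e A v = [set a; b]) (al : alpha_le e A k.+1).

Let aA : a \in A.
Proof. by move/setP/(_ a): nv; rewrite !inE eqxx => /andP[]. Qed.
Let bA : b \in A.
Proof. by move/setP/(_ b): nv; rewrite !inE eqxx orbT => /andP[]. Qed.
Let eva : e v a.
Proof. by move/setP/(_ a): nv; rewrite !inE eqxx => /andP[]. Qed.
Let evb : e v b.
Proof. by move/setP/(_ b): nv; rewrite !inE eqxx orbT => /andP[]. Qed.
Let vb : v != b. Proof. by apply: contraTneq evb => ->; rewrite ei. Qed.
Let eba : e b a = false. Proof. by rewrite es. Qed.
Let cnv : cn e A v = [set v; a; b].
Proof. by rewrite /cn nv setUA. Qed.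

Lemma fold_del : (A :\: [set v; b]) :\ a = A :\: cn e A v.
Proof.
rewrite cnv; apply/setP => x; rewrite !inE.
by do !case: (_ == _).
Qed.

(** T together with a and b is independent, hence of size at most k + 1. *)
Lemma fold_two T : T \subset A :\: cn e A v -> indep e (a |: T) ->
  indep e (b |: T) -> #|T| < k.
Proof.
move=> sT ia ib; rewrite cnv in sT.
have aT : a \notin T by apply/negP => /(subsetP sT); rewrite !inE eqxx orbT.
have bT : b \notin T by apply/negP => /(subsetP sT); rewrite !inE eqxx !orbT.
have := al (S := a |: (b |: T)).
rewrite !cardsU1 bT !inE negb_or ab aT /= !add1n !ltnS; apply.
  by rewrite !subUset !sub1set aA bA (subset_trans sT) // subsetDl.
move/indepP: ia => ia; move/indepP: ib => ib.
apply/indepP => x y; rewrite !inE => /or3P[/eqP->|/eqP->|xT] /or3P[/eqP->|/eqP->|yT];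
  rewrite ?ei ?eab ?eba //; by [apply: ia; rewrite !inE ?eqxx ?xT ?yT ?orbT
    | apply: ib; rewrite !inE ?eqxx ?xT ?yT ?orbT].
Qed.

(** An independent set of the merged graph lifts to one with one more vertex:
    b if it contains a, and v otherwise. *)
Lemma alpha_fold : alpha_le (fold a b) (A :\: [set v; b]) k.
Proof.
move=> S sS iS; case: (boolP (a \in S)) => aS; last first.
  rewrite indep_fold // in iS.
  apply: (alpha_del es ei vA al) => //; rewrite -fold_del.
  by apply/subsetD1P.
have bS : b \notin S by apply/negP => /(subsetP sS); rewrite !inE eqxx orbT.
have := al (S := b |: S); rewrite cardsU1 bS /= add1n ltnS; apply.
  by rewrite subUset sub1set bA (subset_trans sS) // subsetDl.
move/indepP: iS => iS; apply/indepP => x y.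
have bz z : z \in S -> e b z = false.
  move=> zS; have := iS a z aS zS; rewrite fold_at //.
  by case: (e b z); rewrite ?orbT.
rewrite !inE => /orP[/eqP->|xS] /orP[/eqP->|yS]; rewrite ?ei ?bz //.
  by rewrite es bz.
by have := iS x y xS yS; rewrite /fold; case: (e x y).
Qed.

(** A maximum independent set without v contains a or b. If it contains both,
    the merged vertex a represents them; if it contains only one, that one is
    dropped. *)
Definition fold_map S := if (a \in S) && (b \in S) then S :\ b else S :\: [set a; b].

(** Otherwise v could be added. *)
Lemma fold_hit S : S \in indep_sets e (A :\ v) k.+1 -> (a \in S) || (b \in S).
Proof.
rewrite inE => /and3P[sS iS /eqP cS]; apply/negPn/negP => /norP[aS bS].
  have := alpha_del es ei vA al; move=> /(_ S); rewrite cS ltnn => H.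
  suff /H/(_ iS) : S \subset A :\: cn e A v by [].
  move: sS; rewrite cnv => /subsetD1P[sS vS].
  apply/subsetP => x xS; rewrite !inE (subsetP sS) // andbT.
  by rewrite !negb_or; apply/andP; split; [apply/andP; split|];
     apply: contraTneq xS => ->.
Qed.

Lemma fold_map_in S : S \in indep_sets e (A :\ v) k.+1 ->
  fold_map S \in indep_sets (fold a b) (A :\: [set v; b]) k.
Proof.
move=> SI; have := fold_hit SI; move: SI; rewrite inE => /and3P[/subsetD1P[sS vS] iS /eqP cS] ho.
  rewrite inE /fold_map; case: ifP => [/andP[aS bS]|nab].
    apply/and3P; split.
    - rewrite subsetD (subset_trans (subsetDl _ _) sS) /=.
      rewrite disjoint_sym disjoints_subset subUset !sub1set !inE eqxx /=.
      by rewrite (negbTE vS) andbF.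
    - move/indepP: iS => iS; apply/indepP => x y.
      rewrite !inE => /andP[xb xS] /andP[yb yS].
      by rewrite /fold !iS // !andbF.
    - by apply/eqP; move: cS; rewrite (cardsD1 b) bS => -[].
  apply/and3P; split.
  - apply/subsetP => x; rewrite !inE => /andP[/norP[_ xb] xS].
    rewrite (subsetP sS) // (negbTE xb) orbF andbT.
    by apply: contraNneq vS => <-.
  - rewrite indep_fold; last by rewrite !inE eqxx.
    exact: indepS (subsetDl _ _) iS.
  - apply/eqP; move: cS; rewrite -(cardsID [set a; b] S).
    have -> : #|S :&: [set a; b]| = 1; last by rewrite add1n => -[].
    case/orP: ho => zS; move: nab; rewrite zS ?andbT /= => nz.
      rewrite (_ : _ :&: _ = [set a]) ?cards1 //; apply/setP => x; rewrite !inE.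
      case: (eqVneq x a) => [->|xa] /=; first by rewrite zS.
      by case: eqP => [->|]; rewrite ?nz ?andbF.
    rewrite (_ : _ :&: _ = [set b]) ?cards1 //; apply/setP => x; rewrite !inE.
    case: (eqVneq x b) => [->|xa] /=; first by rewrite zS orbT.
    by rewrite orbF; case: eqP => [->|]; rewrite ?nz ?andbF.
Qed.

(** Two sets with the same image could differ only in having a and b
    exchanged, and then a and b could both be added to the image. *)
Lemma fold_map_inj : {in indep_sets e (A :\ v) k.+1 &, injective fold_map}.
Proof.
have phia (S : {set V}) : (a \in fold_map S) = (a \in S) && (b \in S).
  by rewrite /fold_map; case: ifP => [/andP[aS _]|]; rewrite !inE ?ab ?aS ?eqxx.
move=> S S' SI SI' eqp.
have := phia S; have := phia S'; rewrite -eqp => ->.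
case nS': ((a \in S') && (b \in S')) => /esym nS.
  move: eqp; rewrite /fold_map nS nS' => eqp; move/andP: nS' => [_ bS']; move/andP: nS => [_ bS].
  by rewrite -(setD1K bS) eqp setD1K.
move: eqp; rewrite /fold_map nS nS' => eqp.
have ho := fold_hit SI; have ho' := fold_hit SI'.
move: SI SI'; rewrite !inE => /and3P[/subsetD1P[sS vS] iS /eqP cS]
  /and3P[/subsetD1P[sS' vS'] iS' /eqP cS'].
have rec (U : {set V}) z z' : (z, z') = (a, b) \/ (z, z') = (b, a) -> z \in U -> z' \notin U ->
    U = z |: (U :\: [set a; b]).
  move=> zz zU z'U; apply/setP => x; rewrite !inE.
  case: (eqVneq x z) => [->|xz] /=; first by rewrite zU.
  case: (eqVneq x z') => [->|xz'] /=.
    by rewrite (negbTE z'U) andbF.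
  by case: zz xz xz' => -[-> ->] n1 n2; rewrite (negbTE n1) (negbTE n2).
have sub (U : {set V}) : U \subset A -> v \notin U -> U :\: [set a; b] \subset A :\: cn e A v.
  move=> sU vU; rewrite cnv; apply/subsetP => x; rewrite !inE.
  move=> /andP[/norP[/negbTE-> /negbTE->] xU]; rewrite (subsetP sU) //= !orbF andbT.
  by apply: contraNneq vU => <-.
have card (U : {set V}) : #|U| = k.+1 -> (a \in U) && (b \in U) = false -> a \in U \/ b \in U ->
   #|U :\: [set a; b]| = k.
  move=> cU nU hU; move: (cU); case: hU => zU.
    rewrite {1}(rec U a b) // ?cardsU1; [|by left|by move: nU; rewrite zU /= => ->].
    by rewrite !inE eqxx /= add1n => -[].
  rewrite {1}(rec U b a) // ?cardsU1; [|by right|by move: nU; rewrite zU andbT => ->].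
  by rewrite !inE eqxx orbT /= add1n => -[].
have bad (U U' : {set V}) : #|U| = k.+1 -> a \in U -> b \notin U -> b \in U' -> a \notin U' ->
    U :\: [set a; b] = U' :\: [set a; b] -> U \subset A -> v \notin U ->
    indep e U -> indep e U' -> False.
  move=> cU aU bU bU' aU' E sU vU iU iU'.
  have := fold_two (sub U sU vU); rewrite (card U) ?aU ?(negbTE bU) //; last by left.
  rewrite -(rec U a b) //; last by left.
  by rewrite E -(rec U' b a) ?ltnn //; [move/(_ iU iU') | right].
case aS: (a \in S) nS ho => /= nS ho; case aS': (a \in S') nS' ho' => /= nS' ho'.
- rewrite (rec S a b) ?nS ?aS //; last by left.
  by rewrite eqp -(rec S' a b) ?nS' ?aS' //; left.
- by case: (bad S S'); rewrite ?aS ?aS' ?nS ?ho'.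
- by case: (bad S' S); rewrite ?aS ?aS' ?nS' ?ho // -eqp.
- rewrite (rec S b a) ?ho ?aS //; last by right.
  by rewrite eqp -(rec S' b a) ?ho' ?aS' //; right.
Qed.

Lemma cnt_fold_del : cnt e (A :\ v) k.+1 <= cnt (fold a b) (A :\: [set v; b]) k.
Proof.
rewrite /cnt -(card_in_imset fold_map_inj); apply: subset_leq_card.
by apply/subsetP => _ /imsetP[S SI ->]; apply: fold_map_in.
Qed.

(** A preimage of S0 would contain a or b, but S0 has a neighbour of each. *)
Lemma cnt_fold_del_strict S0 z1 z2 : S0 \subset A :\: cn e A v -> indep e S0 -> #|S0| = k ->
  z1 \in S0 -> e a z1 -> z2 \in S0 -> e b z2 ->
  cnt e (A :\ v) k.+1 < cnt (fold a b) (A :\: [set v; b]) k.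
Proof.
move=> sS0 iS0 cS0 z1S eaz z2S ebz; rewrite /cnt -(card_in_imset fold_map_inj).
have aS0 : a \notin S0 by apply/negP => /(subsetP sS0); rewrite cnv !inE eqxx orbT.
have bS0 : b \notin S0 by apply/negP => /(subsetP sS0); rewrite cnv !inE eqxx !orbT.
apply: proper_card; apply/properP; split.
  by apply/subsetP => _ /imsetP[S SI ->]; apply: fold_map_in.
exists S0.
  rewrite inE cS0 eqxx andbT indep_fold // iS0 andbT.
  apply: subset_trans sS0 _; rewrite cnv; apply: setDS.
  by rewrite !subUset !sub1set !inE !eqxx ?orbT.
apply/imsetP => -[S SI E]; have := fold_hit SI.
move: SI; rewrite inE => /and3P[_ /indepP iS _].
have sub z : z \in S0 -> z \in S.
  by rewrite E /fold_map; case: ifP => _; rewrite !inE => /andP[].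
have [z1' z2'] := (sub _ z1S, sub _ z2S).
by case/orP=> H; [have := iS a z1 H z1' | have := iS b z2 H z2']; rewrite ?eaz ?ebz.
Qed.

Lemma cnt_fold :
  cnt e A k.+1 <= cnt e (A :\: cn e A v) k + cnt (fold a b) (A :\: [set v; b]) k.
Proof. by rewrite (cnt_del es ei k vA) addnC leq_add2l cnt_fold_del. Qed.

Lemma card_fold : #|A :\: [set v; b]| = #|A| - 2.
Proof.
rewrite cardsD (setIidPr _) ?cards2 ?vb //.
by rewrite subUset !sub1set vA bA.
Qed.

Lemma card_fold_del : #|A :\: cn e A v| = #|A| - 3.
Proof. by rewrite card_del_cn // nv cards2 ab. Qed.

End Fold.

(** * Stability of the Moon-Moser bound *)

(** This and the next two inequalities are the gaps of the branchings of
    [triangles_or_few], by the degree of the vertex used. *)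
Lemma gap_arith s : 0 < s -> 9 * (2 * g (3 * s) + g (3 * s - 1)) <= 8 * g (3 * s.+1).
Proof.
case: s => // s _; rewrite (_ : 3 * s.+1 - 1 = 3 * s + 2) ?g2 ?g0; last lia.
by rewrite !expnS; move: (3 ^ s) => X; lia.
Qed.

Lemma gap_arith1 s : 9 * (2 * g (3 * s + 1)) <= 8 * g (3 * s.+1).
Proof.
case: s => // s; rewrite (_ : 3 * s.+1 + 1 = 3 * s + 4) ?g1 ?g0; last lia.
by rewrite !expnS; move: (3 ^ s) => X; lia.
Qed.

Lemma gap_arith2 s : 9 * g (3 * s + 2) <= 8 * g (3 * s.+1).
Proof. by rewrite g2 g0 expnS; move: (3 ^ s) => X; lia. Qed.

Section Stability.
Variables (V : finType) (e : rel V).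
Hypotheses (es : symmetric e) (ei : irreflexive e).
Implicit Types (A B C S T W : {set V}) (x y v : V) (k : nat).

Lemma nb2P A v : #|nb e A v| = 2 -> exists a b, [/\ a != b & nb e A v = [set a; b]].
Proof. by move/eqP/cards2P => [a [b [ab E]]]; exists a, b. Qed.

Lemma nb_memP A v x : (x \in nb e A v) -> [/\ x \in A, e v x, e x v & x != v].
Proof.
rewrite inE => /andP[xA evx]; split=> //; first by rewrite es.
by apply: contraTneq evx => ->; rewrite ei.
Qed.

Lemma cnt_del_cn_le A k x n : x \in A -> alpha_le e A k.+1 -> #|A| <= n + #|nb e A x|.+1 ->
  cnt e (A :\: cn e A x) k <= g n.
Proof.
move=> xA al H; apply: (cnt_le_gn es ei); first exact: (alpha_del es ei xA al).
by rewrite (card_del_cn ei xA); narith.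
Qed.

Lemma sum_cn2 A v a b (f : V -> nat) : a != b -> nb e A v = [set a; b] ->
  \sum_(x in cn e A v) f x = f v + f a + f b.
Proof.
move=> ab nv; rewrite /cn big_setU1 ?nb_irr //= nv big_setU1 ?inE //=.
by rewrite big_set1 addnA.
Qed.

Lemma sum_cn1 A v a (f : V -> nat) : nb e A v = [set a] ->
  \sum_(x in cn e A v) f x = f v + f a.
Proof.
by move=> nv; rewrite /cn big_setU1 ?nb_irr //= nv big_set1.
Qed.

Lemma cnt_min_degree A k v : v \in A -> alpha_le e A k.+1 ->
  (forall x, x \in A -> #|nb e A v| <= #|nb e A x|) ->
  cnt e A k.+1 <= #|nb e A v|.+1 * g (#|A| - #|nb e A v|.+1).
Proof.
move=> vA al vmin; apply: leq_trans (cnt_nbhd es ei vA al) _.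
rewrite -(card_cn ei A) -sum_nat_const; apply: leq_sum => x xC.
have xA := subsetP (cn_sub e vA) _ xC.
by apply: cnt_del_cn_le => //; rewrite card_cn //; move: (vmin x xA) (nb_lt ei xA); narith.
Qed.

(** Branch at a vertex v of minimum degree. Unless this degree is 2, the factor
    8/9 is lost at once. If it is 2, the factor is lost when a neighbour of v has
    larger degree, and also when the two neighbours are nonadjacent, as merging
    them shows. Otherwise v lies in a component that is a triangle, and
    induction applies to the rest. *)
Theorem triangles_or_few s A k : alpha_le e A k -> #|A| = 3 * s ->
  triangles e A \/ 9 * cnt e A k <= 8 * g (3 * s).
Proof.
elim: s A k => [|s IH] A k al cA.
  by left => x; move/eqP: cA; rewrite muln0 cards_eq0 => /eqP->; rewrite inE.
have A0 : A != set0 by rewrite -card_gt0 cA mulnS.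
case: k al => [|k] al.
  by move: A0; rewrite (alpha_le0 ei al) eqxx.
have [v vA vmin] := min_degree e A0.
have bound := cnt_min_degree vA al vmin; rewrite cA in bound.
have vlt := nb_lt ei vA; rewrite cA in vlt.
have g1' := gap_arith1 s.
have g2' := gap_arith2 s.
have g3' : g (3 * s.+1) = 3 * g (3 * s) by rewrite !g0 expnS.
case d: #|nb e A v| bound vlt => [|[|[|d']]] bound vlt.
- right; move: bound; rewrite (_ : _ - _ = 3 * s + 2); narith.
- right; move: bound; rewrite (_ : _ - _ = 3 * s + 1); narith.
- have [a [b [ab nv]]] := nb2P d.
  have [aA eva eav av] := nb_memP (A := A) (v := v) (x := a) ltac:(by rewrite nv !inE eqxx).
  have [bA evb ebv bv] := nb_memP (A := A) (v := v) (x := b) ltac:(by rewrite nv !inE eqxx orbT).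
  have gm := @gap_arith s.
  have := cnt_nbhd es ei vA al; rewrite (sum_cn2 _ ab nv).
  have b1 := @cnt_del_cn_le A k v (3 * s) vA al ltac:(rewrite cA; narith).
  have da2 := vmin a aA; have db2 := vmin b bA; rewrite d in da2 db2.
  have b2 := @cnt_del_cn_le A k a (3 * s) aA al ltac:(rewrite cA; narith).
  have b3 := @cnt_del_cn_le A k b (3 * s) bA al ltac:(rewrite cA; narith).
  case: (ltnP 2 #|nb e A a|) => da.
    have b4 := @cnt_del_cn_le A k a (3 * s - 1) aA al ltac:(rewrite cA; narith).
    have s0 : 0 < s by move: (nb_lt ei aA); rewrite cA; narith.
    by right; move: (gm s0); narith.
  case: (ltnP 2 #|nb e A b|) => db.
    have b4 := @cnt_del_cn_le A k b (3 * s - 1) bA al ltac:(rewrite cA; narith).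
    have s0 : 0 < s by move: (nb_lt ei bA); rewrite cA; narith.
    by right; move: (gm s0); narith.
  case eab: (e a b); last first.
    have b5 := cnt_fold es ei vA ab eab nv al.
    have al' := alpha_fold es ei vA eab nv al.
    move=> _; right; case: k al al' b5 {bound b1 b2 b3} => [|k] al al' b5.
      by rewrite !cnt0 in b5; move: (g_gt0 (3 * s)); narith.
    move: b5; rewrite (cnt_del (fold_sym es a b) (fold_irr ei _) _ (v := a)); last first.
    + by rewrite inE aA !inE negb_or av ab.
    + by rewrite es.
    rewrite (fold_del nv) (eq_cnt (e' := e)); last first.
      move=> x y; rewrite -(fold_del nv) !inE => /andP[xa _] /andP[ya _].
      exact: fold_off.
    have b1 := @cnt_del_cn_le A k.+1 v (3 * s) vA al ltac:(rewrite cA; narith).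
    set X := cnt _ _ k.
    have s0 : 0 < s.
      have : 0 < #|nb e A a :\ v| by move: da2; rewrite (cardsD1 v) inE vA eav; narith.
      case/card_gt0P => c; rewrite !inE => /and3P[cv cA' eac].
      have : #|[set v; a; b; c]| <= #|A|.
        by apply: subset_leq_card; rewrite !subUset !sub1set vA aA bA.
      rewrite setUC cardsU1 cards3 ?cA; last by rewrite /= !inE negb_or !(eq_sym v) av bv ab.
      rewrite !inE !negb_or cv.
      have -> : c != a by apply: contraTneq eac => ->; rewrite ei.
      have -> : c != b by apply: contraTneq eac => ->; rewrite eab.
      by narith.
    suff XX : X <= g (3 * s - 1) by move: (gm s0); narith.
    rewrite /X => {X}.
    have eba : e b a = false by rewrite es.
    have fi := fold_irr ei eba; have fs := fold_sym es a b.
    have aF : a \in A :\: [set v; b] by rewrite inE aA !inE negb_or av ab.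
    apply: (cnt_le_gn fs fi); first exact: (alpha_del fs fi aF al').
    rewrite (card_del_cn fi aF) (card_fold ei vA nv) cA.
    suff : 0 < #|nb (fold e a b) (A :\: [set v; b]) a| by narith.
    (* after the merge, a keeps its neighbour c other than v *)
    have : 0 < #|nb e A a :\ v| by move: da2; rewrite (cardsD1 v) inE vA eav; narith.
    case/card_gt0P => c; rewrite !inE => /and3P[cv cA' eac].
    apply/card_gt0P; exists c; rewrite !inE cA' negb_or cv /fold eac /= andbT.
    by rewrite andbT; apply: contraTneq eac => ->; rewrite eab.
  have na : nb e A a = [set v; b].
    apply/esym/eqP; rewrite eqEcard subUset !sub1set !inE vA bA eav eab /=.
    by rewrite cards2 eq_sym bv da.
  have nb' : nb e A b = [set v; a].
    apply/esym/eqP; rewrite eqEcard subUset !sub1set !inE vA aA ebv es eab /=.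
    by rewrite cards2 eq_sym av db.
  have cnv : cn e A v = [set v; a; b] by rewrite /cn nv setUA.
  have cna : cn e A a = [set v; a; b].
    by rewrite /cn na; apply/setP => x; rewrite !inE; do !case: (_ == _).
  have cnb : cn e A b = [set v; a; b].
    by rewrite /cn nb'; apply/setP => x; rewrite !inE; do !case: (_ == _).
  rewrite cnv cna cnb => le3.
  have alD := alpha_del es ei vA al; rewrite cnv in alD.
  have cD : #|A :\: [set v; a; b]| = 3 * s.
    by rewrite -cnv card_del_cn // cA d; narith.
  case: (IH _ _ alD cD) => [tD|few]; last by right; narith.
  left => x xA; case: (boolP (x \in [set v; a; b])) => xT.
    move: xT; rewrite !inE -orbA => /or3P[] /eqP->; [exists a, b | exists v, b | exists v, a].
    + by [].
    + by rewrite eq_sym.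
    + by rewrite eq_sym.
  have [y [z [yz eyz E]]] := tD x ltac:(by rewrite inE xT).
  exists y, z; split=> //; rewrite -E; apply/setP => w; rewrite !inE.
  case wA: (w \in A); rewrite ?andbF //= andbT.
  case exw: (e x w); rewrite ?andbF //= andbT.
  apply/esym/negP => wT; have : x \in [set v; a; b]; last by rewrite (negbTE xT).
  case/orP: wT => [/orP[]|] /eqP E'; rewrite E' in exw.
  + by rewrite -cnv in_cn xA es exw orbT.
  + by rewrite -cna in_cn xA es exw orbT.
  + by rewrite -cnb in_cn xA es exw orbT.
- right; set j := d'.+4 in bound *.
  have : j * g (3 * s.+1 - j) <= 2 * g (3 * s + 1); last by narith.
  apply: leq_trans (_ : 2 * ((j - 2) * g (3 * s.+1 - j)) <= _).
    by rewrite mulnA leq_mul2r /j; narith.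
  rewrite leq_mul2l /=; apply: leq_trans (g_mul _ _) _; first by rewrite /j.
  by apply: g_mono; rewrite /j; narith.
Qed.

(** The only graphs on four vertices that attain the Moon-Moser number are K4
    and two disjoint edges. *)
Theorem four_vertices A k : alpha_le e A k -> #|A| = 4 -> 4 <= cnt e A k ->
  (forall x y, x \in A -> y \in A -> x != y -> e x y) \/
  exists x y z w, [/\ uniq [:: x; y; z; w], A = [set x; y; z; w],
    e x y, e z w & forall a b, a \in [set x; y] -> b \in [set z; w] -> e a b = false].
Proof.
move=> al cA c4.
have A0 : A != set0 by rewrite -card_gt0 cA.
case: k al c4 => [|k] al c4; first by move: A0; rewrite (alpha_le0 ei al) eqxx.
have [v vA vmin] := min_degree e A0.
have bound := cnt_min_degree vA al vmin; rewrite cA in bound.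
have vlt := nb_lt ei vA; rewrite cA in vlt.
case d: #|nb e A v| bound vlt => [|[|[|[|d']]]] bound vlt //.
- by move: bound; rewrite !subSS subn0 !g_vals; narith.
- have /cards1P[u nv] : #|nb e A v| == 1 by rewrite d.
  have [uA evu euv uv] := nb_memP (A := A) (v := v) (x := u) ltac:(by rewrite nv inE).
  have := cnt_nbhd es ei vA al; rewrite (sum_cn1 _ nv).
  have b1 := @cnt_del_cn_le A k v 2 vA al ltac:(rewrite cA; narith).
  case: (ltnP 1 #|nb e A u|) => du.
    have b2 := @cnt_del_cn_le A k u 1 uA al ltac:(rewrite cA; narith).
    by move: c4 b1 b2; rewrite !g_vals; narith.
  have nu : nb e A u = [set v].
    by apply/esym/eqP; rewrite eqEcard sub1set inE vA euv cards1.
  move=> c5; right.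
  have := card_del_cn ei vA; rewrite cA d => /eqP/cards2P[z [w [zw E]]].
  have cnv : cn e A v = [set v; u] by rewrite /cn nv.
  have cnu : cn e A u = [set v; u] by rewrite /cn nu setUC.
  have zD : z \in A :\: cn e A v by rewrite E !inE eqxx.
  have wD : w \in A :\: cn e A v by rewrite E !inE eqxx orbT.
  move: (zD) (wD); rewrite cnv !inE => /andP[/norP[zv zu] zA] /andP[/norP[wv wu] wA].
  exists v, u, z, w; split=> //.
  + by rewrite /= !inE !negb_or eq_sym uv eq_sym zv eq_sym wv eq_sym zu eq_sym wu zw.
  + rewrite -setUA -E cnv; apply/setP => x; rewrite !inE.
    case: (eqVneq x v) => [->|]; first by rewrite vA.
    by case: (eqVneq x u) => [->|].
  + apply/negPn/negP => nzw.
    have alD := alpha_del es ei vA al.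
    have i2 : indep e [set z; w].
      apply/indepP => a b; rewrite !inE => /orP[] /eqP-> /orP[] /eqP->; rewrite ?ei //.
        exact: negbTE.
      by rewrite es; apply: negbTE.
    have := alD [set z; w]; rewrite E cards2 zw => /(_ (subxx _) i2) k2.
    move: c4 c5; rewrite cnv cnu -cnv E.
    have le1 : cnt e [set z; w] k <= 1.
      case: (eqVneq k 2) => [->|k2']; last first.
        rewrite /cnt (eq_card0 (_ : _ =i pred0)) // => S; rewrite !inE; apply/and3P => -[sS _ /eqP cS].
        by have := subset_leq_card sS; rewrite cards2 zw cS; move: k2 k2'; clear; lia.
      apply: leq_trans (_ : #|[set [set z; w]]| <= 1); last by rewrite cards1.
      apply: subset_leq_card; apply/subsetP => S.
      rewrite !inE => /and3P[sS _ /eqP cS].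
      by rewrite eqEcard sS cards2 zw cS.
    by narith.
  + move=> a b; rewrite !inE => /orP[] /eqP-> /orP[] /eqP->.
    * by have := in_nb e A v z; rewrite nv inE (negbTE zu) zA.
    * by have := in_nb e A v w; rewrite nv inE (negbTE wu) wA.
    * by have := in_nb e A u z; rewrite nu inE (negbTE zv) zA.
    * by have := in_nb e A u w; rewrite nu inE (negbTE wv) wA.
- by move: bound; rewrite !subSS subn0 !g_vals; narith.
- left => x y xA yA xy.
  have : nb e A x = A :\ x.
    apply/eqP; rewrite eqEcard; apply/andP; split.
      by apply/subsetP => z /nb_memP[zA _ _ zx]; rewrite !inE zx.
    by have := vmin x xA; move: cA; rewrite (cardsD1 x) xA d; narith.
  by move/setP/(_ y); rewrite !inE eq_sym xy yA.
Qed.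

End Stability.

(** * Connected vertex sets *)

Section Connected.
Variables (V : finType).
Implicit Types (e : rel V) (A B C R S T W : {set V}) (x y v : V).

(** Connectedness by cuts, so that it makes sense for subsets without changing
    the type of vertices; the empty set is connected. *)
Definition conn e A := forall B, B \subset A -> B != set0 ->
  (forall x y, x \in B -> y \in A -> e x y -> y \in B) -> B = A.

(** The boolean form, to choose maximal connected sets. *)
Definition connb e A := [forall B : {set V}, [&& B \subset A, B != set0 &
  [forall x in B, forall y in A, e x y ==> (y \in B)]] ==> (B == A)].

Lemma connP e A : reflect (conn e A) (connb e A).
Proof.
apply: (iffP forallP) => [H B sB B0 cl|H B].
  apply/eqP/(implyP (H B)); rewrite sB B0; apply/forall_inP => x xB.
  by apply/forall_inP => y yA; apply/implyP; apply: cl.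
apply/implyP => /and3P[sB B0 /forall_inP cl]; apply/eqP; apply: H => // x y xB yA.
by apply/implyP; move/forall_inP: (cl x xB); apply.
Qed.

Lemma conn0 e : conn e set0.
Proof. by move=> B; rewrite subset0 => /eqP-> /eqP. Qed.

Lemma conn1 e x : conn e [set x].
Proof.
move=> B; rewrite subset1 => /orP[/eqP->//|/eqP->]; by rewrite eqxx.
Qed.

Lemma conn_add e A x y : symmetric e -> conn e A -> x \in A -> e x y -> conn e (y |: A).
Proof.
move=> es cA xA exy B sB B0 cl.
case: (boolP (A :&: B == set0)) => [/eqP AB|AB].
  have xB : x \notin B by apply/negP => xB; move/setP/(_ x): AB; rewrite !inE xA xB.
  have sub z : z \in B -> z = y.
    move=> zB; have := subsetP sB z zB; rewrite !inE => /orP[/eqP//|zA].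
    by move/setP/(_ z): AB; rewrite !inE zA zB.
  case/set0Pn: B0 => z zB; have zy := sub z zB; rewrite zy in zB.
  by have := cl y x zB; rewrite es inE xA orbT (negbTE xB) => /(_ isT exy).
have EA : A :&: B = A.
  apply: cA => //; first exact: subsetIl.
  move=> u w; rewrite !inE => /andP[_ uB] wA euw; rewrite wA.
  by apply: cl euw => //; rewrite inE wA orbT.
have sAB : A \subset B by apply/setIidPl.
apply/eqP; rewrite eqEsubset sB subUset sAB sub1set andbT.
by apply: (cl x); rewrite ?(subsetP sAB) // inE set11.
Qed.

Lemma conn_edge e A B : conn e A -> B \subset A -> B != set0 -> B != A ->
  exists x y, [/\ x \in B, y \in A, y \notin B & e x y].
Proof.
move=> cA sB B0 BA.
case: (boolP [exists x in B, exists y in A, (y \notin B) && e x y]).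
  by case/exists_inP => x xB /exists_inP[y yA /andP[yB exy]]; exists x, y.
move=> H; case/eqP: BA; apply: cA => // x y xB yA exy; apply: contraNT H => yB.
by apply/exists_inP; exists x => //; apply/exists_inP; exists y; rewrite ?yB.
Qed.

Lemma conn_path e A x y : conn e A -> x \in A -> y \in A ->
  exists p, [/\ path e x p, last x p = y, uniq (x :: p) & {subset x :: p <= A}].
Proof.
move=> cA xA yA; pose r a b := e a b && (b \in A).
have /setP/(_ y) : [set z in A | connect r x z] = A.
  apply: cA.
  - by apply/subsetP => z; rewrite inE => /andP[].
  - by apply/set0Pn; exists x; rewrite inE xA connect0.
  - move=> a b; rewrite !inE => /andP[aA xa] bA eab; rewrite bA.
    by apply: connect_trans xa (connect1 _); rewrite /r eab.
rewrite inE yA /= => /connectP[p0 pp0 yE]; rewrite yE.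
case/shortenP: pp0 => p pp up _; exists p; split=> //.
  by apply: sub_path pp => a b /andP[].
have : all (mem A) p.
  elim: p (x) pp {up yE} => //= a p IH b /andP[/andP[_ aA] pp].
  by rewrite aA (IH a).
by move=> /allP pA z; rewrite inE => /orP[/eqP->|/pA].
Qed.

Lemma conn_of_connect e A : (forall x y, x \in A -> y \in A ->
    connect [rel a b | [&& e a b, a \in A & b \in A]] x y) -> conn e A.
Proof.
move=> H B sB /set0Pn[x xB] cl; apply/eqP; rewrite eqEsubset sB.
apply/subsetP => y yA; have /connectP[p pp ->] := H x y (subsetP sB x xB) yA.
elim: p x xB pp => //= a p IH x xB /andP[/and3P[exa xA aA] pp].
by apply: IH => //; apply: cl exa.
Qed.

Lemma conn_sub_rel e e' A : (forall x y, x \in A -> y \in A -> e x y -> e' x y) ->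
  conn e A -> conn e' A.
Proof.
move=> sub cA B sB B0 cl; apply: cA => // x y xB yA exy; apply: (cl x) => //.
by apply: sub => //; apply: (subsetP sB).
Qed.

Lemma conn_leaf_del e A v u : symmetric e -> conn e A -> v \in A -> nb e A v = [set u] ->
  conn e (A :\ v).
Proof.
move=> es cA vA nv B sB B0 cl.
have vB : v \notin B by apply/negP => /(subsetP sB); rewrite !inE eqxx.
have nbv x : x \in A -> e x v -> x = u.
  by move=> xA exv; apply/set1P; rewrite -nv inE xA es.
case: (boolP (u \in B)) => uB.
  have -> : A = v |: B; last by rewrite setU1K.
  apply/esym/cA.
  - by rewrite subUset sub1set vA (subset_trans sB) // subsetDl.
  - by apply/set0Pn; exists v; rewrite !inE eqxx.
  move=> x y; rewrite !inE => xB yA exy; case: (eqVneq y v) => //= yv.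
  case/orP: xB => [/eqP xv|xB]; first by rewrite (nbv y yA) // es -xv.
  by apply: (cl x); rewrite ?inE ?yv.
have BA : B = A.
  apply: cA => //; first exact: subset_trans sB (subsetDl _ _).
  move=> x y xB yA exy; apply: (cl x) => //; rewrite !inE yA andbT.
  apply: contraNneq uB => yv; rewrite -(nbv x) // -?yv //.
  by have := subsetP sB x xB; rewrite inE => /andP[].
by rewrite BA vA in vB.
Qed.

Lemma conn_fold e A v a b : symmetric e -> irreflexive e -> a != b -> v \in A ->
  nb e A v = [set a; b] -> conn e A -> conn (fold e a b) (A :\: [set v; b]).
Proof.
move=> es ei ab vA nv cA B sB B0 cl.
have aux z : z \in B -> [/\ z \in A, z != v & z != b].
  by move=> /(subsetP sB); rewrite !inE negb_or => /andP[/andP[-> ->] ->].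
have nbv x : x \in A -> e v x -> x \in [set a; b] by move=> xA evx; rewrite -nv inE xA.
have bA : b \in A by move/setP/(_ b): nv; rewrite !inE eqxx orbT => /andP[].
have vB : v \notin B by apply/negP => /aux[_]; rewrite eqxx.
have bB : b \notin B by apply/negP => /aux[_ _]; rewrite eqxx.
case: (boolP (a \in B)) => aB.
  have E : [set v; b] :|: B = A.
    apply: cA.
    - by rewrite !subUset !sub1set vA bA (subset_trans sB) // subsetDl.
    - by apply/set0Pn; exists v; rewrite !inE eqxx.
    move=> x y; rewrite !inE => xB yA exy.
    case: (eqVneq y v) => //= yv; case: (eqVneq y b) => //= yb.
    case/orP: xB => [/orP[]/eqP xE|xB]; last 1 first.
    - by apply: (cl x); rewrite ?inE ?negb_or ?yv ?yb // /fold exy.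
    - rewrite xE in exy; have := nbv y yA exy; rewrite !inE (negbTE yb) orbF.
      by move=> /eqP ya; rewrite ya.
    - rewrite xE in exy; apply: (cl a); rewrite ?inE ?negb_or ?yv ?yb //.
      by rewrite /fold eqxx exy orbT.
  apply/setP => z; rewrite -E !inE.
  case: (eqVneq z v) => [->|] /=; first by rewrite (negbTE vB).
  by case: (eqVneq z b) => [->|] /=; first by rewrite (negbTE bB).
have BA : B = A.
  apply: cA => //; first exact: subset_trans sB (subsetDl _ _).
  move=> x y xB yA exy; have [xA xv xb] := aux x xB.
  apply: (cl x) => //; last by rewrite /fold exy.
  rewrite !inE yA andbT negb_or; apply/andP; split.
    apply: contraNneq aB => yv; have := nbv x xA.
    rewrite es -yv => /(_ exy); rewrite !inE (negbTE xb) orbF => /eqP<- //.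
  apply: contraNneq aB => yb; apply: (cl x) => //.
    rewrite !inE negb_or; move/setP/(_ a): nv; rewrite !inE eqxx => /andP[-> eva].
    have -> : a != v by apply: contraTneq eva => ->; rewrite ei.
    by rewrite ab.
  by rewrite /fold eqxx es yb in exy *; rewrite exy !orbT.
by rewrite BA vA in vB.
Qed.

Definition dele e a d : rel V :=
  fun x y => e x y && ~~ ((x == a) && (y == d) || (x == d) && (y == a)).

Lemma dele_sym e a d : symmetric e -> symmetric (dele e a d).
Proof.
move=> es x y; rewrite /dele es; congr (_ && ~~ _).
by rewrite orbC; congr (_ || _); rewrite andbC.
Qed.

Lemma dele_irr e a d : irreflexive e -> irreflexive (dele e a d).
Proof. by move=> ei x; rewrite /dele ei. Qed.

Lemma dele_sub e a d : subrel (dele e a d) e.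
Proof. by move=> x y /andP[]. Qed.

Lemma dele_fewer e x y : e x y ->
  #|[set p : V * V | dele e x y p.1 p.2]| < #|[set p : V * V | e p.1 p.2]|.
Proof.
move=> exy; apply: proper_card; apply/properP; split.
  by apply/subsetP => p; rewrite !inE; apply: dele_sub.
by exists (x, y); rewrite inE /= ?exy // /dele !eqxx andbF.
Qed.

(** The vertex a remains attached to the connected set A \ a through q. *)
Lemma conn_dele e A a d q : symmetric e -> conn e (A :\ a) -> a \in A -> q \in A ->
  q != a -> q != d -> e a q -> conn (dele e a d) A.
Proof.
move=> es cA aA qA qa qd eaq; rewrite -(setD1K aA).
apply: (@conn_add _ _ q); first exact: dele_sym.
- apply: conn_sub_rel cA => x y; rewrite !inE => /andP[xa _] /andP[ya _].
  by rewrite /dele (negbTE xa) (negbTE ya) andbF => ->.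
- by rewrite !inE qa.
by rewrite /dele es eaq (negbTE qa) (negbTE qd).
Qed.

(** Choose R as large as possible among the components of the A \ u, over all u,
    that are not all of A \ u; the empty set is admitted. If deleting q outside
    u and R left A disconnected, then the component of A \ q containing u and R
    would be a larger choice. *)
Lemma end_piece e A : symmetric e -> conn e A -> 1 < #|A| ->
  exists u R, [/\ u \in A, R \subset A :\ u, conn e R &
    [/\ forall x y, x \in R -> y \in A -> e x y -> y \in u |: R,
        u |: R != A &
        forall q, q \in A -> q \notin u |: R -> conn e (A :\ q)]].
Proof.
move=> es cA cardA.
pose P (p : V * {set V}) := [&& p.1 \in A, p.2 \subset A :\ p.1, connb e p.2,
  [forall x in p.2, forall y in A, e x y ==> (y \in p.1 |: p.2)] &
  p.1 |: p.2 != A].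
have [u0 u0A] : exists u, u \in A by apply/set0Pn; rewrite -card_gt0; lia.
have P0 : P (u0, set0).
  rewrite /P /= u0A sub0set; apply/and5P; split=> //.
  - by apply/connP; apply: conn0.
  - by apply/forall_inP => x; rewrite inE.
  by apply: contraTneq cardA => <-; rewrite setU0 cards1.
have [[u R] /= PuR max] := arg_maxnP (fun p : V * {set V} => #|p.2|) P0.
move: (PuR); rewrite /P /= => /and5P[uA sR /connP cR /forall_inP clR nA].
have cl x y : x \in R -> y \in A -> e x y -> y \in u |: R.
  by move=> xR yA; apply/implyP; move/forall_inP: (clR x xR); apply.
exists u, R; split=> //; split=> // q qA qR.
apply/connP/negPn/negP => ncq.
have uR : u \notin R by apply/negP => /(subsetP sR); rewrite !inE eqxx.
have c1 : conn e (u |: R).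
  case: (eqVneq R set0) => [->|R0]; first by rewrite setU0; apply: conn1.
  have sRA : R \subset A := subset_trans sR (subsetDl _ _).
  have RA : R != A by apply: contraNneq uR => ->.
  have [x [y [xR yA yR exy]]] := conn_edge cA sRA R0 RA.
  have := cl x y xR yA exy; rewrite !inE (negbTE yR) orbF => /eqP yu.
  by apply: (@conn_add _ _ x) => //; rewrite -yu.
have s1 : u |: R \subset A :\ q.
  rewrite subsetD1 qR andbT subUset sub1set uA; exact: subset_trans sR (subsetDl _ _).
pose Q (X : {set V}) := connb e X && (X \subset A :\ q).
have Q1 : Q (u |: R) by rewrite /Q s1 andbT; apply/connP.
have [R' /maxsetP[/andP[/connP cR' sR'] maxR'] sRR'] := maxset_exists Q1.
have qR' : q \notin R' by apply/negP => /(subsetP sR'); rewrite !inE eqxx.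
have := max (q, R'); rewrite /P /= qA sR' /=.
have -> : connb e R' by apply/connP.
have -> : q |: R' != A.
  apply: contraNneq ncq => <-; rewrite setU1K //; exact/connP.
rewrite andbT /=; have -> : [forall x in R', forall y in A, e x y ==> (y \in q |: R')].
  apply/forall_inP => x xR'; apply/forall_inP => y yA; apply/implyP => exy.
  rewrite !inE; case: (eqVneq y q) => //= yq.
  have <- : y |: R' = R'; last by rewrite !inE eqxx.
  apply: maxR'; last exact: subsetUr.
  apply/andP; split; first by apply/connP; apply: conn_add exy.
  by rewrite subUset sub1set !inE yq yA.
by move=> /(_ isT); move: (subset_leq_card sRR'); rewrite cardsU1 uR; narith.
Qed.

End Connected.

(** * Cycles in a vertex set *)

Definition pairs (T : Type) (c : seq T) := zip c (rot 1 c).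

Lemma pairs_cons (T : Type) (x : T) c : pairs (x :: c) = zip (x :: c) (rcons c x).
Proof. by rewrite /pairs rot1_cons. Qed.

Section Cycles.
Variables (V : finType).
Implicit Types (e : rel V) (A B C R S T W : {set V}) (x y v : V) (c : seq V)
  (F : {set {set V}}).

Definition cedges c : {set {set V}} := [set [set x; next c x] | x in c].

Definition cycles e A : {set {set {set V}}} :=
  [set F | [exists k : 'I_#|V|.+1, exists c : k.-tuple V,
     [&& 2 < k, cycle e c, uniq c, all (mem A) c & F == cedges c]]].

Definition ncyc e A := #|cycles e A|.

Lemma cyclesP e A F :
  reflect (exists c, [/\ 2 < size c, cycle e c, uniq c, {subset c <= A} & F = cedges c])
          (F \in cycles e A).
Proof.
rewrite inE; apply: (iffP existsP).
  case=> k /existsP[c /and5P[k2 cc uc /allP sc /eqP ->]]; exists c.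
  by split; rewrite ?size_tuple.
case=> c [c2 cc uc sc ->]; have sV : size c < #|V|.+1.
  by rewrite ltnS -(card_uniqP uc) max_card.
exists (Ordinal sV); apply/existsP; exists (in_tuple c).
by apply/and5P; split=> //; apply/allP.
Qed.

Lemma set2_inj (x y a b : V) : [set x; y] = [set a; b] -> (x = a /\ y = b) \/ (x = b /\ y = a).
Proof.
move=> E.
have: x \in [set a; b] by rewrite -E set21.
have: y \in [set a; b] by rewrite -E set22.
have: a \in [set x; y] by rewrite E set21.
have: b \in [set x; y] by rewrite E set22.
rewrite !inE.
case/orP=> /eqP h1; case/orP=> /eqP h2; case/orP=> /eqP h3; case/orP=> /eqP h4;
subst; first [by left; split | by right; split].
Qed.

Lemma mem_pairs_next c x y : uniq c -> ((x, y) \in pairs c) = (x \in c) && (next c x == y).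
Proof.
move=> uc; case: c uc => // z c uc; rewrite pairs_cons.
have sz : size (z :: c) = size (rcons c z) by rewrite size_rcons.
apply/(nthP (z, z))/andP => [[i]|[xc /eqP <-]].
  rewrite size_zip -sz minnn => ilt; rewrite nth_zip // => -[<- <-].
  rewrite mem_nth //; split=> //; apply/eqP.
  rewrite next_nth mem_nth // index_uniq // nth_rcons.
  move: ilt; rewrite /= ltnS leq_eqVlt => /orP[/eqP->|->//].
  by rewrite ltnn eqxx nth_default.
exists (index x (z :: c)); first by rewrite size_zip -sz minnn index_mem.
rewrite nth_zip // nth_index // next_nth xc nth_rcons; congr (_, _).
have := xc; rewrite -index_mem /= ltnS leq_eqVlt => /orP[/eqP E|-> //].
by rewrite E ltnn eqxx nth_default.
Qed.

Lemma cedgesE c : uniq c -> cedges c = [set [set p.1; p.2] | p in pairs c].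
Proof.
move=> uc; apply/setP => E; apply/imsetP/imsetP.
  by case=> x xc ->; exists (x, next c x) => //; rewrite mem_pairs_next // xc eqxx.
by case=> -[x y]; rewrite mem_pairs_next //= => /andP[xc /eqP<-] ->; exists x.
Qed.

Lemma mem_cedges c a b : uniq c ->
  ([set a; b] \in cedges c) = ((a, b) \in pairs c) || ((b, a) \in pairs c).
Proof.
move=> uc; rewrite cedgesE //; apply/imsetP/orP => [[[x y] xy] /=|].
  by case/set2_inj=> -[-> ->]; [left | right].
by case=> H; [exists (a, b) | exists (b, a)] => //=; rewrite setUC.
Qed.

Lemma cover_cedges c : cover (cedges c) = [set x in c].
Proof.
apply/setP => x; rewrite inE; apply/bigcupP/idP.
  case=> E /imsetP[y yc ->]; rewrite !inE => /orP[] /eqP-> //.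
  by rewrite mem_next.
by move=> xc; exists [set x; next c x]; [exact: imset_f | exact: set21].
Qed.

Lemma ncycS e A B : A \subset B -> ncyc e A <= ncyc e B.
Proof.
move=> /subsetP sAB; apply: subset_leq_card; apply/subsetP => F /cyclesP[c [? ? ? sc ->]].
by apply/cyclesP; exists c; split=> // x /sc /sAB.
Qed.

Lemma ncyc_sub_rel e e' A : subrel e e' -> ncyc e A <= ncyc e' A.
Proof.
move=> sub; apply: subset_leq_card; apply/subsetP => F /cyclesP[c [? cc ? sc ->]].
by apply/cyclesP; exists c; split=> //; apply: sub_cycle cc.
Qed.

Lemma cover_cycle e A F : F \in cycles e A -> cover F \subset A.
Proof.
case/cyclesP=> c [_ _ _ sc ->]; rewrite cover_cedges.
by apply/subsetP => x; rewrite inE => /sc.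
Qed.

(** Cycles that leave B are not counted in B. *)
Lemma new_cycles e A B (Fs : {set {set {set V}}}) : B \subset A ->
  Fs \subset cycles e A -> (forall F, F \in Fs -> ~~ (cover F \subset B)) ->
  ncyc e B + #|Fs| <= ncyc e A.
Proof.
move=> sBA sF nF; rewrite /ncyc -cardsUI.
have -> : cycles e B :&: Fs = set0.
  apply/setP => F; rewrite in_setI in_set0; apply/negP => /andP[FB FF].
  by case/negP: (nF F FF); apply: cover_cycle FB.
rewrite cards0 addn0; apply: subset_leq_card; rewrite subUset sF andbT.
apply/subsetP => F /cyclesP[c [? ? ? sc ->]].
by apply/cyclesP; exists c; split=> // x /sc /(subsetP sBA).
Qed.

(** Close a path from a to b in the connected set A \ v through v. The cycle
    remembers a and b as the two vertices joined to v. *)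
Lemma cycle_through e A v a b : symmetric e -> irreflexive e -> conn e (A :\ v) -> v \in A ->
  a \in nb e A v -> b \in nb e A v -> a != b ->
  exists2 F, F \in cycles e A & [set y | [set v; y] \in F] = [set a; b].
Proof.
move=> es ei cA vA an bn ab.
have [aA eva eav av] := nb_memP es ei an; have [bA evb ebv bv] := nb_memP es ei bn.
have [||p [pp lp up sp]] := @conn_path _ e (A :\ v) a b cA; rewrite ?inE ?av ?bv //.
have vp : v \notin a :: p by apply/negP => /sp; rewrite !inE eqxx.
have uc : uniq (v :: a :: p) by rewrite cons_uniq vp.
exists (cedges (v :: a :: p)).
  apply/cyclesP; exists (v :: a :: p); split=> //.
  - by case: p lp ab {pp up sp vp uc} => //= ->; rewrite eqxx.
  - by rewrite /= eva rcons_path pp lp.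
  - by move=> x; rewrite inE => /orP[/eqP->//|/sp]; rewrite inE => /andP[].
have nv : next (v :: a :: p) v = a by rewrite /= eqxx.
have nb' : next (v :: a :: p) b = v.
  have := mem_pairs_next b v uc; rewrite pairs_cons.
  have -> : (b, v) \in zip (v :: a :: p) (rcons (a :: p) v).
    have -> : v :: a :: p = rcons (belast v (a :: p)) b by rewrite -lp; apply: lastI.
    by rewrite zip_rcons ?size_belast // mem_rcons mem_head.
  by move/esym/andP => [_ /eqP].
have bc : b \in v :: a :: p by rewrite inE -lp mem_last orbT.
have vc : v \in v :: a :: p by rewrite mem_head.
set c := v :: a :: p in uc nv nb' bc vc *.
apply/setP => y; rewrite !inE mem_cedges // !mem_pairs_next // nv vc.
rewrite (eq_sym a); case: (eqVneq y a) => [//|ya]; rewrite !orFb.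
case: (eqVneq y b) => [->|yb]; first by rewrite nb' eqxx bc.
apply/negP => /andP[yc /eqP ny]; case/eqP: yb.
by rewrite -(prev_next uc y) ny -nb' prev_next.
Qed.

(** Each pair of neighbours of v gives a cycle through v, from which the pair
    can be recovered. *)
Lemma ncyc_noncut e A v : symmetric e -> irreflexive e -> conn e (A :\ v) -> v \in A ->
  ncyc e (A :\ v) + 'C(#|nb e A v|, 2) <= ncyc e A.
Proof.
move=> es ei cA vA; pose Fs := [set F in cycles e A | v \in cover F].
apply: leq_trans (_ : ncyc e (A :\ v) + #|Fs| <= _); last first.
  apply: new_cycles; first exact: subsetDl.
    by apply/subsetP => F; rewrite inE => /andP[].
  move=> F; rewrite inE => /andP[_ vF]; apply/subsetPn; exists v => //.
  by rewrite !inE eqxx.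
rewrite leq_add2l -cards_draws.
apply: leq_trans (leq_imset_card (fun F => [set y | [set v; y] \in F]) Fs).
apply: subset_leq_card; apply/subsetP => P; rewrite inE => /andP[sP /cards2P[a [b [ab PE]]]].
have [F FC FE] := @cycle_through e A v a b es ei cA vA
  (subsetP sP a ltac:(by rewrite PE !inE eqxx))
  (subsetP sP b ltac:(by rewrite PE !inE eqxx orbT)) ab.
apply/imsetP; exists F; last by rewrite FE.
rewrite inE FC; apply/bigcupP; exists [set v; a]; last exact: set21.
by have /setP/(_ a) := FE; rewrite !inE eqxx.
Qed.

End Cycles.

(** * Lower bounds from explicit cycles *)

Section ExplicitCycles.
Variables (V : finType) (e : rel V).
Implicit Types (A B C R S T W : {set V}) (x y v : V).

(** The cycles below are lists of positions, placed in the graph by an injection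
    f. Two of them have the same edges exactly if these vectors agree, so that
    distinctness of concrete cycles is a computation. *)
Definition edge_vector n (s : seq nat) : seq bool :=
  [seq (p \in pairs s) || ((p.2, p.1) \in pairs s) |
     p <- [seq (i, j) | i <- iota 0 n, j <- iota 0 n]].

Definition good_cycles n (adj : rel nat) (cs : seq (seq nat)) :=
  all (fun s => [&& uniq s, 2 < size s, all (gtn n) s & cycle adj s]) cs &&
  uniq [seq edge_vector n s | s <- cs].

Variables (n : nat) (f : nat -> V) (adj : rel nat) (cs : seq (seq nat)) (A : {set V}).
Hypotheses (fI : {in gtn n &, injective f})
  (fadj : forall i j, i < n -> j < n -> adj i j -> e (f i) (f j))
  (fA : forall i, i < n -> f i \in A)
  (good : good_cycles n adj cs).

Definition explicit_cycles : {set {set {set V}}} :=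
  [set F in [seq cedges (map f s) | s <- cs]].

Lemma pairs_map (s : seq nat) : pairs (map f s) = [seq (f p.1, f p.2) | p <- pairs s].
Proof.
by rewrite /pairs -map_rot; elim: s (rot 1 s) => [|x s IH] [|y t] //=; rewrite IH.
Qed.

Lemma mem_pairs_map (s : seq nat) i j : all (gtn n) s -> i < n -> j < n ->
  ((f i, f j) \in pairs (map f s)) = ((i, j) \in pairs s).
Proof.
move=> sn ilt jlt; rewrite pairs_map; apply/mapP/idP => [[[a b] abs [/= Ei Ej]]|ijs].
  have /andP[alt blt] : (a < n) && (b < n).
    have := map_f fst abs; have := map_f snd abs.
    rewrite -/(unzip1 _) -/(unzip2 _) unzip1_zip ?unzip2_zip ?size_rot //=.
    by rewrite mem_rot => /(allP sn) /= -> /(allP sn) /= ->.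
  by rewrite (fI _ _ Ei) // (fI _ _ Ej).
by exists (i, j).
Qed.

Lemma explicit_vector s : s \in cs -> edge_vector n s =
  [seq [set f p.1; f p.2] \in cedges (map f s) | p <- [seq (i, j) | i <- iota 0 n, j <- iota 0 n]].
Proof.
case/andP: good => /allP H _ /H /and4P[us _ sn _].
apply/eq_in_map => -[i j] /allpairsP[[a b] /= [ai bj [-> ->]]].
move: ai bj; rewrite !mem_iota !add0n => /andP[_ an] /andP[_ bn].
rewrite mem_cedges ?mem_pairs_map // map_inj_in_uniq //.
by move=> x y /(allP sn) xn /(allP sn) yn; apply: fI.
Qed.

Lemma explicit_sub : explicit_cycles \subset cycles e A.
Proof.
apply/subsetP => F; rewrite inE => /mapP[s scs ->].
case/andP: good => /allP H _; have /and4P[us s2 sn cs'] := H s scs.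
apply/cyclesP; exists (map f s); split=> //; first by rewrite size_map.
- case: s cs' sn {us s2 scs} => //= a s; rewrite -map_rcons path_map => ps /andP[an sn].
  apply: (sub_in_path (P := gtn n)) ps; last first.
    by rewrite /= all_rcons; apply/and3P.
  by move=> x y xn yn; apply: fadj.
- by rewrite map_inj_in_uniq // => x y /(allP sn) xn /(allP sn) yn; apply: fI.
by move=> x /mapP[i /(allP sn) ilt ->]; apply: fA.
Qed.

Lemma explicit_card : #|explicit_cycles| = size cs.
Proof.
pose G (F : {set {set V}}) :=
  [seq [set f p.1; f p.2] \in F | p <- [seq (i, j) | i <- iota 0 n, j <- iota 0 n]].
rewrite cardsE; have /card_uniqP -> : uniq [seq cedges (map f s) | s <- cs].
  apply: (@map_uniq _ _ G); rewrite -map_comp.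
  have -> : [seq (G \o (fun s => cedges (map f s))) s | s <- cs] = [seq edge_vector n s | s <- cs].
    by apply/eq_in_map => s scs; rewrite explicit_vector.
  by case/andP: good.
by rewrite size_map.
Qed.

Lemma explicit_cover F : F \in explicit_cycles ->
  exists2 s, s \in cs & F = cedges (map f s).
Proof. by rewrite inE => /mapP. Qed.

Lemma explicit_new B : B \subset A ->
  (forall s, s \in cs -> exists2 i, i \in s & f i \notin B) ->
  ncyc e B + size cs <= ncyc e A.
Proof.
move=> sBA H; rewrite -explicit_card; apply: new_cycles => //; first exact: explicit_sub.
move=> F /explicit_cover[s scs ->]; have [i is_ fi] := H s scs.
by apply/subsetPn; exists (f i) => //; rewrite cover_cedges inE map_f.
Qed.

End ExplicitCycles.

Section CycleBounds.
Variables (V : finType) (e : rel V).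
Hypotheses (es : symmetric e) (ei : irreflexive e).
Implicit Types (A B C D R S T W : {set V}) (x y v : V).

Lemma nth_inj_in (x0 : V) (s : seq V) : uniq s ->
  {in gtn (size s) &, injective (nth x0 s)}.
Proof. by move=> us i j ilt jlt /eqP; rewrite nth_uniq // => /eqP. Qed.

Lemma ncyc_triangle A B x y z : B \subset A -> x \notin B -> [set x; y; z] \subset A ->
  e x y -> e y z -> e x z -> ncyc e B + 1 <= ncyc e A.
Proof.
move=> sBA xB; rewrite !subUset !sub1set => /andP[/andP[xA yA] zA] exy eyz exz.
have ne a b : e a b -> a != b by apply: contraTneq => ->; rewrite ei.
have us : uniq [:: x; y; z] by rewrite /= !inE negb_or !ne.
pose adj : rel nat := fun i j => i != j.
apply: (@explicit_new V e 3 (nth x [:: x; y; z]) adj [:: [:: 0; 1; 2]] A) => //.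
- exact: nth_inj_in us.
- by move=> [|[|[|i]]] [|[|[|j]]] //=; rewrite es.
- by case=> [|[|[|i]]].
by move=> s; rewrite inE => /eqP->; exists 0.
Qed.

Lemma ncyc_K4 A B u x y z : B \subset A -> x \notin B -> y \notin B -> z \notin B ->
  [set u; x; y; z] \subset A ->
  e u x -> e u y -> e u z -> e x y -> e x z -> e y z -> ncyc e B + 7 <= ncyc e A.
Proof.
move=> sBA xB yB zB; rewrite !subUset !sub1set -!andbA => /and4P[uA xA yA zA].
move=> eux euy euz exy exz eyz.
have ne a b : e a b -> a != b by apply: contraTneq => ->; rewrite ei.
have us : uniq [:: u; x; y; z] by rewrite /= !inE !negb_or !ne.
pose adj : rel nat := fun i j => i != j.
pose cs := [:: [:: 0; 1; 2]; [:: 0; 1; 3]; [:: 0; 2; 3]; [:: 1; 2; 3];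
   [:: 0; 1; 2; 3]; [:: 0; 1; 3; 2]; [:: 0; 2; 1; 3]].
apply: (@explicit_new V e 4 (nth x [:: u; x; y; z]) adj cs A) => //.
- exact: nth_inj_in us.
- by move=> [|[|[|[|i]]]] [|[|[|[|j]]]] //=; rewrite es.
- by case=> [|[|[|[|i]]]].
move=> s; rewrite !inE => H.
have: (1 \in s) || (2 \in s) by do ![case/orP: H => [/eqP->//|H]]; move/eqP: H => ->.
by case/orP=> H'; [exists 1 | exists 2].
Qed.

(** Each triangle is a cycle. *)
Lemma triangles_ncyc A : triangles e A -> #|A| <= 3 * ncyc e A.
Proof.
move=> tA; elim/(triangles_ind es ei): A / tA => [|A x y z _ us sT cl _ -> IH].
  by rewrite cards0.
have : ncyc e (A :\: [set x; y; z]) + 1 <= ncyc e A.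
  have [xT yT zT] : [/\ x \in [set x; y; z], y \in [set x; y; z] & z \in [set x; y; z]].
    by rewrite !inE !eqxx ?orbT.
  move: us; rewrite /= !inE negb_or => /and3P[/andP[xy xz] yz _].
  apply: (@ncyc_triangle A _ x y z) => //; rewrite ?subsetDl ?inE ?eqxx //.
  - by rewrite cl ?yT ?(subsetP sT) 1?eq_sym.
  - by rewrite cl ?zT ?(subsetP sT) 1?eq_sym.
  - by rewrite cl ?zT ?(subsetP sT) 1?eq_sym.
by move: IH; narith.
Qed.

Lemma triangle_dec D W :
  (exists x y z, [/\ uniq [:: x; y; z], [set x; y; z] \subset D, [/\ e x y, e y z & e x z] &
      [set x; y; z] \subset W]) \/
  (forall x y z, uniq [:: x; y; z] -> [set x; y; z] \subset D -> e x y -> e y z -> e x z ->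
      ~~ ([set x; y; z] \subset W)).
Proof.
case: (boolP [exists x, exists y, exists z, [&& uniq [:: x; y; z], [set x; y; z] \subset D,
   [&& e x y, e y z & e x z] & [set x; y; z] \subset W]]).
  case/existsP=> x /existsP[y /existsP[z /and4P[us sD /and3P[? ? ?] sW]]].
  by left; exists x, y, z.
move=> H; right=> x y z us sD exy eyz exz; apply: contra H => sW.
apply/existsP; exists x; apply/existsP; exists y; apply/existsP; exists z.
by rewrite us sD exy eyz exz sW.
Qed.

(** The six cycles of a K4 that pass through vertex 0. *)
Definition K4_cycles := [:: [:: 0; 1; 2]; [:: 0; 1; 3]; [:: 0; 2; 3];
   [:: 0; 1; 2; 3]; [:: 0; 1; 3; 2]; [:: 0; 2; 1; 3]].

(** A triangle 3, 4, 5 and a path 1, 0, 2 outside it, where 1 is adjacent to 3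
    and 4, and 2 to 5. *)
Definition theta_adj : rel nat := fun i j =>
  let l := [:: (0, 1); (0, 2); (1, 3); (1, 4); (2, 5); (3, 4); (3, 5); (4, 5)] in
  ((i, j) \in l) || ((j, i) \in l).

Definition theta_cycles := [:: [:: 1; 3; 4]; [:: 1; 3; 5; 4]; [:: 0; 1; 3; 5; 2];
   [:: 0; 1; 4; 5; 2]; [:: 0; 1; 3; 4; 5; 2]; [:: 0; 1; 4; 3; 5; 2]].

(** A vertex joined to a whole triangle of D makes a K4, with six cycles through
    that vertex. *)
Lemma ncyc_full_triangle D A p x y z : triangles e D -> D \subset A -> p \in A -> p \notin D ->
  [set x; y; z] \subset D -> e x y -> e y z -> e x z -> e p x -> e p y -> e p z ->
  #|D| + 18 <= 3 * ncyc e A.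
Proof.
move=> tD sDA pA pD sT exy eyz exz epx epy epz.
have ne a b : e a b -> a != b by apply: contraTneq => ->; rewrite ei.
have us : uniq [:: p; x; y; z] by rewrite /= !inE !negb_or !ne.
have := subset_trans sT sDA; rewrite !subUset !sub1set => /andP[/andP[xA yA] zA].
pose adj : rel nat := fun i j => i != j.
have : ncyc e D + 6 <= ncyc e A.
  apply: (@explicit_new V e 4 (nth x [:: p; x; y; z]) adj K4_cycles A) => //.
  - exact: nth_inj_in us.
  - by move=> [|[|[|[|i]]]] [|[|[|[|j]]]] //=; rewrite es.
  - by case=> [|[|[|[|i]]]].
  move=> s; rewrite !inE => H; exists 0 => //.
  by do ![case/orP: H => [/eqP->//|H]]; move/eqP: H => ->.
by move: (triangles_ncyc tD); narith.
Qed.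

(** One cycle F0 more than the explicit ones, distinguished from them by a vertex
    c that they do not visit. *)
Lemma new_cycles1 A D n f (adj : rel nat) cs F0 c :
  {in gtn n &, injective f} ->
  (forall i j, i < n -> j < n -> adj i j -> e (f i) (f j)) ->
  (forall i, i < n -> f i \in A) -> good_cycles n adj cs ->
  D \subset A -> (forall s, s \in cs -> exists2 i, i \in s & f i \notin D) ->
  F0 \in cycles e A -> c \in cover F0 -> c \notin D ->
  (forall i, i < n -> f i != c) -> ncyc e D + (size cs).+1 <= ncyc e A.
Proof.
move=> fI fadj fA good sDA out F0A cF0 cD fc.
have F0n : F0 \notin explicit_cycles f cs.
  apply/negP => /explicit_cover[s scs E].
  move: cF0; rewrite E cover_cedges inE => /mapP[i is_ ci].
  case/andP: good => /allP H _; have /and4P[_ _ /allP sn _] := H s scs.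
  by move: (fc i (sn i is_)); rewrite -ci eqxx.
have -> : (size cs).+1 = #|F0 |: explicit_cycles f cs|.
  by rewrite cardsU1 F0n (explicit_card fI good).
apply: new_cycles => //.
  by rewrite subUset sub1set F0A (explicit_sub fI fadj fA good).
move=> F; rewrite in_setU1 => /orP[/eqP->|/explicit_cover[s scs ->]].
  by apply/subsetPn; exists c.
have [i is_ fi] := out s scs.
by apply/subsetPn; exists (f i) => //; rewrite cover_cedges inE map_f.
Qed.

(** The vertices p and q together see a whole triangle of D. Either p alone does,
    which gives a K4, or there are six cycles in the graph [theta_adj]. *)
Lemma ncyc_two_centres A D z p q c x1 x2 x3 F0 :
  triangles e D -> D \subset A -> z \in A -> p \in A -> q \in A ->
  z \notin D -> p \notin D -> q \notin D -> c \notin D ->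
  uniq [:: z; p; q; c] -> e z p -> e z q ->
  F0 \in cycles e A -> c \in cover F0 ->
  [set x1; x2; x3] \subset D -> e x1 x2 -> e x2 x3 -> e x1 x3 ->
  e p x1 -> e p x2 -> e p x3 || e q x3 -> #|D| + 21 <= 3 * ncyc e A.
Proof.
move=> tD sDA zA pA qA zD pD qD cD uq ezp ezq F0A cF0 sT e12 e23 e13 ep1 ep2 epq.
have ne a b : e a b -> a != b by apply: contraTneq => ->; rewrite ei.
have := sT; rewrite !subUset !sub1set => /andP[/andP[x1D x2D] x3D].
have [x1A x2A x3A] : [/\ x1 \in A, x2 \in A & x3 \in A] by rewrite !(subsetP sDA).
have off w x : w \notin D -> x \in D -> w != x by move=> wD; apply: contraTneq => <-.
have : ncyc e D + 7 <= ncyc e A; last by move: (triangles_ncyc tD); narith.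
move: uq; rewrite /= !inE !negb_or -!andbA => /and5P[zp zq zc pq /and3P[pc qc _]].
case ep3: (e p x3) epq => /= epq.
  have us : uniq [:: p; x1; x2; x3] by rewrite /= !inE !negb_or !ne.
  pose adj : rel nat := fun i j => i != j.
  apply: (@new_cycles1 A D 4 (nth z [:: p; x1; x2; x3]) adj K4_cycles F0 c) => //.
  - exact: nth_inj_in us.
  - by move=> [|[|[|[|i]]]] [|[|[|[|j]]]] //=; rewrite es.
  - by case=> [|[|[|[|i]]]].
  - move=> s; rewrite !inE => H; exists 0 => //.
    by do ![case/orP: H => [/eqP->//|H]]; move/eqP: H => ->.
  by case=> [|[|[|[|i]]]] //= _; rewrite eq_sym off.
have us : uniq [:: z; p; q; x1; x2; x3].
  by rewrite /= !inE !negb_or zp zq pq (ne _ _ e12) (ne _ _ e13) (ne _ _ e23) !off.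
apply: (@new_cycles1 A D 6 (nth z [:: z; p; q; x1; x2; x3]) theta_adj theta_cycles F0 c) => //.
- exact: nth_inj_in us.
- by move=> [|[|[|[|[|[|i]]]]]] [|[|[|[|[|[|j]]]]]] //= _ _ _; rewrite // es.
- by case=> [|[|[|[|[|[|i]]]]]].
- move=> s; rewrite !inE => H; exists 1 => //.
  by do ![case/orP: H => [/eqP->//|H]]; move/eqP: H => ->.
by case=> [|[|[|[|[|[|i]]]]]] //= _; rewrite eq_sym off.
Qed.

End CycleBounds.

(** * Cycles around disjoint triangles, and cycles after merging *)

Section TriangleRest.
Variables (V : finType) (e : rel V).
Hypotheses (es : symmetric e) (ei : irreflexive e).
Implicit Types (A B C D R S T W : {set V}) (x y v : V).

(** If some transversal of the triangles avoids the neighbours of a and b, it can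
    be extended by both a and b and becomes too large an independent set.
    Otherwise a and b together see a whole triangle, and there are six cycles
    around it; F0 is a seventh. *)
Lemma ncyc_del_triangles A k z a b c F0 : z \in A -> nb e A z = [set a; b; c] ->
  uniq [:: a; b; c] -> e a b = false -> F0 \in cycles e A -> c \in cover F0 ->
  triangles e (A :\: cn e A z) -> alpha_le e A k.+1 -> 0 < cnt e (A :\: cn e A z) k ->
  #|A :\: cn e A z| + 21 <= 3 * ncyc e A.
Proof.
move=> zA nz us eab F0A cF0 tD al cD; set D := A :\: cn e A z in tD cD *.
have inN w : w \in [set a; b; c] -> [/\ w \in A, e z w, e w z & w != z].
  by rewrite -nz; apply: nb_memP.
have [aA eza eaz az] := inN a ltac:(by rewrite !inE eqxx).
have [bA ezb ebz bz] := inN b ltac:(by rewrite !inE eqxx orbT).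
have [cA ezc ecz cz] := inN c ltac:(by rewrite !inE eqxx orbT).
have offD w : w \in cn e A z -> w \notin D by move=> wc; rewrite inE wc.
have zD : z \notin D by apply: offD; rewrite in_cn eqxx.
have aD : a \notin D by apply: offD; rewrite in_cn aA eza orbT.
have bD : b \notin D by apply: offD; rewrite in_cn bA ezb orbT.
have cD' : c \notin D by apply: offD; rewrite in_cn cA ezc orbT.
have sDA : D \subset A by apply: subsetDl.
move: (us); rewrite /= !inE negb_or => /and3P[/andP[ab ac] bc _].
case: (triangle_dec e D (nb e A a :|: nb e A b)).
  case=> x1 [x2 [x3 [u3 sT [e12 e23 e13] sW]]].
  have hit x : x \in [set x1; x2; x3] -> e a x || e b x.
    by move/(subsetP sW); rewrite !inE => /orP[] /andP[_ ->]; rewrite ?orbT.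
  have h1 := hit x1 ltac:(by rewrite !inE eqxx).
  have h2 := hit x2 ltac:(by rewrite !inE eqxx orbT).
  have h3 := hit x3 ltac:(by rewrite !inE eqxx orbT).
  have perm1 : [set x1; x3; x2] \subset D by rewrite setUAC.
  have perm2 : [set x2; x3; x1] \subset D by rewrite setUAC (setUC [set x2]).
  have main p q y1 y2 y3 : uniq [:: z; p; q; c] -> p \in A -> q \in A -> p \notin D ->
      q \notin D -> e z p -> e z q -> [set y1; y2; y3] \subset D -> e y1 y2 -> e y2 y3 ->
      e y1 y3 -> e p y1 -> e p y2 -> e p y3 || e q y3 -> #|D| + 21 <= 3 * ncyc e A.
    move=> *; exact: (@ncyc_two_centres V e es ei A D z p q c y1 y2 y3 F0).
  have uz : uniq [:: z; a; b; c].
    by rewrite /= !inE !negb_or !(eq_sym z) az bz cz ab ac bc.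
  have uz' : uniq [:: z; b; a; c].
    by rewrite /= !inE !negb_or !(eq_sym z) az bz cz eq_sym ab ac bc.
  have e21 : e x2 x1 by rewrite es.
  have e32 : e x3 x2 by rewrite es.
  have e31 : e x3 x1 by rewrite es.
  case a1: (e a x1) h1 => /= h1; case a2: (e a x2) h2 => /= h2; case a3: (e a x3) h3 => /= h3.
  - by apply: (main a b x1 x2 x3); rewrite // a3.
  - by apply: (main a b x1 x2 x3); rewrite // h3 orbT.
  - by apply: (main a b x1 x3 x2); rewrite // h2 orbT.
  - by apply: (main b a x2 x3 x1); rewrite // a1 orbT.
  - by apply: (main a b x2 x3 x1); rewrite // h1 orbT.
  - by apply: (main b a x1 x3 x2); rewrite // a2 orbT.
  - by apply: (main b a x1 x2 x3); rewrite // a3 orbT.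
  - by apply: (main b a x1 x2 x3); rewrite // h3.
move=> H; have [S [sS iS cS]] := triangles_transversal es ei tD H.
have [S' [sS' iS' cS']] := cnt_witness cD.
have le1 := triangles_indep es ei tD sS' iS'.
have sSD : S \subset D := subset_trans sS (subsetDl _ _).
have out w x : x \in S -> w \in [set a; b] -> e w x = false.
  move=> xS; move: (subsetP sS x xS); rewrite !inE => /andP[/norP[n1 n2]] /andP[_ xA].
  by case/orP=> /eqP->; [move: n1 | move: n2]; rewrite xA => /negbTE.
have i2 : indep e (a |: (b |: S)).
  move/indepP: iS => iS; apply/indepP => x y; rewrite !inE.
  have eba : e b a = false by rewrite es.
  case/or3P=> [/eqP->|/eqP->|xS] /or3P[/eqP->|/eqP->|yS]; rewrite ?ei ?eab ?eba //.
  - by rewrite out // !inE eqxx.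
  - by rewrite out // !inE eqxx orbT.
  - by rewrite es out // !inE eqxx.
  - by rewrite es out // !inE eqxx orbT.
  - exact: iS.
have := al (a |: (b |: S)); rewrite !subUset !sub1set aA bA (subset_trans sSD sDA) /=.
move=> /(_ isT i2); rewrite !cardsU1 !inE negb_or ab /=.
have -> : a \notin S by apply: contra aD; apply: (subsetP sSD).
have -> : b \notin S by apply: contra bD; apply: (subsetP sSD).
by move: cS le1; rewrite cS' /=; narith.
Qed.

(** A transversal that avoids the neighbours of p would be extended by p; hence p
    sees a whole triangle. *)
Lemma ncyc_cone_triangles D k p : triangles e D -> p \notin D -> alpha_le e (p |: D) k ->
  0 < cnt e D k -> #|D| + 18 <= 3 * ncyc e (p |: D).
Proof.
move=> tD pD al cD.
case: (triangle_dec e D (nb e D p)).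
  case=> x1 [x2 [x3 [u3 sT [e12 e23 e13] sW]]].
  have hit x : x \in [set x1; x2; x3] -> e p x by move/(subsetP sW); rewrite inE => /andP[].
  apply: (@ncyc_full_triangle V e es ei D _ p x1 x2 x3) => //; rewrite ?subsetUr ?set21 ?setU11 //.
  - by apply: hit; rewrite !inE eqxx.
  - by apply: hit; rewrite !inE eqxx orbT.
  - by apply: hit; rewrite !inE eqxx orbT.
move=> H; have [S [sS iS cS]] := triangles_transversal es ei tD H.
have [S' [sS' iS' cS']] := cnt_witness cD.
have le1 := triangles_indep es ei tD sS' iS'.
have sSD : S \subset D := subset_trans sS (subsetDl _ _).
have i2 : indep e (p |: S).
  apply: (indep_add es ei (A := p |: D)) => //; apply/subsetP => x xS.
  move: (subsetP sS x xS); rewrite !inE => /andP[n1 xD]; rewrite xD orbT andbT.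
  by move: n1; rewrite xD /= => /negbTE->; rewrite orbF; apply: contraNneq pD => <-.
have := al (p |: S); rewrite setUS // => /(_ isT i2); rewrite cardsU1.
have -> : p \notin S by apply: contra pD; apply: (subsetP sSD).
by move: cS le1; rewrite cS' /=; narith.
Qed.

End TriangleRest.

Section FoldCycles.
Variables (V : finType) (e : rel V).
Hypotheses (es : symmetric e) (ei : irreflexive e).
Variables (A : {set V}) (v a b : V).
Hypotheses (vA : v \in A) (ab : a != b) (nv : nb e A v = [set a; b]).
Implicit Types (F : {set {set V}}) (c : seq V).

Let phi x := if (x == v) || (x == b) then a else x.

(** The contraction of a set of edges under phi, which sends v and b to a; an
    edge contracted to a point is dropped. *)
Definition fold_edges F : {set {set V}} :=
  [set D in (fun E : {set V} => phi @: E) @: F | #|D| == 2].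

Definition pair_edges (P : seq (V * V)) : {set {set V}} :=
  [set [set p.1; p.2] | p in P].

Lemma fold_pair_edges P : fold_edges (pair_edges P) =
  pair_edges [seq p <- [seq (phi p.1, phi p.2) | p <- P] | p.1 != p.2].
Proof.
apply/setP => D; rewrite inE; apply/andP/imsetP.
  case=> /imsetP[E /imsetP[p pP ->] ->]; rewrite imsetU1 imset_set1 cards2 => ne.
  exists (phi p.1, phi p.2) => //; rewrite mem_filter /=.
  rewrite (map_f (fun p => (phi p.1, phi p.2))) // andbT.
  by move: ne; case: (_ != _).
case=> q; rewrite mem_filter => /andP[ne /mapP[p pP qE]] ->; rewrite {q}qE /= in ne *.
rewrite cards2 ne; split=> //; apply/imsetP; exists [set p.1; p.2].
  by apply/imsetP; exists p.
by rewrite imsetU1 imset_set1.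
Qed.

Let va : v != a.
Proof. by have /setP/(_ a) := nv; rewrite !inE eqxx; apply: contraTneq => ->; rewrite ei andbF. Qed.
Let vb : v != b.
Proof. by have /setP/(_ b) := nv; rewrite !inE eqxx orbT; apply: contraTneq => ->; rewrite ei andbF. Qed.
Let evw w : w \in [set a; b] -> e v w /\ w \in A.
Proof. by rewrite -nv inE => /andP[]. Qed.

Lemma pairs_walk (w x y : V) q :
  pairs (w :: x :: rcons q y) = (w, x) :: rcons (zip (x :: q) (rcons q y)) (y, w).
Proof.
rewrite pairs_cons rcons_cons /=; congr (_ :: _).
by rewrite -rcons_cons -zip_rcons ?size_rcons.
Qed.

(** A cycle of the merged graph that avoids a is a cycle of the original. If it
    passes through a, its two edges at a come from edges at a or b: when both
    come from the same vertex, that vertex replaces a, and otherwise the path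
    a, v, b does. *)
Lemma fold_cycle_lift F : F \in cycles (fold e a b) (A :\: [set v; b]) ->
  exists2 F', F' \in cycles e A & fold_edges F' = F.
Proof.
case/cyclesP=> c [c2 cc uc sc FE].
have offc z : z \in c -> [/\ z \in A, z != v & z != b].
  by move/sc; rewrite !inE negb_or => /andP[/andP[-> ->] ->].
have phid z : z != v -> z != b -> phi z = z by rewrite /phi => /negbTE-> /negbTE->.
have ne_pairs (s : seq V) : uniq s -> 1 < size s -> all (fun p => p.1 != p.2) (pairs s).
  move=> us s2; apply/allP => -[x y]; rewrite mem_pairs_next //= => /andP[xs /eqP<-].
  case: s us s2 xs => // z s us s2 xs.
  have := next_nth (z :: s) x; rewrite xs => ->.
  rewrite -{1}(nth_index z xs); set i := index x (z :: s).
  have ilt : i < size (z :: s) by rewrite index_mem.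
  move: ilt; rewrite /= ltnS leq_eqVlt => /orP[/eqP->|ilt].
    rewrite (nth_default _ (leqnn (size s))); move: us s2 => /andP[zs _].
    case: (s) zs => // z' s' zs _; apply: contraNneq zs => /= E.
    by have := @mem_nth _ z (z' :: s') (size s') (ltnSn _); rewrite E.
  rewrite -[nth z s i]/(nth z (z :: s) i.+1) nth_uniq //; first by rewrite neq_ltn ltnSn.
  exact: leqW.
case: (boolP (a \in c)) => ac; last first.
  exists F.
    apply/cyclesP; exists c; split=> //; last by move=> z /offc[].
    apply: (sub_in_cycle (P := [pred z | z != a])) cc.
      by move=> x y /= xa ya; rewrite fold_off.
    by apply/allP => z zc /=; apply: contraNneq ac => <-.
  rewrite FE cedgesE // -/(pair_edges _) fold_pair_edges.
  rewrite (_ : [seq _ | p <- pairs c] = pairs c).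
    by rewrite (eq_in_filter (a2 := predT)) ?filter_predT // => p /(allP (ne_pairs c uc (ltnW c2))) ->.
  rewrite -[RHS]map_id; apply/eq_in_map => -[x y] xy.
  have := map_f fst xy; have := map_f snd xy.
  rewrite -/(unzip1 _) -/(unzip2 _) unzip1_zip ?unzip2_zip ?size_rot //= mem_rot.
  by move=> /offc[_ yv yb] /offc[_ xv xb]; rewrite !phid.
have [i s sE] := rot_to ac.
have {c2} c2 : 2 < size (a :: s) by rewrite -sE size_rot.
have {cc} cc : cycle (fold e a b) (a :: s) by rewrite -sE rot_cycle.
have us : uniq (a :: s) by rewrite -sE rot_uniq.
have {FE} FE : F = pair_edges (pairs (a :: s)).
  rewrite FE /pair_edges -cedgesE // -sE; apply/setP => E.
  apply/imsetP/imsetP => -[x xc ->]; exists x; rewrite ?mem_rot // 1?next_rot //.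
  by move: xc; rewrite mem_rot.
have {offc} offc z : z \in a :: s -> [/\ z \in A, z != v & z != b].
  by rewrite -sE mem_rot; apply: offc.
move: {sc uc ac sE c} i => _.
case: s c2 cc us FE offc => [|x s] //; case/lastP: s => [|q y] // c2 cc us FE offc.
have := cc; rewrite /= rcons_path last_rcons => /and3P[fax pxy fya].
have /= /andP[anx uxy] := us.
have xa : x != a by apply: contraNneq anx => ->; rewrite inE eqxx.
have ya : y != a by apply: contraNneq anx => ->; rewrite inE mem_rcons mem_head orbT.
have pe : path e x (rcons q y).
  apply: (sub_in_path (P := [pred z | z != a])) pxy.
    by move=> z w /= za wa; rewrite fold_off.
  by apply/allP => z zc /=; apply: contraNneq anx => <-.
have ho1 : e a x || e b x.
  by move: fax; rewrite /fold eqxx (negbTE xa) andFb orbF.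
have ho2 : e y a || e y b.
  by move: fya; rewrite /fold eqxx (negbTE ya) andFb orFb (es b).
set P := x :: rcons q y in anx uxy.
have sP z : z \in P -> [/\ z \in A, z != v & z != b] by move=> zP; apply: offc; rewrite inE zP orbT.
have vP : v \notin P by apply/negP => /sP[_]; rewrite eqxx.
have bP : b \notin P by apply/negP => /sP[_ _]; rewrite eqxx.
have phiP z : z \in P -> phi z = z by move=> /sP[_ zv zb]; apply: phid.
have phia : phi a = a by rewrite phid // eq_sym.
have phiv : phi v = a by rewrite /phi eqxx.
have phib : phi b = a by rewrite /phi eqxx orbT.
have phiM : [seq (phi p.1, phi p.2) | p <- zip (x :: q) (rcons q y)] = zip (x :: q) (rcons q y).
  rewrite -[RHS]map_id; apply/eq_in_map => -[z w] zw.
  have := map_f fst zw; have := map_f snd zw.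
  rewrite -/(unzip1 _) -/(unzip2 _) unzip1_zip ?unzip2_zip ?size_rcons //= => wP zP.
  by rewrite !phiP // /P; [rewrite inE wP orbT | rewrite -rcons_cons mem_rcons inE zP orbT].
have ne := ne_pairs _ us (ltnW c2); rewrite pairs_walk in FE ne.
have filt : [seq p <- (a, x) :: rcons (zip (x :: q) (rcons q y)) (y, a) | p.1 != p.2] =
    (a, x) :: rcons (zip (x :: q) (rcons q y)) (y, a).
  by apply/all_filterP.
have [xP yP] : x \in P /\ y \in P by rewrite /P mem_head inE mem_rcons mem_head orbT.
(* closing the path P through a single vertex w *)
have one w : w \in [set a; b] -> e w x -> e y w -> exists2 F', F' \in cycles e A & fold_edges F' = F.
  move=> wab ewx eyw; have wP : w \notin P by move: wab; rewrite !inE => /orP[] /eqP->.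
  have phiw : phi w = a by move: wab; rewrite !inE => /orP[] /eqP->.
  have uw : uniq (w :: P) by rewrite /= wP.
  exists (cedges (w :: P)).
    apply/cyclesP; exists (w :: P); split=> //.
    - by rewrite /P /= rcons_path last_rcons ewx pe.
    by move=> z; rewrite inE => /orP[/eqP->|/sP[]//]; have [] := evw wab.
  rewrite cedgesE // -/(pair_edges _) fold_pair_edges pairs_walk /= map_rcons /= phiM.
  by rewrite phiw !phiP // -[X in _ = X]/F FE -filt.
(* closing it through v *)
have two w1 w2 : w1 \in [set a; b] -> w2 \in [set a; b] -> w1 != w2 -> e w1 x -> e y w2 ->
    exists2 F', F' \in cycles e A & fold_edges F' = F.
  move=> wab1 wab2 w12 ew eyw.
  have nP w : w \in [set a; b] -> w \notin P by rewrite !inE => /orP[] /eqP->.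
  have pw w : w \in [set a; b] -> phi w = a by rewrite !inE => /orP[] /eqP->.
  have vw w : w \in [set a; b] -> v != w by rewrite !inE => /orP[] /eqP->.
  have [ev1 w1A] := evw wab1; have [ev2 w2A] := evw wab2.
  have gen (s : seq V) : v \notin s -> w1 \notin s -> w2 \notin s -> uniq s ->
      uniq (v :: w1 :: rcons s w2).
    move=> vs w1s w2s us'; rewrite /= inE !mem_rcons !inE rcons_uniq !negb_or.
    by rewrite !vw // w12 vs w1s w2s us'.
  have uw := gen P vP (nP _ wab1) (nP _ wab2) uxy.
  exists (cedges (v :: w1 :: rcons P w2)).
    apply/cyclesP; exists (v :: w1 :: rcons P w2); split=> //.
    - by rewrite /P /= ev1 ew 2!rcons_path pe !last_rcons eyw es ev2.
    move=> z; rewrite 2!in_cons mem_rcons in_cons => /or4P[/eqP->|/eqP->|/eqP->|/sP[]] //.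
  rewrite cedgesE // -/(pair_edges _) fold_pair_edges pairs_walk.
  have -> : zip (w1 :: P) (rcons P w2) = (w1, x) :: rcons (zip (x :: q) (rcons q y)) (y, w2).
    by rewrite /P rcons_cons /=; congr (_ :: _); rewrite -rcons_cons -zip_rcons ?size_rcons.
  rewrite /= !map_rcons /= phiM (pw _ wab1) (pw _ wab2) phiv !phiP //.
  by rewrite filter_rcons /= eqxx /= FE -filt.
case: (boolP (e a x)) ho1 => eax /= ho1; case: (boolP (e y a)) ho2 => eya /= ho2.
- by apply: (one a) => //; rewrite !inE eqxx.
- by apply: (two a b); rewrite // !inE eqxx ?orbT.
- by apply: (two b a); rewrite // ?(eq_sym b) // !inE eqxx ?orbT.
- by apply: (one b) => //; rewrite !inE eqxx orbT.
Qed.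

Lemma ncyc_fold : ncyc (fold e a b) (A :\: [set v; b]) <= ncyc e A.
Proof.
apply: leq_trans (leq_imset_card fold_edges (cycles e A)).
apply: subset_leq_card; apply/subsetP => F /fold_cycle_lift[F' F'A <-].
exact: imset_f.
Qed.

End FoldCycles.

(** * Existence of a reduction *)

Section Reduction.
Variables (V : finType) (e : rel V).
Hypotheses (es : symmetric e) (ei : irreflexive e).
Implicit Types (A B C D Q R S T W : {set V}) (u v w x y z : V) (k : nat).

(** A clique Q of at most three vertices whose only contact with the rest is the
    vertex u, joined to all of Q. *)
Definition pendant A u Q := [/\ u \in A, u \notin Q, Q \subset A, 0 < #|Q| <= 3 &
  forall q, q \in Q -> cn e A q = u |: Q].

(** In RedF the neighbours a and b of v are merged. In RedM the vertex w has degree 2 after v has been deleted,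
    and its neighbours x and y are merged. *)
Inductive reducible A : Prop :=
| RedE x y of x \in A & y \in A & e x y & conn (dele e x y) A &
    (forall k, alpha_le e A k -> alpha_le (dele e x y) A k)
| RedA v of v \in A & conn e (A :\ v) & 4 <= #|nb e A v|
| RedF v a b of v \in A & a != b & e a b = false & nb e A v = [set a; b] &
    1 < #|nb e A a| & 1 < #|nb e A b|
| RedM v w x y of v \in A & w \in A & conn e (A :\ v) & #|nb e A v| = 3 &
    nb e A w = [set v; x; y] & uniq [:: v; x; y] & e x y = false
| RedP u Q of pendant A u Q & conn e (A :\: (u |: Q))
| RedC u Q1 Q2 of pendant A u Q1 & pendant A u Q2 & [disjoint Q1 & Q2].

(** An independent set that uses both ends of the deleted edge xy can have x
    replaced by w, because after the deletion w has no neighbours other than x that x does not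
    have. *)
Lemma alpha_dele A k x y w : x \in A -> y \in A -> w \in A -> e x w -> w != y ->
  (forall z, z \in A -> e w z -> z != x -> e x z && (z != y)) ->
  alpha_le e A k -> alpha_le (dele e x y) A k.
Proof.
move=> xA yA wA exw wy H al S sS /indepP iS.
have wx : w != x by apply: contraTneq exw => ->; rewrite ei.
case: (boolP ((x \in S) && (y \in S))) => [/andP[xS yS]|nxy]; last first.
  apply: al => //; apply/indepP => a b aS bS; have := iS a b aS bS.
  rewrite /dele; case: (e a b) => //=; move/negbFE/orP.
  by case=> /andP[/eqP E1 /eqP E2]; case/negP: nxy; rewrite -E1 -E2 aS bS.
have outx z : z \in S -> z != y -> e x z = false.
  move=> zS zy; have := iS x z xS zS; rewrite /dele eqxx (negbTE zy) /=.
  case: (eqVneq z x) => [->|_]; first by rewrite ei.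
  by rewrite andbF andbT.
have wS : w \notin S by apply/negP => wS; move: (outx w wS wy); rewrite exw.
have -> : #|S| = #|w |: (S :\ x)|.
  by rewrite cardsU1 !inE (negbTE wS) andbF (cardsD1 x S) xS.
apply: al; first by rewrite subUset sub1set wA (subset_trans (subsetDl _ _) sS).
have outw z : z \in S -> z != x -> e w z = false.
  move=> zS zx; apply/negP => ewz; have /andP[exz zy] := H z (subsetP sS z zS) ewz zx.
  by rewrite (outx z zS zy) in exz.
apply/indepP => a b; rewrite !inE.
case/orP=> [/eqP->|/andP[ax aS]] /orP[/eqP->|/andP[bx bS]].
- exact: ei.
- exact: outw.
- by rewrite es outw.
by have := iS a b aS bS; rewrite /dele (negbTE ax) (negbTE bx) !andbF andbT.
Qed.

(** If one of a and b has no further neighbour, then it is a leaf at v. *)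
Lemma reducible_deg2 A v a b : conn e A -> v \in A -> a != b -> e a b = false ->
  nb e A v = [set a; b] -> reducible A.
Proof.
move=> cA vA ab eab nv.
have [aA eva eav av] := nb_memP es ei (A := A) (v := v) (x := a) ltac:(by rewrite nv !inE eqxx).
have [bA evb ebv bv] := nb_memP es ei (A := A) (v := v) (x := b) ltac:(by rewrite nv !inE eqxx orbT).
have leaf x y : x \in A -> e v x -> x != v -> nb e A v = [set x; y] -> x != y -> #|nb e A x| <= 1 ->
    reducible A.
  move=> xA evx xv nvx xy dx.
  have nx : nb e A x = [set v].
    by apply/esym/eqP; rewrite eqEcard sub1set inE vA es evx cards1.
  apply: (@RedP A v [set x]).
    split; rewrite ?cards1 ?sub1set // ?inE 1?eq_sym //.
    by move=> q; rewrite inE => /eqP->; rewrite /cn nx setUC.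
  have -> : A :\: (v |: [set x]) = A :\ x :\ v by rewrite setUC setDDl.
  apply: (@conn_leaf_del _ _ _ _ y) => //.
  - exact: (@conn_leaf_del _ _ _ _ v).
  - by rewrite !inE eq_sym xv.
  apply/setP => z; have /setP/(_ z) := nvx; rewrite !inE.
  by case: (eqVneq z x) => [->|zx] E; rewrite /= ?(negbTE xy) // E.
case: (leqP #|nb e A a| 1) => da; first exact: (leaf a b).
case: (leqP #|nb e A b| 1) => db; first by apply: (leaf b a); rewrite // 1?setUC // eq_sym.
exact: (@RedF A v a b).
Qed.

(** The vertex q is simplicial, so it can replace a in any independent set that
    uses both ends of the edge ad. *)
Lemma reducible_simplicial A q a d : q \in A ->
  (forall x y, x \in nb e A q -> y \in nb e A q -> x != y -> e x y) ->
  a \in nb e A q -> conn e (A :\ a) -> d \in nb e A a -> d \notin cn e A q -> reducible A.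
Proof.
move=> qA cl aq ca da dq.
have [aA eqa eaq aq'] := nb_memP es ei aq; have [dA ead eda da'] := nb_memP es ei da.
have qd : q != d by apply: contraNneq dq => ->; rewrite in_cn eqxx.
apply: (@RedE A a d) => //.
  by apply: (@conn_dele _ _ _ _ _ q) => //; rewrite eq_sym.
move=> k; apply: (@alpha_dele _ _ _ _ q) => // z zA eqz za.
have zq : z \in nb e A q by rewrite inE zA.
have az : a != z by rewrite eq_sym.
rewrite cl //=; apply: contraNneq dq => <-.
by rewrite in_cn zA eqz orbT.
Qed.

Section EndPiece.
Variables (A : {set V}) (u : V) (R : {set V}).
Hypotheses (conA : conn e A) (A5 : 5 <= #|A|) (uA : u \in A)
  (clR : forall x y, x \in R -> y \in A -> e x y -> y \in u |: R)
  (noncut : forall q, q \in A -> q \notin u |: R -> conn e (A :\ q)).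

Let far q := (q \in A) && (q \notin u |: R).

(** Vertices outside the end piece are adjacent only to each other and to u. *)
Lemma far_nb q x : far q -> x \in nb e A q -> x != u -> far x.
Proof.
case/andP=> qA qR /(nb_memP es ei)[xA eqx exq xq] xu; rewrite /far xA /=.
apply: contra qR; rewrite in_setU1 (negbTE xu) /= => xR; exact: clR exq.
Qed.

Lemma far_u q : far q -> q != u.
Proof. by case/andP=> _; apply: contraNneq => ->; rewrite !inE eqxx. Qed.

Lemma far_conn q : far q -> q \in A /\ conn e (A :\ q).
Proof. by case/andP=> qA qR; split=> //; apply: noncut. Qed.

(** If the clique of q has an edge to the outside at a vertex other than u, that
    edge is superfluous; otherwise the clique hangs at u. *)
Lemma far_simplicial q : far q ->
  (forall x y, x \in nb e A q -> y \in nb e A q -> x != y -> e x y) -> #|nb e A q| <= 3 ->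
  reducible A \/ exists2 Q, pendant A u Q & q \in Q.
Proof.
move=> fq cl d3; have [qA cq] := far_conn fq.
case: (boolP [exists a in nb e A q, (a != u) && ~~ (nb e A a \subset cn e A q)]).
  case/exists_inP=> a aq /andP[au /subsetPn[d da dq]]; left.
  have [aA ca] := far_conn (far_nb fq aq au).
  exact: (reducible_simplicial qA cl aq ca da dq).
move=> H; have same a : a \in nb e A q -> a != u -> cn e A a = cn e A q.
  move=> aq au; have [aA eqa eaq aq'] := nb_memP es ei aq.
  have sub : nb e A a \subset cn e A q.
    by apply: contraNT H => na; apply/exists_inP; exists a; rewrite ?au.
  apply/eqP; rewrite eqEsubset; apply/andP; split.
    by rewrite subUset sub1set sub in_cn aA eqa orbT.
  apply/subsetP => x; rewrite !in_cn => /orP[/eqP->|/andP[xA eqx]].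
    by rewrite qA eaq orbT.
  case: (eqVneq x a) => //= xa; rewrite xA cl // ?inE ?xA ?aA // eq_sym //.
case: (boolP (u \in nb e A q)) => uq.
  right; exists (cn e A q :\ u); last by rewrite !inE eqxx /= andbT far_u.
  have uc : u \in cn e A q by rewrite in_setU uq orbT.
  have card : #|cn e A q :\ u| = #|nb e A q|.
    by have := card_cn ei A q; rewrite (cardsD1 u) uc add1n => -[].
  split=> //.
  - by rewrite !inE eqxx.
  - by rewrite (subset_trans (subsetDl _ _)) // cn_sub.
  - by rewrite card d3 andbT card_gt0; apply/set0Pn; exists u.
  move=> x; rewrite setD1K // in_setD1 in_setU1 => /andP[xu /orP[/eqP->//|xq]].
  exact: same.
suff E : cn e A q = A by move: A5; rewrite -E card_cn // ltnNge => /negP[].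
apply: conA; first exact: cn_sub.
  by apply/set0Pn; exists q; rewrite in_cn eqxx.
move=> x y; rewrite in_setU1 => /orP[/eqP->|xq] yA exy.
  by rewrite in_cn yA exy orbT.
have xu : x != u by apply: contraNneq uq => <-.
by rewrite -(same x xq xu) in_cn yA exy orbT.
Qed.

Lemma set3_of x y z D : uniq [:: x; y; z] -> [set x; y; z] \subset D -> #|D| = 3 -> D = [set x; y; z].
Proof. by move=> us sD cD; apply/esym/eqP; rewrite eqEcard sD cards3 // cD. Qed.

Lemma clique_or_not D : (forall x y, x \in D -> y \in D -> x != y -> e x y) \/
  exists x y, [/\ x \in D, y \in D, x != y & e x y = false].
Proof.
case: (boolP [exists x in D, exists y in D, (x != y) && ~~ e x y]).
  case/exists_inP=> x xD /exists_inP[y yD /andP[xy /negbTE exy]].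
  by right; exists x, y.
move=> H; left=> x y xD yD xy; apply: contraNT H => exy.
by apply/exists_inP; exists x => //; apply/exists_inP; exists y; rewrite ?xy.
Qed.

(** The degree of c decides: at least 4, exactly 3 (then q and c form the pair of
    RedM), 2 with nonadjacent neighbours, or c is simplicial, and q has a
    neighbour outside its clique. *)
Lemma far_third q a b c : far q -> nb e A q = [set a; b; c] -> uniq [:: a; b; c] ->
  e a b = false -> c != u -> reducible A.
Proof.
move=> fq nq us eab cu; have [qA cq] := far_conn fq.
have cin : c \in nb e A q by rewrite nq !inE eqxx orbT.
have fc := far_nb fq cin cu; have [cA cc] := far_conn fc.
have [_ eqc ecq cq'] := nb_memP es ei cin.
have qc : q \in nb e A c by rewrite inE qA.
have uq3 : #|nb e A q| = 3 by rewrite nq cards3.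
case: (leqP 4 #|nb e A c|) => d4; first exact: (@RedA A c).
have far_third_aux m : #|nb e A c| = m -> m < 3 ->
    (forall x y, x \in nb e A c -> y \in nb e A c -> x != y -> e x y) -> reducible A.
  move=> d m3 cl.
  have [d' d'q d'c] : exists2 d', d' \in cn e A q & d' \notin cn e A c.
    apply/subsetPn; apply: contraTN m3 => /subset_leq_card.
    by rewrite !card_cn // uq3 d -leqNgt ltnS.
  apply: (@reducible_simplicial A c q d') => //.
  move: d'q; rewrite in_setU1 => /orP[/eqP E|//].
  by rewrite E in_cn qA ecq orbT in d'c.
case d: (#|nb e A c|) d4 => [|[|[|[|?]]]] // _; last 1 first.
- apply: (@RedM A c q a b) => //; first by rewrite nq setUC setUA.
  by move: us; rewrite /= !inE !negb_or !(eq_sym c) => /and3P[/andP[-> ->] ->].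
- by move/eqP: d; rewrite cards_eq0 => /eqP d; rewrite d inE in qc.
- apply: (@far_third_aux _ d) => //; move/eqP: d => /cards1P[z E] x y.
  by rewrite E !inE => /eqP-> /eqP->; rewrite eqxx.
have [z [w [zw E]]] := nb2P d.
case ezw: (e z w); last first.
  apply: (@reducible_deg2 A c z w) => //.
apply: (@far_third_aux _ d) => // x y.
by rewrite E !inE => /orP[] /eqP-> /orP[] /eqP->; rewrite ?eqxx // es.
Qed.

Lemma far_adj_u q y : far q -> u \in nb e A q -> y \in nb e A q -> y != u ->
  #|nb e A q| <= 3 -> reducible A \/ e u y.
Proof.
move=> fq uq yq yu d3; have [qA cq] := far_conn fq.
case euy: (e u y); [by right | left].
have uy : u != y by rewrite eq_sym.
have sub2 : [set u; y] \subset nb e A q by rewrite subUset !sub1set uq yq.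
case: (leqP #|nb e A q| 2) => d2.
  apply: (@reducible_deg2 A q u y) => //; apply/esym/eqP.
  by rewrite eqEcard sub2 cards2 uy.
have [t tq tn] : exists2 t, t \in nb e A q & t \notin [set u; y].
  apply/subsetPn; apply: contraTN d2 => /subset_leq_card.
  by rewrite cards2 uy -leqNgt.
move: tn; rewrite !inE negb_or => /andP[tu ty].
have us : uniq [:: u; y; t] by rewrite /= !inE negb_or uy !(eq_sym _ t) tu ty.
apply: (@far_third q u y t) => //; apply: set3_of => //.
  by rewrite subUset sub2 sub1set tq.
by apply/eqP; rewrite eqn_leq d3.
Qed.

(** Now u is adjacent to all vertices in question. Walking from q to a and on to
    a second vertex a', one of the earlier cases occurs, or all neighbours of
    a' are neighbours of u; then a' can replace u in any independent set that
    uses both ends of the edge uq, and this edge is superfluous. *)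
Lemma far_wheel q a b : far q -> nb e A q = [set a; b; u] -> uniq [:: a; b; u] ->
  e a b = false -> reducible A.
Proof.
move=> fq nq us eab; have [qA cq] := far_conn fq.
have d3 : #|nb e A q| <= 3 by rewrite nq cards3.
have aq : a \in nb e A q by rewrite nq !inE eqxx.
have bq : b \in nb e A q by rewrite nq !inE eqxx orbT.
have uq : u \in nb e A q by rewrite nq !inE eqxx orbT.
have [aA eqa eaq aq'] := nb_memP es ei aq; have [_ equ euq uq'] := nb_memP es ei uq.
have [bA eqb ebq bq'] := nb_memP es ei bq.
move: us; rewrite /= !inE negb_or => /and3P[/andP[ab au] bu _].
case: (far_adj_u fq uq aq au d3) => // eua.
have fa := far_nb fq aq au; have [_ ca] := far_conn fa.
case: (leqP 4 #|nb e A a|) => da; first exact: (@RedA A a).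
have qna : q \in nb e A a by rewrite inE qA.
have una : u \in nb e A a by rewrite inE uA es.
case: (boolP (nb e A a \subset [set q; u])) => [sub|/subsetPn[a' a'a]].
  apply: (@reducible_simplicial A a q b) => //.
    by move=> x y /(subsetP sub) + /(subsetP sub); rewrite !inE => /orP[] /eqP-> /orP[] /eqP->;
      rewrite ?eqxx.
  by rewrite in_cn bA eab andbF orbF eq_sym.
rewrite !inE negb_or => /andP[a'q a'u].
case: (far_adj_u fa una a'a a'u da) => // eua'.
have [a'A eaa' ea'a a'a'] := nb_memP es ei a'a.
have eqa' : e q a' = false.
  apply/negP => H; have : a' \in nb e A q by rewrite inE a'A.
  rewrite nq !inE (negbTE a'u) (negbTE a'a') orbF /= => /eqP E.
  by rewrite -E eaa' in eab.
have fa' := far_nb fa a'a a'u; have [_ ca'] := far_conn fa'.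
case: (leqP 4 #|nb e A a'|) => da'; first exact: (@RedA A a').
have una' : u \in nb e A a' by rewrite inE uA es.
case: (boolP [exists z in nb e A a', (z != u) && ~~ e u z]) => [|H].
  by case/exists_inP=> z za' /andP[zu /negbTE euz]; case: (far_adj_u fa' una' za' zu da'); rewrite ?euz.
apply: (@RedE A u q) => //.
  apply: (@conn_sub_rel _ (dele e q u)); last by apply: (@conn_dele _ _ _ _ _ a).
  by move=> x y _ _; rewrite /dele orbC.
move=> k; apply: (@alpha_dele _ _ _ _ a') => // z zA ea'z zu; apply/andP; split.
  by apply: contraNT H => nuz; apply/exists_inP; exists z; rewrite ?inE ?zA ?ea'z ?zu.
by apply: contraTneq ea'z => ->; rewrite es eqa'.
Qed.

Lemma far_cases q : far q -> reducible A \/ exists2 Q, pendant A u Q & q \in Q.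
Proof.
move=> fq; have [qA cq] := far_conn fq.
case: (leqP 4 #|nb e A q|) => d4; first by left; apply: (@RedA A q).
case: (clique_or_not (nb e A q)) => [cl|[a [b [aq bq ab eab]]]].
  exact: far_simplicial.
left; have sub2 : [set a; b] \subset nb e A q by rewrite subUset !sub1set aq bq.
case: (leqP #|nb e A q| 2) => d2.
  apply: (@reducible_deg2 A q a b) => //; apply/esym/eqP.
  by rewrite eqEcard sub2 cards2 ab.
have [c cq' cn'] : exists2 c, c \in nb e A q & c \notin [set a; b].
  apply/subsetPn; apply: contraTN d2 => /subset_leq_card.
  by rewrite cards2 ab -leqNgt.
move: cn'; rewrite !inE negb_or => /andP[ca cb].
have us : uniq [:: a; b; c] by rewrite /= !inE negb_or ab !(eq_sym _ c) ca cb.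
have nq : nb e A q = [set a; b; c].
  apply: set3_of => //; first by rewrite subUset sub2 sub1set cq'.
  by apply/eqP; rewrite eqn_leq -ltnS d4.
case: (eqVneq c u) => cu; last exact: (@far_third q a b c).
by rewrite cu in us nq; apply: (@far_wheel q a b).
Qed.

End EndPiece.

(** Apply [far_cases] to a vertex outside the end piece. If a pendant clique is
    found and something else is left outside, a second one is found there. *)
Theorem reduce A : conn e A -> 5 <= #|A| -> reducible A.
Proof.
move=> cA A5; have A2 : 1 < #|A| by apply: leq_trans A5.
have [u [R [uA sR cR [clR RA noncut]]]] := end_piece es cA A2.
have sRA : R \subset A := subset_trans sR (subsetDl _ _).
have suR : u |: R \subset A by rewrite subUset sub1set uA.
have pick Q : Q \subset A -> ~~ (A \subset Q) -> exists2 q, q \in A & q \notin Q.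
  by move=> _ /subsetPn.
have [q qA qR] : exists2 q, q \in A & q \notin u |: R.
  by apply: pick => //; apply: contra RA => H; rewrite eqEsubset suR.
case: (far_cases cA A5 uA clR noncut (q := q)); rewrite ?qA // => -[Q1 p1 qQ1].
have p1' := p1; case: p1' => _ uQ1 sQ1 _ cnQ1.
have Q1R x : x \in Q1 -> x \notin R.
  move=> xQ; apply/negP => xR.
  have : q \in u |: R.
    case: (eqVneq q x) => [->|qx]; first by rewrite inE xR orbT.
    apply: (clR x) => //; have : x \in cn e A q by rewrite cnQ1 // inE xQ orbT.
    by rewrite in_cn eq_sym (negbTE qx) es => /andP[].
  by rewrite (negbTE qR).
case: (boolP (A \subset Q1 :|: (u |: R))) => [sub|/subsetPn[q2 q2A]].
  apply: (@RedP A u Q1) => //.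
  have -> // : A :\: (u |: Q1) = R.
  apply/setP => x; rewrite !inE negb_or.
  case xA : (x \in A); last by rewrite andbF; apply/esym/negP => /(subsetP sRA); rewrite xA.
  have := subsetP sub x xA; rewrite !inE andbT.
  case: (boolP (x \in R)) => [xR _|_].
    have -> : x != u by apply: contraTneq xR => ->; apply/negP => /(subsetP sR); rewrite !inE eqxx.
    by rewrite /=; apply/negP => /Q1R; rewrite xR.
  by rewrite orbF => /orP[->|->]; rewrite ?andbF.
rewrite inE negb_or => /andP[q2Q1 q2R].
case: (far_cases cA A5 uA clR noncut (q := q2)); rewrite ?q2A // => -[Q2 p2 qQ2].
apply: (@RedC A u Q1 Q2) => //.
have p2' := p2; case: p2' => _ uQ2 _ _ cnQ2.
rewrite -setI_eq0; apply/eqP/setP => x; rewrite !inE; apply/negP => /andP[x1 x2].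
have : Q1 = Q2 by rewrite -(setU1K uQ1) -(cnQ1 x x1) (cnQ2 x x2) setU1K.
by move=> E; rewrite E qQ2 in q2Q1.
Qed.

End Reduction.

(** * The bound as a function of order and number of cycles *)

(** The bounds for orders 3s, 3s + 1 and 3s + 2, multiplied by 36 in order to
    have natural numbers for every s; order 2 and order 4 are exceptional. *)
Definition bound0 s c := 24 * 3 ^ s + (if c < s then 0 else 18 * 2 ^ s).

Definition bound1 s c :=
  if c < s + 6 then (if s == 1 then 108 else 32 * 3 ^ s + 9 * 2 ^ s)
  else 36 * 3 ^ s + 18 * 2 ^ s.

Definition bound2 s c :=
  if s == 0 then 72
  else 48 * 3 ^ s + (if c < s then 0 else if c <= s + 6 then 18 * 2 ^ s else 27 * 2 ^ s).

Definition bound n c :=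
  match n %% 3 with 0 => bound0 (n %/ 3) c | 1 => bound1 (n %/ 3) c | _ => bound2 (n %/ 3) c end.

Lemma bound_0 s c : bound (3 * s) c = bound0 s c.
Proof. by rewrite /bound mulnC modnMl mulnK. Qed.

Lemma bound_1 s c : bound (3 * s + 1) c = bound1 s c.
Proof. by rewrite /bound mulnC modnMDl divnMDl // addn0. Qed.

Lemma bound_2 s c : bound (3 * s + 2) c = bound2 s c.
Proof. by rewrite /bound mulnC modnMDl divnMDl // addn0. Qed.

(** The range of cycle numbers in which equality is analysed. *)
Definition tight n c : bool :=
  match n %% 3 with
  | 0 => n %/ 3 <= c | 1 => c < n %/ 3 + 6 | _ => n %/ 3 <= c <= n %/ 3 + 6 end.

Lemma tight_0 s c : tight (3 * s) c = (s <= c).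
Proof. by rewrite /tight mulnC modnMl mulnK. Qed.

Lemma tight_1 s c : tight (3 * s + 1) c = (c < s + 6).
Proof. by rewrite /tight mulnC modnMDl divnMDl // addn0. Qed.

Lemma tight_2 s c : tight (3 * s + 2) c = (s <= c <= s + 6).
Proof. by rewrite /tight mulnC modnMDl divnMDl // addn0. Qed.

Lemma g1_le s : 3 * g (3 * s + 1) <= 4 * 3 ^ s.
Proof.
case: s => [|s]; first by rewrite !g_vals.
by rewrite (_ : 3 * s.+1 + 1 = 3 * s + 4) ?g1 ?expnS; move: (3 ^ s) => *; lia.
Qed.

Lemma pow_le s : 0 < 2 ^ s <= 3 ^ s.
Proof. by rewrite expn_gt0; case: s => // s; rewrite leq_exp2r. Qed.

Inductive split3_spec n : Prop :=
| Split0 s of n = 3 * s.+2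
| Split1 s of n = 3 * s.+2 + 1
| Split2 s of n = 3 * s.+1 + 2.

Lemma split3 n : 5 <= n -> split3_spec n.
Proof.
move=> n5; have := divn_eq n 3; have := ltn_pmod n (isT : 0 < 3).
case: (n %% 3) => [|[|[|]]] // _ E.
- by apply: (@Split0 _ (n %/ 3 - 2)); lia.
- by apply: (@Split1 _ (n %/ 3 - 2)); lia.
- by apply: (@Split2 _ (n %/ 3 - 1)); lia.
Qed.

Ltac powers := rewrite ?expnS; repeat match goal with
  | |- context [3 ^ ?s] => move: (pow_le s); move: (3 ^ s) (2 ^ s) => ? ?
  end.

(** Case analysis on the conditions in the bounds, and linear arithmetic in 3^s
    and 2^s <= 3^s. *)
Ltac bcase := rewrite /bound0 /bound1 /bound2 /= ?eqSS;
  repeat (case: ifP => ? //=); powers; lia.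

Section Arith.
Variables (n c : nat).
Hypothesis n5 : 5 <= n.

(** The summand tight n c, here and in similar lemmas, is 1 in the range of tightness: there
    the reduction is strict. *)
Lemma bound_deg4 : 6 <= c -> bound n.-1 (c - 6) + 36 * g (n - 5) + tight n c <= bound n c.
Proof.
move=> c6; case: (split3 n5) => s ->.
- rewrite (_ : _.-1 = 3 * s.+1 + 2); last lia.
  rewrite (_ : _ - 5 = 3 * s + 1); last lia.
  rewrite tight_0 bound_0 bound_2; have := g1_le s; move: (g _) => G.
  by case: s => [|s]; bcase.
- rewrite (_ : _.-1 = 3 * s.+2); last lia.
  rewrite (_ : _ - 5 = 3 * s + 2); last lia.
  rewrite tight_1 bound_0 bound_1 g2.
  by bcase.
- rewrite (_ : _.-1 = 3 * s.+1 + 1); last lia.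
  rewrite (_ : _ - 5 = 3 * s); last lia.
  rewrite tight_2 bound_2 bound_1 g0.
  by case: s => [|s]; bcase.
Qed.

Lemma bound_pair : bound (n - 2) c + 36 * g (n - 3) <= bound n c.
Proof.
case: (split3 n5) => s ->.
- rewrite (_ : _ - 2 = 3 * s.+1 + 1); last lia.
  rewrite (_ : _ - 3 = 3 * s.+1); last lia.
  by rewrite bound_0 bound_1 g0; case: s => [|s]; bcase.
- rewrite (_ : _ - 2 = 3 * s.+1 + 2); last lia.
  rewrite (_ : _ - 3 = 3 * s.+1 + 1); last lia.
  rewrite bound_1 bound_2; have := g1_le s.+1; move: (g _) => G.
  by bcase.
- rewrite (_ : _ - 2 = 3 * s.+1); last lia.
  rewrite (_ : _ - 3 = 3 * s + 2); last lia.
  by rewrite bound_2 bound_0 g2; bcase.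
Qed.

Lemma bound_K4 : 7 <= c -> 3 * bound (n - 4) (c - 7) + 36 * g (n - 5) + tight n c <= bound n c.
Proof.
move=> c7; case: (split3 n5) => s ->.
- rewrite (_ : _ - 4 = 3 * s + 2); last lia.
  rewrite (_ : _ - 5 = 3 * s + 1); last lia.
  rewrite tight_0 bound_0 bound_2; have := g1_le s; move: (g _) => G.
  by case: s => [|s]; bcase.
- rewrite (_ : _ - 4 = 3 * s.+1); last lia.
  rewrite (_ : _ - 5 = 3 * s + 2); last lia.
  by rewrite tight_1 bound_0 bound_1 g2; bcase.
- rewrite (_ : _ - 4 = 3 * s + 1); last lia.
  rewrite (_ : _ - 5 = 3 * s); last lia.
  by rewrite tight_2 bound_2 bound_1 g0; case: s => [|[|s]]; bcase.
Qed.

(** The range in which the bound is 8/9 of its value for more cycles, up to lower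
    order. *)
Definition low := (n %% 3 == 1) && (c < n %/ 3 + 6).

Lemma low_0 s : n = 3 * s -> low = false.
Proof. by rewrite /low => ->; rewrite mulnC modnMl. Qed.

Lemma low_1 s : n = 3 * s + 1 -> low = (c < s + 6).
Proof. by rewrite /low => ->; rewrite mulnC modnMDl divnMDl // addn0. Qed.

Lemma low_2 s : n = 3 * s + 2 -> low = false.
Proof. by rewrite /low => ->; rewrite mulnC modnMDl. Qed.

Lemma bound_triangle J : 1 <= c -> J <= g (n - 4) -> (low -> 9 * J <= 8 * g (n - 4)) ->
  2 * bound (n - 3) (c - 1) + 36 * J <= bound n c.
Proof.
move=> c1; case: (split3 n5) => s nE.
- move=> + _; rewrite nE.
  rewrite (_ : _ - 4 = 3 * s + 2); last lia.
  rewrite (_ : _ - 3 = 3 * s.+1); last lia.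
  by rewrite !bound_0 g2; bcase.
- rewrite (low_1 nE) nE.
  rewrite (_ : _ - 4 = 3 * s.+1); last lia.
  rewrite (_ : _ - 3 = 3 * s.+1 + 1); last lia.
  by rewrite !bound_1 g0; case: s {nE} => [|s]; rewrite /bound1 /= ?eqSS;
    repeat (case: ifP => ? //=); powers; lia.
- move=> + _; rewrite nE.
  rewrite (_ : _ - 4 = 3 * s + 1); last lia.
  rewrite (_ : _ - 3 = 3 * s + 2); last lia.
  rewrite !bound_2; have := g1_le s; move: (g _) => G.
  by case: s {nE} => [|s]; bcase.
Qed.

Lemma bound_matching J J' : 1 <= c -> J <= g (n - 4) -> J' <= g (n - 4) ->
  (low -> 9 * J <= 8 * g (n - 4) /\ 9 * J' <= 8 * g (n - 4)) ->
  bound (n - 3) (c - 1) + 36 * (J + J') + tight n c <= bound n c.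
Proof.
move=> c1; case: (split3 n5) => s nE.
- move=> + + _; rewrite nE.
  rewrite (_ : _ - 4 = 3 * s + 2); last lia.
  rewrite (_ : _ - 3 = 3 * s.+1); last lia.
  by rewrite !bound_0 tight_0 g2; bcase.
- rewrite (low_1 nE) nE.
  rewrite (_ : _ - 4 = 3 * s.+1); last lia.
  rewrite (_ : _ - 3 = 3 * s.+1 + 1); last lia.
  by rewrite !bound_1 tight_1 g0; case: s {nE} => [|s]; rewrite /bound1 /= ?eqSS;
    repeat (case: ifP => ? //=); powers; lia.
- move=> + + _; rewrite nE.
  rewrite (_ : _ - 4 = 3 * s + 1); last lia.
  rewrite (_ : _ - 3 = 3 * s + 2); last lia.
  rewrite !bound_2 tight_2; have := g1_le s; move: (g _) => G.
  by case: s {nE} => [|s]; bcase.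
Qed.

Lemma bound_cut J : J <= g n.-1 -> (low -> 9 * J <= 8 * g n.-1) -> 36 * J + tight n c <= bound n c.
Proof.
case: (split3 n5) => s nE.
- move=> + _; rewrite nE.
  rewrite (_ : _.-1 = 3 * s.+1 + 2); last lia.
  by rewrite !bound_0 tight_0 g2; bcase.
- rewrite (low_1 nE) nE.
  rewrite (_ : _.-1 = 3 * s.+2); last lia.
  by rewrite !bound_1 tight_1 g0; rewrite /bound1 /= ?eqSS; repeat (case: ifP => ? //=); powers; lia.
- move=> + _; rewrite nE.
  rewrite (_ : _.-1 = 3 * s.+1 + 1); last lia.
  rewrite !bound_2 tight_2; have := g1_le s.+1; move: (g _) => G.
  by bcase.
Qed.

(** Hanging two cliques at a vertex costs a factor 8/9, unless both of them make
    a K4 with the vertex. *)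
Lemma cut_arith a b : 1 <= a <= 3 -> 1 <= b <= 3 -> a + b < n -> low ->
  (a < 3) || (b < 3) -> 9 * (a * (b * g (n.-1 - a - b))) <= 8 * g n.-1.
Proof.
move=> a3 b3 abn lo ab.
have [s nE] : exists s, n.-1 = 3 * s.+1.
  case: (split3 n5) => s E; rewrite ?(low_0 E) ?(low_2 E) // in lo.
  by exists s.+1; rewrite E; lia.
suff main a' b' : 1 <= a' <= 3 -> 1 <= b' <= 3 -> a' + b' < n -> a' < 3 ->
    9 * (a' * (b' * g (n.-1 - a' - b'))) <= 8 * g n.-1.
  case/orP: ab => lt3; first exact: main.
  by rewrite (mulnCA a) (_ : n.-1 - a - b = n.-1 - b - a); [apply: main; lia | lia].
move=> {a b a3 b3 abn ab} ; move: a' b' => a b a3 b3 abn a2.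
have le1 : b * g (n.-1 - a - b) <= g (n.-1 - a).
  by apply: leq_trans (g_mul _ _) _; [lia | apply: g_mono; lia].
apply: leq_trans (_ : 9 * (a * g (n.-1 - a)) <= _); first by rewrite leq_mul2l leq_mul2l le1 orbT.
rewrite nE; have [->|->] : a = 1 \/ a = 2 by lia.
  by rewrite mul1n (_ : _ - 1 = 3 * s + 2); [apply: gap_arith2 | lia].
by rewrite (_ : _ - 2 = 3 * s + 1); [apply: gap_arith1 | lia].
Qed.

End Arith.

(** * Pendant cliques *)

Lemma bound_mono n c c' : c <= c' -> bound n c <= bound n c'.
Proof.
move=> le; rewrite /bound; case: (n %/ 3) => [|[|s]]; case: (n %% 3) => [|[|?]];
  rewrite /bound0 /bound1 /bound2 /= ?eqSS; repeat (case: ifP => ? //=); powers; lia.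
Qed.

Section Pendant.
Variables (V : finType) (e : rel V).
Hypotheses (es : symmetric e) (ei : irreflexive e).
Implicit Types (A B C D Q R S T W : {set V}) (u v w x y z : V) (k : nat).
Local Notation pendant := (pendant e).

Lemma pendant_adj A u Q x y : pendant A u Q -> x \in u |: Q -> y \in u |: Q -> x != y -> e x y.
Proof.
case=> uA uQ sQ _ cnQ xQ yQ xy.
have adj q z : q \in Q -> z \in u |: Q -> q != z -> e q z.
  by move=> qQ zQ qz; move: zQ; rewrite -(cnQ q qQ) in_cn eq_sym (negbTE qz) => /andP[].
move: xQ; rewrite in_setU1 => /orP[/eqP xu|xQ]; last exact: adj.
move: yQ; rewrite in_setU1 => /orP[/eqP yu|yQ]; first by rewrite xu yu eqxx in xy.
by rewrite es adj // ?xu ?setU11 // -xu eq_sym.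
Qed.

Lemma pendant_sub A u Q : pendant A u Q -> u |: Q \subset A.
Proof. by case=> uA _ sQ _ _; rewrite subUset sub1set uA. Qed.

Lemma pendant_cn A u Q : pendant A u Q -> u |: Q \subset cn e A u.
Proof.
move=> pQ; apply/subsetP => x xQ; rewrite in_cn (subsetP (pendant_sub pQ)) //=.
case: (eqVneq x u) => //= xu; apply: (pendant_adj pQ) => //; first exact: setU11.
by rewrite eq_sym.
Qed.

(** A vertex of Q is simplicial. *)
Lemma cnt_pendant A u Q k : pendant A u Q -> alpha_le e A k.+1 ->
  cnt e A k.+1 = #|Q| * cnt e (A :\: (u |: Q)) k + cnt e (A :\: cn e A u) k.
Proof.
move=> pQ al; have := pQ; case=> uA uQ sQ /andP[Q0 _] cnQ.
case/card_gt0P: Q0 => q qQ.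
rewrite (cnt_simplicial es ei (subsetP sQ q qQ) al); last first.
  by rewrite cnQ // => x y; apply: (pendant_adj pQ).
rewrite cnQ // big_setU1 //= addnC; congr (_ + _).
by rewrite -sum_nat_const; apply: eq_bigr => x xQ; rewrite cnQ.
Qed.

Lemma pendant_alpha A u Q k : pendant A u Q -> alpha_le e A k.+1 ->
  alpha_le e (A :\: (u |: Q)) k.
Proof.
case=> uA uQ sQ /andP[/card_gt0P[q qQ] _] cnQ al; rewrite -(cnQ q qQ).
by apply: (alpha_del es ei) => //; apply: (subsetP sQ).
Qed.

Lemma card_pendant A u Q : pendant A u Q -> #|A :\: (u |: Q)| = #|A| - #|Q|.+1.
Proof.
move=> pQ; rewrite cardsD (setIidPr (pendant_sub pQ)) cardsU1.
by case: pQ => _ -> _ _ _.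
Qed.

Lemma pendant_ncyc2 A B u Q : pendant A u Q -> #|Q| = 2 -> B \subset A -> [disjoint B & Q] ->
  ncyc e B + 1 <= ncyc e A.
Proof.
move=> pQ cQ sBA dBQ; have := pQ; case=> uA uQ sQ _ cnQ.
have /cards2P[x [y [xy QE]]] : #|Q| == 2 by rewrite cQ.
have xQ : x \in Q by rewrite QE !inE eqxx.
have yQ : y \in Q by rewrite QE !inE eqxx orbT.
have adj a b : a \in u |: Q -> b \in u |: Q -> a != b -> e a b := pendant_adj pQ (x := a) (y := b).
apply: (@ncyc_triangle _ e es ei A B x y u) => //.
- by apply/negP => xB; have /setP/(_ x) := disjoint_setI0 dBQ; rewrite !inE xB xQ.
- by rewrite !subUset !sub1set uA !(subsetP sQ).
- by apply: adj; rewrite // inE ?xQ ?yQ orbT.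
- by apply: adj; rewrite ?inE ?eqxx ?yQ ?orbT //; apply: contraNneq uQ => <-.
- by apply: adj; rewrite ?inE ?eqxx ?xQ ?orbT //; apply: contraNneq uQ => <-.
Qed.

Lemma pendant_ncyc3 A B u Q : pendant A u Q -> #|Q| = 3 -> B \subset A -> [disjoint B & Q] ->
  ncyc e B + 7 <= ncyc e A.
Proof.
move=> pQ cQ sBA dBQ; have := pQ; case=> uA uQ sQ _ cnQ.
have [x xQ] : exists x, x \in Q by apply/card_gt0P; rewrite cQ.
have /cards2P[y [z [yz QE]]] : #|Q :\ x| == 2 by move: cQ; rewrite (cardsD1 x) xQ add1n => -[->].
have : y \in Q :\ x by rewrite QE !inE eqxx.
have : z \in Q :\ x by rewrite QE !inE eqxx orbT.
rewrite !inE => /andP[zx zQ] /andP[yx yQ].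
have adj a b : a \in u |: Q -> b \in u |: Q -> a != b -> e a b := pendant_adj pQ (x := a) (y := b).
have out a : a \in Q -> a \notin B.
  by move=> aQ; apply/negP => aB; have /setP/(_ a) := disjoint_setI0 dBQ; rewrite !inE aB aQ.
have ua a : a \in Q -> u != a by move=> aQ; apply: contraNneq uQ => ->.
have uu : u \in u |: Q := setU11 _ _.
have inu a : a \in Q -> a \in u |: Q by move=> aQ; rewrite inE aQ orbT.
apply: (@ncyc_K4 _ e es ei A B u x y z); rewrite ?out //.
- by rewrite !subUset !sub1set uA !(subsetP sQ).
- by apply: adj; [| exact: inu | exact: ua].
- by apply: adj; [| exact: inu | exact: ua].
- by apply: adj; [| exact: inu | exact: ua].
- by apply: adj; rewrite ?inu // eq_sym.
- by apply: adj; rewrite ?inu // eq_sym.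
- by apply: adj; rewrite ?inu // eq_sym.
Qed.

(** No maximum independent set contains u, since u could be exchanged for a vertex
    of each of the two cliques. *)
Lemma cnt_two_pendants A u Q1 Q2 k : pendant A u Q1 -> pendant A u Q2 -> [disjoint Q1 & Q2] ->
  alpha_le e A k -> exists j, alpha_le e (A :\: (u |: (Q1 :|: Q2))) j /\
    cnt e A k = #|Q1| * (#|Q2| * cnt e (A :\: (u |: (Q1 :|: Q2))) j).
Proof.
move=> p1 p2 dQ al; have := p1; case=> uA uQ1 sQ1 /andP[/card_gt0P[q1 q1Q] _] cnQ1.
have := p2; case=> _ uQ2 sQ2 /andP[/card_gt0P[q2 q2Q] _] cnQ2.
have q1A := subsetP sQ1 _ q1Q; have q2A := subsetP sQ2 _ q2Q.
have dis x : x \in Q1 -> x \notin Q2 by move=> x1; rewrite (disjointFr dQ x1).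
have u1 : u != q1 by apply: contraNneq uQ1 => ->.
have u2 : u != q2 by apply: contraNneq uQ2 => ->.
have e1u : e u q1 by apply: (pendant_adj p1); rewrite ?setU11 // inE q1Q orbT.
have e2u : e u q2 by apply: (pendant_adj p2); rewrite ?setU11 // inE q2Q orbT.
case: k al => [|k] al; first by rewrite (alpha_le0 ei al) inE in uA.
have cu0 : cnt e (A :\: cn e A u) k = 0.
  apply/eqP; rewrite -leqn0 leqNgt; apply/negP => /cnt_witness[S [sS iS cS]].
  have sub2 : S \subset A :\: cn e A q1.
    apply/subsetP => x xS; have := subsetP sS x xS; rewrite !in_setD => /andP[xu ->]; rewrite andbT.
    by rewrite cnQ1 //; apply: contra xu => /(subsetP (pendant_cn p1)).
  have i1 : indep e (q1 |: S) by apply: (indep_add es ei sub2).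
  have sub3 : q1 |: S \subset A :\: cn e A q2.
    rewrite subUset sub1set in_setD q1A andbT cnQ2 // in_setU1 negb_or eq_sym u1 dis //=.
    apply/subsetP => x xS; have := subsetP sS x xS; rewrite !in_setD => /andP[xu ->]; rewrite andbT.
    by apply: contra xu => /(subsetP (pendant_cn p2)).
  have i2 : indep e (q2 |: (q1 |: S)) by apply: (indep_add es ei sub3).
  have := al _ _ i2; rewrite subUset sub1set q2A (subset_trans sub3) ?subsetDl // => /(_ isT).
  by rewrite !cardsU1 (notin_del_cn sub3) (notin_del_cn sub2) cS; narith.
rewrite (cnt_del es ei k uA) cu0 addn0.
have cnu q Q : q \in Q -> u \notin Q -> cn e A q = u |: Q -> cn e (A :\ u) q = Q.
  move=> qQ uQ cnq; apply/setP => x; rewrite in_cn !inE.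
  have /setP/(_ x) := cnq; rewrite in_cn !inE.
  case: (eqVneq x u) => [->|_] /=; last by [].
  by rewrite (negbTE uQ) orbF => _; apply: contraNF uQ => /eqP->.
have alu : alpha_le e (A :\ u) k.+1 by apply: alpha_leS al; apply: subsetDl.
have q1u : q1 \in A :\ u by rewrite !inE eq_sym u1.
have step B Q q j : q \in B -> q \in Q -> alpha_le e B j.+1 ->
   (forall x, x \in Q -> cn e B x = Q) -> cnt e B j.+1 = #|Q| * cnt e (B :\: Q) j.
  move=> qB qQ alB cnB; rewrite (cnt_simplicial es ei qB alB); last first.
    rewrite cnB // => x y xQ yQ xy; move: yQ; rewrite -(cnB x xQ) in_cn eq_sym (negbTE xy).
    by case/andP.
  by rewrite cnB // -sum_nat_const; apply: eq_bigr => x xQ; rewrite cnB.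
have cn1 x : x \in Q1 -> cn e (A :\ u) x = Q1 by move=> xQ; apply: cnu (cnQ1 x xQ).
have cn2 x : x \in Q2 -> cn e ((A :\ u) :\: Q1) x = Q2.
  move=> xQ; have /setP := cnu _ _ xQ uQ2 (cnQ2 x xQ) => E; apply/setP => y.
  have := E y; rewrite !in_cn !in_setD; case: (boolP (y \in Q1)) => //= y1.
  rewrite orbF (negbTE (dis y y1)); case: (y == x); rewrite //=.
rewrite (step _ Q1 q1) //.
have al1 : alpha_le e ((A :\ u) :\: Q1) k by rewrite -(cn1 q1 q1Q); apply: (alpha_del es ei q1u alu).
have q2B : q2 \in (A :\ u) :\: Q1.
  rewrite in_setD !inE q2A (eq_sym q2) u2 andbT.
  by rewrite andbT; apply: contraL q2Q => q21; apply: dis.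
have EQ : A :\: (u |: (Q1 :|: Q2)) = (A :\ u) :\: Q1 :\: Q2 by rewrite !setDDl setUA.
case: k al al1 {cu0 alu} => [|k] al al1; first by rewrite (alpha_le0 ei al1) inE in q2B.
exists k; rewrite EQ; split; last by rewrite (step _ Q2 q2).
by rewrite -(cn2 q2 q2Q); apply: (alpha_del es ei q2B al1).
Qed.

End Pendant.

(** * The inductive step for each reduction *)

Lemma disjoint_setD (T : finType) (B Q : {set T}) : [disjoint B :\: Q & Q].
Proof.
rewrite -setI_eq0; apply/eqP/setP => x; rewrite !inE.
by case: (x \in Q); rewrite ?andbF.
Qed.

Section Steps.
Variables (V : finType) (e : rel V).
Hypotheses (es : symmetric e) (ei : irreflexive e).
Variables (A : {set V}) (k : nat).
Hypotheses (cA : conn e A) (A5 : 5 <= #|A|) (al : alpha_le e A k.+1).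
Hypothesis smaller : forall (e' : rel V) (A' : {set V}) k', symmetric e' -> irreflexive e' ->
  0 < #|A'| < #|A| -> conn e' A' -> alpha_le e' A' k' ->
  36 * cnt e' A' k' <= bound #|A'| (ncyc e' A').
Implicit Types (B C D Q R S T W : {set V}) (u v w x y z : V).

(** At least six cycles pass through v. *)
Lemma step_deg4 v : v \in A -> conn e (A :\ v) -> 4 <= #|nb e A v| ->
  36 * cnt e A k.+1 + tight #|A| (ncyc e A) <= bound #|A| (ncyc e A).
Proof.
move=> vA cv d4; rewrite (cnt_del es ei k vA).
have c1 : #|A :\ v| = #|A|.-1 by rewrite (cardsD1 v A) vA.
have le1 := smaller es ei (A' := A :\ v) (k' := k.+1).
have {}le1 := le1 ltac:(rewrite c1; narith) cv (alpha_leS (subsetDl _ _) al).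
have le2 := @cnt_del_cn_le _ e es ei A k v (#|A| - 5) vA al ltac:(narith).
have le3 := ncyc_noncut es ei cv vA.
have le4 : 6 <= 'C(#|nb e A v|, 2) by apply: leq_trans (leq_bin2l 2 d4).
have le5 := bound_mono (#|A|.-1) (c := ncyc e (A :\ v)) (c' := ncyc e A - 6) ltac:(narith).
have := bound_deg4 (c := ncyc e A) A5 ltac:(narith).
by rewrite c1 in le1; narith.
Qed.

Lemma step_fold v a b : v \in A -> a != b -> e a b = false -> nb e A v = [set a; b] ->
  [/\ cnt e (A :\: cn e A v) k <= g (#|A| - 3),
   36 * cnt (fold e a b) (A :\: [set v; b]) k <= bound (#|A| - 2) (ncyc e A) &
   36 * cnt e A k.+1 <= bound #|A| (ncyc e A)].
Proof.
move=> vA ab eab nv; have eba : e b a = false by rewrite es.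
have le1 := cnt_fold es ei vA ab eab nv al.
have le2 : cnt e (A :\: cn e A v) k <= g (#|A| - 3).
  apply: (cnt_le_gn es ei); first exact: (alpha_del es ei vA al).
  by rewrite (card_fold_del ei vA ab nv).
have cF := card_fold ei vA nv.
have le3 := smaller (fold_sym es a b) (fold_irr ei eba) (A' := A :\: [set v; b]) (k' := k).
have {}le3 := le3 ltac:(rewrite cF; narith) (conn_fold es ei ab vA nv cA)
   (alpha_fold es ei vA eab nv al).
have le4 := bound_mono (#|A| - 2) (ncyc_fold es ei vA ab nv).
rewrite cF in le3.
have le5 := bound_pair (ncyc e A) A5.
by split=> //; move: le1 le2 le3 le4 le5; clear; narith.
Qed.

(** If A \ N[z] were a disjoint union of triangles, [ncyc_del_triangles] would
    provide too many cycles. *)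
Lemma few_del_cn z a b c F0 : z \in A -> nb e A z = [set a; b; c] ->
  uniq [:: a; b; c] -> e a b = false -> F0 \in cycles e A -> c \in cover F0 ->
  low #|A| (ncyc e A) -> 9 * cnt e (A :\: cn e A z) k <= 8 * g (#|A| - 4).
Proof.
move=> zA nz us eab F0A cF0 lo; have [s nE] : exists s, #|A| = 3 * s.+2 + 1.
  by case: (split3 A5) => s E; rewrite ?(low_0 _ E) ?(low_2 _ E) // in lo; exists s.
rewrite (low_1 _ nE) in lo.
have cD : #|A :\: cn e A z| = 3 * s.+1.
  by rewrite (card_del_cn ei) // nz cards3 // nE; narith.
have E4 : #|A| - 4 = 3 * s.+1 by rewrite nE; narith.
case: (triangles_or_few es ei (alpha_del es ei zA al) cD) => [tD|]; last by rewrite E4.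
case: (posnP (cnt e (A :\: cn e A z) k)) => [->|c0]; first by rewrite muln0.
by have := ncyc_del_triangles es ei zA nz us eab F0A cF0 tD al c0; rewrite cD; narith.
Qed.

(** Branch on v, and merge x and y at w in the rest. When the order is 1 modulo
    3, both neighbourhood terms need the factor 8/9; the cycles that
    [few_del_cn] asks for are one through two neighbours of v. *)
Lemma step_matching v w x y : v \in A -> w \in A -> conn e (A :\ v) -> #|nb e A v| = 3 ->
  nb e A w = [set v; x; y] -> uniq [:: v; x; y] -> e x y = false ->
  36 * cnt e A k.+1 + tight #|A| (ncyc e A) <= bound #|A| (ncyc e A).
Proof.
move=> vA wA cv d3 nw us exy.
have vw : v \in nb e A w by rewrite nw !inE eqxx.
have [_ ewv evw vw'] := nb_memP es ei vw.
have wv : w \in nb e A v by rewrite inE wA.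
have wv' : w != v by rewrite eq_sym.
move: (us); rewrite /= !inE negb_or => /and3P[/andP[vx vy] xy _].
have nw' : nb e (A :\ v) w = [set x; y].
  apply/setP => z; have /setP/(_ z) := nw; rewrite !inE.
  by case: (eqVneq z v) => [->|zv] E; rewrite /= ?(negbTE vx) ?(negbTE vy) // E.
have wAv : w \in A :\ v by rewrite !inE wv'.
have alv : alpha_le e (A :\ v) k.+1 by apply: alpha_leS al; apply: subsetDl.
have cAv : #|A :\ v| = #|A|.-1 by rewrite (cardsD1 v A) vA.
rewrite (cnt_del es ei k vA).
have le1 := cnt_fold es ei wAv xy exy nw' alv.
rewrite -(nb_del wv') in le1; last by rewrite in_cn vA ewv orbT.
have cF : #|(A :\ v) :\: [set w; y]| = #|A| - 3.
  by rewrite (card_fold ei wAv nw') cAv; narith.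
have eyx : e y x = false by rewrite es.
have le2 := smaller (fold_sym es x y) (fold_irr ei eyx) (A' := (A :\ v) :\: [set w; y]) (k' := k).
have {}le2 := le2 ltac:(rewrite cF; narith) (conn_fold es ei xy wAv nw' cv)
   (alpha_fold es ei wAv exy nw' alv).
have le3 := ncyc_fold es ei wAv xy nw'.
have le4 := ncyc_noncut es ei cv vA; rewrite d3 in le4.
have le5 : 1 <= 'C(3, 2) by [].
have le6 := bound_mono (#|A| - 3) (c := ncyc (fold e x y) ((A :\ v) :\: [set w; y]))
   (c' := ncyc e A - 1) ltac:(narith).
rewrite cF in le2.
have dw : #|nb e A w| = 3 by rewrite nw cards3.
have le7 := @cnt_del_cn_le _ e es ei A k v (#|A| - 4) vA al ltac:(narith).
have le8 := @cnt_del_cn_le _ e es ei A k w (#|A| - 4) wA al ltac:(narith).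
have := bound_matching A5 (c := ncyc e A) (J := cnt e (A :\: cn e A v) k)
   (J' := cnt e (A :\: cn e A w) k) ltac:(narith) le7 le8.
case lo : (low #|A| (ncyc e A)); last by move=> /(_ ltac:(by [])); narith.
move=> H; suff [f1 f2] : 9 * cnt e (A :\: cn e A v) k <= 8 * g (#|A| - 4) /\
    9 * cnt e (A :\: cn e A w) k <= 8 * g (#|A| - 4).
  by have := H ltac:(by []); narith.
(* otherwise the neighbours of v form a clique, to which x and y belong *)
have [a [b [av bv ab eab]]] : exists a b, [/\ a \in nb e A v, b \in nb e A v, a != b & e a b = false].
  case: (clique_or_not e (nb e A v)) => // cl.
  suff : x \in nb e A v /\ y \in nb e A v by case=> xv yv; rewrite cl in exy.
  have sub : nb e A v :\ w \subset [set x; y].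
    apply/subsetP => z; rewrite in_setD1 => /andP[zw zv]; rewrite -nw' inE.
    have [zA evz ezv zv'] := nb_memP es ei zv.
    by rewrite !inE zv' zA cl // eq_sym.
  have E : nb e A v :\ w = [set x; y].
    apply/eqP; rewrite eqEcard sub cards2 xy.
    by move: d3; rewrite (cardsD1 w) wv add1n => -[->].
  by move/setP: E => E; have := E x; have := E y; rewrite !inE !eqxx orbT /=;
    case/andP=> _ -> /andP[_ ->].
have [c cv' cn'] : exists2 c, c \in nb e A v & c \notin [set a; b].
  apply/subsetPn; apply/negP => /subset_leq_card; rewrite d3 cards2 ab; narith.
move: cn'; rewrite !inE negb_or => /andP[ca cb].
have us' : uniq [:: a; b; c] by rewrite /= !inE negb_or ab !(eq_sym _ c) ca cb.
have nv : nb e A v = [set a; b; c].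
  by apply: set3_of => //; rewrite !subUset !sub1set av bv.
have [F0 F0A F0E] := cycle_through es ei cv vA av cv' ltac:(by rewrite eq_sym).
have in0 z : z \in [set a; c] -> [set v; z] \in F0 by rewrite -F0E inE.
have cov z : z \in [set a; c] -> z \in cover F0 /\ v \in cover F0.
  by move=> zac; split; apply/bigcupP; exists [set v; z]; rewrite ?in0 ?set21 ?set22.
split.
  by apply: (few_del_cn vA nv us' eab F0A _ lo); have [] := cov c ltac:(by rewrite !inE eqxx orbT).
apply: (@few_del_cn w x y v F0 wA _ _ exy F0A _ lo).
- by rewrite nw -setUA setUC.
- by rewrite /= !inE negb_or xy !(eq_sym _ v) vx vy.
by have [] := cov a ltac:(by rewrite !inE eqxx).
Qed.

Section PendantStep.
Variables (u : V) (Q : {set V}).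
Hypotheses (pQ : pendant e A u Q) (cR : conn e (A :\: (u |: Q))).
Local Notation R := (A :\: (u |: Q)).

Lemma pendant_card3 : 0 < #|Q| <= 3.
Proof. by case: pQ. Qed.

Lemma pendant_next : exists p, [/\ p \in R, e u p & p \in nb e A u].
Proof.
have sA := pendant_sub pQ; have := pQ; case=> uA uQ sQ _ cnQ.
have cR' : #|R| = #|A| - #|Q|.+1 := card_pendant pQ.
have R0 : 0 < #|R| by move: pendant_card3; rewrite cR'; narith.
have [x [y [xQ yA yQ exy]]] : exists x y, [/\ x \in u |: Q, y \in A, y \notin u |: Q & e x y].
  apply: conn_edge => //; first by apply/set0Pn; exists u; apply: setU11.
  by apply: contraTneq R0 => ->; rewrite setDv cards0.
have xu : x = u.
  apply/eqP; move: xQ; rewrite in_setU1 => /orP[//|xQ].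
  by case/negP: yQ; rewrite -(cnQ x xQ) in_cn yA exy orbT.
by rewrite xu in exy; exists y; rewrite in_setD yQ yA in_nb yA exy.
Qed.

Lemma pendant_rest_bound :
  36 * cnt e R k <= bound (#|A| - #|Q|.+1) (ncyc e R).
Proof.
rewrite -(card_pendant pQ); apply: smaller => //; last exact: (pendant_alpha es ei pQ al).
by rewrite (card_pendant pQ); move: pendant_card3; narith.
Qed.

Lemma cn_u_card : #|Q|.+2 <= #|cn e A u|.
Proof.
have [p [pR eup pn]] := pendant_next; have := pQ; case=> uA uQ sQ _ cnQ.
have <- : #|p |: (u |: Q)| = #|Q|.+2.
  by move: pR; rewrite in_setD => /andP[pQ' _]; rewrite !cardsU1 pQ' uQ.
apply: subset_leq_card; rewrite subUset sub1set (pendant_cn es pQ) andbT.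
by rewrite in_setU pn orbT.
Qed.

Lemma pendant_u_card : #|A :\: cn e A u| + #|Q|.+2 <= #|A|.
Proof.
have := pQ; case=> uA _ _ _ _.
have := cn_u_card; rewrite (card_del_cn ei uA) card_cn //.
by have := nb_lt ei uA; narith.
Qed.

Lemma pendant_u_bound : cnt e (A :\: cn e A u) k <= g (#|A| - #|Q|.+2).
Proof.
have := pQ; case=> uA _ _ _ _.
apply: (cnt_le_gn es ei); first exact: (alpha_del es ei uA al).
by have := pendant_u_card; narith.
Qed.

Lemma disjoint_rest : [disjoint R & Q].
Proof.
rewrite -setI_eq0; apply/eqP/setP => x; rewrite !inE negb_or.
by case: (x \in Q); rewrite ?andbF.
Qed.

Lemma ncyc_rest : ncyc e R <= ncyc e A.
Proof. by apply: ncycS; apply: subsetDl. Qed.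

Lemma step_leaf : #|Q| = 1 -> 36 * cnt e A k.+1 <= bound #|A| (ncyc e A).
Proof.
move=> Q1; rewrite (cnt_pendant es ei pQ al).
have := pendant_rest_bound; have := pendant_u_bound; rewrite Q1 mul1n => l1 l2.
have l3 := bound_mono (#|A| - 2) ncyc_rest.
by have := bound_pair (ncyc e A) A5; narith.
Qed.

Lemma step_K4 : #|Q| = 3 ->
  36 * cnt e A k.+1 + tight #|A| (ncyc e A) <= bound #|A| (ncyc e A).
Proof.
move=> Q3; rewrite (cnt_pendant es ei pQ al).
have := pendant_rest_bound; have := pendant_u_bound; rewrite Q3 => l1 l2.
have l3 := pendant_ncyc3 es ei pQ Q3 (subsetDl A (u |: Q)) disjoint_rest.
have l4 := bound_mono (#|A| - 4) (c := ncyc e R) (c' := ncyc e A - 7) ltac:(narith).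
by have := bound_K4 (c := ncyc e A) A5 ltac:(narith); narith.
Qed.

(** If the rest were a disjoint union of triangles, a neighbour p of u would see
    one of them entirely, and the pendant triangle is one more cycle. *)
Lemma few_after_triangle : #|Q| = 2 -> low #|A| (ncyc e A) ->
  9 * cnt e (A :\: cn e A u) k <= 8 * g (#|A| - 4).
Proof.
move=> Q2 lo; have [s nE] : exists s, #|A| = 3 * s.+2 + 1.
  by case: (split3 A5) => s E; rewrite ?(low_0 _ E) ?(low_2 _ E) // in lo; exists s.
rewrite (low_1 _ nE) in lo.
have := pQ; case=> uA uQ sQ _ cnQ.
have alu := alpha_del es ei uA al.
have E4 : #|A| - 4 = 3 * s.+1 by rewrite nE; narith.
have := pendant_u_card; rewrite Q2 => cu.
case: (leqP #|A| (#|A :\: cn e A u| + 4)) => cu'; last first.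
  have := cnt_le_gn es ei alu (n := 3 * s + 2) ltac:(narith).
  by rewrite E4; move: (gap_arith2 s); narith.
have cD : #|A :\: cn e A u| = 3 * s.+1 by narith.
case: (triangles_or_few es ei alu cD) => [tD|]; last by rewrite E4.
case: (posnP (cnt e (A :\: cn e A u) k)) => [->|c0]; first by rewrite muln0.
have [p [pR eup pn]] := pendant_next.
have pD : p \notin A :\: cn e A u by rewrite in_setD in_setU pn orbT.
have RE : R = p |: (A :\: cn e A u).
  apply/esym/eqP; rewrite eqEcard; apply/andP; split.
    rewrite subUset sub1set pR /=; apply: setDS; exact: pendant_cn.
  by rewrite (card_pendant pQ) cardsU1 pD Q2 cD; narith.
have alR : alpha_le e (p |: (A :\: cn e A u)) k by rewrite -RE; apply: (pendant_alpha es ei pQ al).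
have := ncyc_cone_triangles es ei tD pD alR c0; rewrite -RE cD => l1.
have := pendant_ncyc2 es ei pQ Q2 (subsetDl A (u |: Q)) disjoint_rest.
by narith.
Qed.

Lemma step_triangle : #|Q| = 2 -> 36 * cnt e A k.+1 <= bound #|A| (ncyc e A).
Proof.
move=> Q2; rewrite (cnt_pendant es ei pQ al).
have := pendant_rest_bound; have := pendant_u_bound; rewrite Q2 => l1 l2.
have l3 := pendant_ncyc2 es ei pQ Q2 (subsetDl A (u |: Q)) disjoint_rest.
have l4 := bound_mono (#|A| - 3) (c := ncyc e R) (c' := ncyc e A - 1) ltac:(narith).
have := bound_triangle A5 (c := ncyc e A) (J := cnt e (A :\: cn e A u) k) ltac:(narith) l1.
by move/(_ (few_after_triangle Q2)); narith.
Qed.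

End PendantStep.

(** The factor 8/9 comes from [cut_arith], unless two K4s hang at u, which have
    fourteen cycles. *)
Lemma step_cut u Q1 Q2 : pendant e A u Q1 -> pendant e A u Q2 -> [disjoint Q1 & Q2] ->
  36 * cnt e A k.+1 + tight #|A| (ncyc e A) <= bound #|A| (ncyc e A).
Proof.
move=> p1 p2 dQ; have [j [alj ->]] := cnt_two_pendants es ei p1 p2 dQ al.
set B := A :\: _ in alj *.
have Q13 := pendant_card3 p1; have Q23 := pendant_card3 p2.
have [uA uQ1 sQ1 _ _] := p1; have [_ uQ2 sQ2 _ _] := p2.
have sU : u |: (Q1 :|: Q2) \subset A by rewrite !subUset sub1set uA sQ1 sQ2.
have cU : #|u |: (Q1 :|: Q2)| = (#|Q1| + #|Q2|).+1.
  rewrite cardsU1 in_setU negb_or uQ1 uQ2 cardsU.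
  by have /eqP -> : Q1 :&: Q2 == set0; rewrite ?setI_eq0 // cards0 subn0.
have cB : #|B| = #|A|.-1 - #|Q1| - #|Q2|.
  by rewrite cardsD (setIidPr sU) cU; narith.
have lt : #|Q1| + #|Q2| < #|A| by rewrite -cU; apply: subset_leq_card.
have le1 : cnt e B j <= g (#|A|.-1 - #|Q1| - #|Q2|) by rewrite -cB; apply: cnt_le_g.
have b1 : #|Q2| * cnt e B j <= g (#|A|.-1 - #|Q1|).
  apply: leq_trans (_ : #|Q2| * g (#|A|.-1 - #|Q1| - #|Q2|) <= _).
    by rewrite leq_mul2l le1 orbT.
  by apply: leq_trans (g_mul _ _) _; [narith | apply: g_mono; narith].
have b2 : #|Q1| * (#|Q2| * cnt e B j) <= g #|A|.-1.
  apply: leq_trans (_ : #|Q1| * g (#|A|.-1 - #|Q1|) <= _).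
    by rewrite leq_mul2l b1 orbT.
  by apply: leq_trans (g_mul _ _) _; [narith | apply: g_mono; narith].
apply: bound_cut => // lo.
case lt3: ((#|Q1| < 3) || (#|Q2| < 3)).
  apply: leq_trans (cut_arith A5 Q13 Q23 lt lo lt3).
  by rewrite leq_mul2l leq_mul2l leq_mul2l le1 !orbT.
have [s nE] : exists s, #|A| = 3 * s.+2 + 1.
  by case: (split3 A5) => s E; rewrite ?(low_0 _ E) ?(low_2 _ E) // in lo; exists s.
rewrite (low_1 _ nE) in lo.
have [Q1E Q2E] : #|Q1| = 3 /\ #|Q2| = 3.
  by move/negbT: lt3; rewrite negb_or -!leqNgt; narith.
have cB3 : #|B| = 3 * s by rewrite cB Q1E Q2E nE; narith.
rewrite Q1E Q2E (_ : #|A|.-1 = 3 * s.+2); last by rewrite nE; narith.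
case: (triangles_or_few es ei alj cB3) => [tB|]; last by rewrite !g0 !expnS; narith.
have sB : B \subset A :\: Q1 by apply: setDS; rewrite setUA -setUA setUCA subsetUl.
have sB1 : B \subset A :\: Q1 :\: Q2.
  by rewrite setDDl; apply: setDS; apply: subsetUr.
have l1 := triangles_ncyc es ei tB.
have l2 : ncyc e B <= ncyc e (A :\: Q1 :\: Q2) := ncycS e sB1.
have d1 := disjoint_setD A Q1.
have l3 := pendant_ncyc3 es ei p1 Q1E (subsetDl A Q1) d1.
have p2' : pendant e (A :\: Q1) u Q2.
  have := p2; case=> _ _ _ c2 cn2; split; rewrite ?in_setD ?uA ?uQ1 //.
    by rewrite subsetD sQ2 disjoint_sym.
  move=> q qQ2; rewrite -(cn2 q qQ2); apply/setP => x; rewrite !in_cn in_setD.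
  case: (boolP (x \in Q1)) => //= xQ1; rewrite orbF.
  have : x \notin cn e A q.
    by rewrite cn2 // in_setU1 negb_or (disjointFr dQ xQ1) andbT; apply: contraNneq uQ1 => <-.
  by rewrite in_cn negb_or => /andP[/negbTE-> /negbTE->].
have d2 := disjoint_setD (A :\: Q1) Q2.
have := pendant_ncyc3 es ei p2' Q2E (subsetDl (A :\: Q1) Q2) d2.
by narith.
Qed.

End Steps.

(** * The upper bound *)

Section Bound.
Variables (V : finType).
Implicit Types (e : rel V) (A B C D Q R S T W : {set V}) (u v w x y z : V) (k : nat).

Lemma four_elements A : #|A| = 4 ->
  exists x y z w, uniq [:: x; y; z; w] /\ [set x; y; z; w] \subset A.
Proof.
rewrite cardE; case E: (enum A) (enum_uniq A) => [|x [|y [|z [|w [|]]]]] // us _.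
exists x, y, z, w; split=> //; rewrite !subUset !sub1set -!(mem_enum A) E !inE.
by rewrite !eqxx !orbT.
Qed.

Lemma bound_small e A k : symmetric e -> irreflexive e -> conn e A -> alpha_le e A k ->
  0 < #|A| <= 4 -> 36 * cnt e A k <= bound #|A| (ncyc e A).
Proof.
move=> es ei cA al A4; have le := cnt_le_g es ei al.
have [E|[E|[E|E]]] : #|A| = 1 \/ #|A| = 2 \/ #|A| = 3 \/ #|A| = 4 by narith.
- move: le; rewrite E g_vals => le; rewrite (_ : 1 = 3 * 0 + 1) // bound_1 /bound1.
  by case: ifP => _; rewrite /= !expn0; narith.
- by move: le; rewrite E g_vals => le; rewrite (_ : 2 = 3 * 0 + 2) // bound_2 /bound2 /=; narith.
- have E3 : #|A| = 3 * 1 by rewrite E.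
  rewrite E3 bound_0 /bound0; case: (triangles_or_few es ei al E3) => [tA|few].
    have := triangles_ncyc es ei tA; rewrite E => c1.
    have -> : (ncyc e A < 1) = false by narith.
    by move: le; rewrite E g_vals !expn1; narith.
  by move: few; rewrite g0 !expn1; case: ifP => _; narith.
have E4 : #|A| = 3 * 1 + 1 by rewrite E.
rewrite E4 bound_1 /bound1 /=; move: le; rewrite E g_vals => le.
case: (ltnP (cnt e A k) 4) => c4.
  by case: ifP => _; rewrite ?expn1; narith.
case: (four_vertices es ei al E c4) => [cl|[x [y [z [w [us AE exy ezw no]]]]]].
  have [x [y [z [w [us sA]]]]] := four_elements E.
  move: us (sA); rewrite /= !inE !negb_or -!andbA !subUset !sub1set -!andbA.
  case/and5P=> xy xz xw yz /and3P[yw zw _] /and4P[xA yA zA wA].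
  have := @ncyc_K4 _ e es ei A set0 x y z w (sub0set _).
  rewrite !inE => /(_ isT isT isT sA).
  move/(_ ltac:(exact: cl) ltac:(exact: cl) ltac:(exact: cl) ltac:(exact: cl) ltac:(exact: cl)
    ltac:(exact: cl)) => c7.
  have -> : (ncyc e A < 7) = false by narith.
  by rewrite !expn1; narith.
exfalso; have zA : z \in A by rewrite AE !inE eqxx !orbT.
have : [set x; y] = A.
  apply: cA.
  - by rewrite AE -setUA subsetUl.
  - by apply/set0Pn; exists x; rewrite !inE eqxx.
  move=> a b axy; rewrite AE -setUA in_setU => /orP[//|bzw].
  by rewrite no.
move/setP/(_ z); rewrite zA !inE; move: us; rewrite /= !inE !negb_or -!andbA.
by case/and5P=> _ xz _ yz _; rewrite !(eq_sym z) (negbTE xz) (negbTE yz).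
Qed.

Theorem cnt_bound e A k : symmetric e -> irreflexive e -> 0 < #|A| -> conn e A ->
  alpha_le e A k -> 36 * cnt e A k <= bound #|A| (ncyc e A).
Proof.
(* by the order, and for equal order by the number of edges, which RedE lowers *)
move: {2}#|A|.+1 (ltnSn #|A|) => n; elim: n e A k => // n IHn e A k nA.
move: {2}#|[set p : V * V | e p.1 p.2]|.+1 (ltnSn #|[set p : V * V | e p.1 p.2]|) => m.
elim: m e k => // m IHm e k em es ei A0 cA al.
case: (ltnP #|A| 5) => A5; first by apply: bound_small => //; rewrite A0 -ltnS.
case: k al => [|k] al; first by rewrite (alpha_le0 ei al) cards0 in A0.
have smaller (e' : rel V) (A' : {set V}) k' : symmetric e' -> irreflexive e' ->
    0 < #|A'| < #|A| -> conn e' A' -> alpha_le e' A' k' ->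
    36 * cnt e' A' k' <= bound #|A'| (ncyc e' A').
  move=> es' ei' /andP[A'0 A'A] cA' al'; apply: IHn => //.
  exact: leq_trans A'A _.
case: (reduce es ei cA A5).
- move=> x y xA yA exy cd ald; have sub := @dele_sub _ e x y.
  apply: leq_trans (_ : 36 * cnt (dele e x y) A k.+1 <= _).
    by rewrite leq_mul2l cnt_sub_rel.
  apply: leq_trans (bound_mono _ (ncyc_sub_rel A sub)).
  apply: IHm => //; [|exact: dele_sym|exact: dele_irr|exact: ald].
  by apply: leq_trans (dele_fewer exy) _.
- move=> v vA cv d4.
  by have := step_deg4 es ei A5 al smaller vA cv d4; narith.
- move=> v a b vA ab eab nv _ _.
  by have [] := step_fold es ei cA A5 al smaller vA ab eab nv.
- move=> v w x y vA wA cv d3 nw us exy.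
  by have := step_matching es ei A5 al smaller vA wA cv d3 nw us exy; narith.
- move=> u Q pQ cR; have := pendant_card3 pQ; rewrite -ltnS => /andP[Q0 Q3].
  have [Q1|[Q2|Q3']] : #|Q| = 1 \/ #|Q| = 2 \/ #|Q| = 3 by narith.
  + exact: (step_leaf es ei cA A5 al smaller pQ cR Q1).
  + exact: (step_triangle es ei cA A5 al smaller pQ cR Q2).
  + by have := step_K4 es ei cA A5 al smaller pQ cR Q3'; narith.
- move=> u Q1 Q2 p1 p2 dQ.
  by have := step_cut es ei A5 al p1 p2 dQ; narith.
Qed.

End Bound.

(** * Bouquets *)

Section Cluster.
Variables (V : finType) (e : rel V).
Hypotheses (es : symmetric e) (ei : irreflexive e).
Implicit Types (A B C D P Q R S T W : {set V}) (r u v w x y z : V) (k t b : nat).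

(** The disjoint unions of complete graphs. *)
Definition cluster A := forall x y z, x \in A -> y \in A -> z \in A ->
  e x y -> e y z -> x != z -> e x z.

Lemma clusterS A B : A \subset B -> cluster B -> cluster A.
Proof. by move=> /subsetP s H x y z xA yA zA; apply: H; apply: s. Qed.

(** In a disjoint union of cliques every maximal independent set is maximum: each
    vertex of S0 has a partner in its clique, and distinct ones have distinct
    partners. *)
Lemma cluster_extend A (S0 P : {set V}) k : cluster A -> alpha_le e A k ->
  S0 \subset A -> indep e S0 -> #|S0| = k -> P \subset A -> indep e P ->
  exists S, [/\ S \subset A, indep e S, #|S| = k & P \subset S].
Proof.
move=> clA al sS0 iS0 cS0 sP iP.
pose good (S : {set V}) := (S \subset A) && indep e S.
have goodP : good P by rewrite /good sP.
have [S /maxsetP[/andP[sS iS] maxS] PS] := maxset_exists goodP.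
exists S; split=> //; apply/eqP; rewrite eqn_leq al //= -cS0.
have hit x : x \in S0 -> exists2 y, y \in S & (x == y) || e x y.
  move=> x0; case: (boolP [exists y in S, (x == y) || e x y]) => [/exists_inP|nx] //.
  have xA := subsetP sS0 x x0.
  have no y : y \in S -> (x == y) = false /\ e x y = false.
    move=> yS; suff /norP[/negbTE-> /negbTE->] : ~~ ((x == y) || e x y) by [].
    by apply: contra nx => H; apply/exists_inP; exists y.
  have : x |: S = S.
    apply: maxS; last exact: subsetUr.
    rewrite /good subUset sub1set xA sS /=; apply/indepP => a b.
    rewrite !inE => /orP[/eqP->|aS] /orP[/eqP->|bS].
    - exact: ei.
    - by have [] := no b bS.
    - by rewrite es; have [] := no a aS.
    - by move/indepP: iS; apply.
  by move=> E; have [] := no x; rewrite ?eqxx // -E setU11.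
pose f x := odflt x [pick y in S | (x == y) || e x y].
have fP x : x \in S0 -> f x \in S /\ (x == f x) || e x (f x).
  move=> x0; rewrite /f; case: pickP => [y /andP[yS H]|H] //=.
  by have [y yS Hy] := hit x x0; have := H y; rewrite yS Hy.
have fI : {in S0 &, injective f}.
  move=> x y x0 y0 E; have [fx Hx] := fP x x0; have [fy Hy] := fP y y0.
  rewrite -E in Hy; have exy : e x y = false by move/indepP: iS0 => ->.
  have [xA yA] : x \in A /\ y \in A by split; apply: (subsetP sS0).
  have fA := subsetP sS _ fx.
  case: (eqVneq x y) => // xy.
  case/orP: Hx => [/eqP xf|xf]; case/orP: Hy => [/eqP yf|yf].
  - by rewrite xf -yf.
  - by move: exy; rewrite {1}xf es yf.
  - by move: exy; rewrite {1}yf xf.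
  - by have := clA x (f x) y xA fA yA xf; rewrite exy (es _ y) => /(_ yf xy).
rewrite -(card_in_imset fI); apply: subset_leq_card.
by apply/subsetP => _ /imsetP[x x0 ->]; have [] := fP x x0.
Qed.

(** A triangle at r, to which t further triangles and b edges are attached by
    one vertex u each. Each of them raises the independence number k by one. *)
Inductive bouquet r : nat -> nat -> {set V} -> nat -> Prop :=
| bouquet_base x y of uniq [:: r; x; y] & e r x & e r y & e x y : bouquet r 0 0 [set r; x; y] 1
| bouquet_add t b A k u Q of pendant e A u Q & #|Q| <= 2 & nb e A u = r |: Q &
    bouquet r t b (A :\: (u |: Q)) k :
    bouquet r (t + (#|Q| == 2)) (b + (#|Q| == 1)) A k.+1.

Lemma bouquet_mem r t b A k : bouquet r t b A k -> r \in A.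
Proof.
elim=> [x y _ _ _ _|t' b' A' k' u Q _ _ _ _ IH]; first by rewrite !inE eqxx.
by move: IH; rewrite inE => /andP[].
Qed.

Lemma bouquet_k r t b A k : bouquet r t b A k -> 0 < k.
Proof. by case. Qed.

Lemma bouquet_card r t b A k : bouquet r t b A k -> #|A| = 3 + 3 * t + 2 * b.
Proof.
elim=> [x y us _ _ _|t' b' A' k' u Q pQ Q2 nu st IH]; first by rewrite cards3.
rewrite (card_pendant pQ) in IH; have [_ _ _ /andP[Q0 _] _] := pQ.
have := subset_leq_card (pendant_sub pQ); rewrite cardsU1.
have [_ -> _ _ _] := pQ; have [E|E] : #|Q| = 1 \/ #|Q| = 2 by narith.
  by rewrite E in IH *; rewrite /=; narith.
by rewrite E in IH *; rewrite /=; narith.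
Qed.

Lemma bouquet_alpha r t b A k : bouquet r t b A k -> alpha_le e A k.
Proof.
elim=> [x y us erx ery exy|t' b' A' k' u Q pQ Q2 nu st IH] S sS iS.
  rewrite leqNgt; apply/negP => /card_gt1P[p [q [pS qS pq]]].
  have := subsetP sS _ pS; have := subsetP sS _ qS; rewrite !inE -!orbA.
  move/indepP: iS => /(_ p q pS qS).
  by case=> + /or3P[] /eqP Eq /or3P[] /eqP Ep; move: pq; rewrite Eq Ep ?eqxx //;
    rewrite ?erx ?ery ?exy ?(es y) ?(es x) ?erx ?ery ?exy // => _; rewrite es ?exy.
have := IH (S :\: (u |: Q)) (setSD _ sS) (indepS (subsetDl _ _) iS).
have : #|S :&: (u |: Q)| <= 1.
  rewrite leqNgt; apply/negP => /card_gt1P[p [q []]].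
  rewrite !in_setI => /andP[pS pQ'] /andP[qS qQ'] pq.
  have := pendant_adj es pQ pQ' qQ' pq.
  by move/indepP: iS => ->.
by have := cardsID (u |: Q) S; narith.
Qed.

(** Without r, the attached cliques are components. *)
Lemma cn_pendant_other A u Q r x : pendant e A u Q -> r \in A -> r \notin u |: Q ->
  nb e A u = r |: Q -> x \in u |: Q -> cn e (A :\ r) x = u |: Q.
Proof.
move=> pQ rA rQ nu xQ; have := pQ; case=> uA uQ sQ _ cnQ.
apply/setP => z; rewrite in_cn in_setD1.
move: xQ; rewrite in_setU1 => /orP[/eqP->|xQ].
  rewrite in_setU1; case: (eqVneq z u) => //= zu.
  have /setP/(_ z) := nu; rewrite in_nb in_setU1.
  case: (eqVneq z r) => [->|zr] /= E; last exact: E.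
  by move: rQ; rewrite in_setU1 negb_or => /andP[_ /negbTE->].
rewrite -(cnQ x xQ) in_cn; case: (eqVneq z r) => [->|] //=.
have : r \notin cn e A x by rewrite cnQ.
by rewrite in_cn negb_or => /andP[/negbTE-> /negbTE->].
Qed.

Lemma bouquet_avoid r t b A k : bouquet r t b A k -> cnt e (A :\ r) k = 2 * 3 ^ t * 2 ^ b.
Proof.
move=> st; elim: st {-2}st => [x y us erx ery exy|t' b' A' k' u Q pQ Q2 nu st IH] st'.
  move: us; rewrite /= !inE negb_or => /and3P[/andP[rx ry] xy _].
  have -> : [set r; x; y] :\ r = [set x; y].
    apply/setP => z; rewrite !inE; case: (eqVneq z r) => [->|] //=.
    by rewrite (negbTE rx) (negbTE ry).
  have al : alpha_le e [set x; y] 1.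
    by apply: alpha_leS (bouquet_alpha st'); apply/subsetP => z; rewrite !inE => /orP[->|->]; rewrite ?orbT.
  have cnx z : z \in [set x; y] -> cn e [set x; y] z = [set x; y].
    rewrite !inE => /orP[] /eqP->; apply/setP => w; rewrite in_cn !inE.
      by case: (eqVneq w x) => //= _; case: (eqVneq w y) => [->|].
    case: (eqVneq w y) => [->|_] /=; first by rewrite orbT.
    by case: (eqVneq w x) => [->|] //=; rewrite es.
  have xI : x \in [set x; y] by rewrite !inE eqxx.
  rewrite (cnt_simplicial es ei xI al) cnx //; last first.
    by move=> p q; rewrite !inE => /orP[] /eqP-> /orP[] /eqP->; rewrite ?eqxx // es.
  rewrite (eq_bigr (fun=> 1)) => [|z zI]; last by rewrite cnx // cnt0.
  by rewrite sum_nat_const cards2 xy.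
have rR := bouquet_mem st; move: (rR); rewrite in_setD => /andP[rQ rA].
have := pQ; case=> uA uQ sQ /andP[Q0 _] cnQ.
have ur : u != r by apply: contraNneq rQ => <-; apply: setU11.
have uAr : u \in A' :\ r by rewrite in_setD1 ur.
have al : alpha_le e (A' :\ r) k'.+1 by apply: alpha_leS (bouquet_alpha st'); apply: subsetDl.
have cnr := cn_pendant_other pQ rA rQ nu.
rewrite (cnt_simplicial es ei uAr al) cnr ?setU11 //; last first.
  by move=> x y; apply: (pendant_adj es pQ).
rewrite (eq_bigr (fun=> 2 * 3 ^ t' * 2 ^ b')) => [|x xQ]; last first.
  by rewrite cnr // setDDl setUC -setDDl IH.
rewrite sum_nat_const cardsU1 uQ.
have [E|E] : #|Q| = 1 \/ #|Q| = 2 by narith.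
  by rewrite E /= !addn0 !addn1 expnS; move: (3 ^ _) (2 ^ _) => *; nia.
by rewrite E /= !addn0 !addn1 expnS; move: (3 ^ _) (2 ^ _) => *; nia.
Qed.

(** Next to r, an attached triangle or edge has only Q to offer. *)
Lemma bouquet_contain r t b A k : bouquet r t b A k -> cnt e (A :\: cn e A r) k.-1 = 2 ^ t.
Proof.
move=> st; elim: st {-2}st => [x y us erx ery exy|t' b' A' k' u Q pQ Q2 nu st IH] st'.
  by rewrite cnt0.
have rR := bouquet_mem st; move: (rR); rewrite in_setD => /andP[rQ rA].
have := pQ; case=> uA uQ sQ /andP[Q0 Q3] cnQ.
have ur : u != r by apply: contraNneq rQ => <-; apply: setU11.
have eur : e u r by have /setP/(_ r) := nu; rewrite in_nb setU11 => /andP[].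
have k0 := bouquet_k st; case: k' k0 st st' IH => // k' _ st st' IH /=.
set B := A' :\: cn e A' r.
have al : alpha_le e B k'.+1 by apply: (alpha_del es ei rA (bouquet_alpha st')).
have erQ x : x \in Q -> e r x = false.
  move=> xQ; apply/negP => erx; case/negP: rQ; rewrite -(cnQ x xQ) in_cn rA es erx.
  by rewrite orbT.
have sQB : Q \subset B.
  apply/subsetP => x xQ; rewrite in_setD (subsetP sQ) // in_cn (erQ x xQ) andbF orbF andbT.
  by apply: contraNneq rQ => <-; rewrite in_setU1 xQ orbT.
have uB : u \notin B by rewrite in_setD in_cn uA es eur orbT.
have cnB x : x \in Q -> cn e B x = Q.
  move=> xQ; apply/setP => z; have /setP/(_ z) := cnQ x xQ; rewrite !in_cn in_setU1.
  case: (boolP (z \in B)) => [zB|zB].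
    have -> : z \in A' by move: zB; rewrite in_setD => /andP[].
    by have -> : z == u = false by apply: contraNF uB => /eqP<-.
  rewrite /= orbF => _; case: (boolP (z \in Q)) => [/(subsetP sQB)|zQ].
    by rewrite (negbTE zB).
  by apply: contraNF zQ => /eqP->.
case/card_gt0P: (Q0) => q qQ; have qB := subsetP sQB q qQ.
rewrite (cnt_simplicial es ei qB al) cnB //; last first.
  by move=> x y xQ yQ; apply: (pendant_adj es pQ); rewrite in_setU1 ?xQ ?yQ orbT.
rewrite (eq_bigr (fun=> 2 ^ t')) => [|x xQ]; last first.
  rewrite cnB // -(IH st) /=; congr (cnt e _ k'); apply/setP => z.
  rewrite /B !in_setD !in_cn !in_setD in_setU1.
  case: (eqVneq z u) => [->|zu] /=; first by rewrite uA (es r) eur orbT !andbF.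
  by case: (z \in Q); case: (z \in A'); rewrite /= ?andbT ?andbF.
rewrite sum_nat_const; have [E|E] : #|Q| = 1 \/ #|Q| = 2 by narith.
  by rewrite E /= addn0 mul1n.
by rewrite E /= addn1 expnS.
Qed.

Lemma bouquet_total r t b A k : bouquet r t b A k -> cnt e A k = 2 * 3 ^ t * 2 ^ b + 2 ^ t.
Proof.
move=> st; rewrite -(bouquet_avoid st) -(bouquet_contain st).
by have := bouquet_k st; case: k st => // k st _; rewrite (cnt_del es ei k (bouquet_mem st)).
Qed.

Lemma bouquet_cluster r t b A k : bouquet r t b A k -> cluster (A :\ r).
Proof.
move=> st; elim: st {-2}st => [x y us erx ery exy|t' b' A' k' u Q pQ Q2 nu st IH] st'.
  move=> p q z; rewrite !inE => /andP[/negbTE-> /= pI] /andP[/negbTE-> /= qI] /andP[/negbTE-> /= zI] _ _.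
  by case/orP: pI => /eqP->; case/orP: zI => /eqP->; rewrite ?eqxx // es.
have rR := bouquet_mem st; move: (rR); rewrite in_setD => /andP[rQ rA].
have cnr := cn_pendant_other pQ rA rQ nu.
have nbr x z : x \in A' :\ r -> z \in A' :\ r -> e x z -> (x \in u |: Q) = (z \in u |: Q).
  move=> xA zA exz; apply/idP/idP => H; rewrite -(cnr _ H) in_cn ?xA ?zA ?exz ?orbT //.
  by rewrite es exz orbT.
move=> x y z xA yA zA exy eyz xz.
case: (boolP (x \in u |: Q)) => xQ.
  apply: (pendant_adj es pQ) => //.
  by rewrite -(nbr y z) // -(nbr x y).
have yQ : y \notin u |: Q by rewrite -(nbr x y).
have zQ : z \notin u |: Q by rewrite -(nbr y z).
by apply: (IH st x y z) => //; rewrite !inE in xA yA zA xQ yQ zQ *; rewrite ?xQ ?yQ ?zQ.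
Qed.

Lemma bouquet_nb r t b A k : bouquet r t b A k -> exists2 x, x \in A & e r x.
Proof.
elim=> [x y us erx ery exy|t' b' A' k' u Q pQ Q2 nu st [x xA erx]].
  by exists x; rewrite // !inE eqxx orbT.
by exists x => //; move: xA; rewrite in_setD => /andP[].
Qed.

Lemma bouquet_two_nbs r t b A k : bouquet r t b A k -> 3 < #|A| ->
  exists x u, [/\ x \in A, u \in A, e r x, e r u & x != u /\ e x u = false].
Proof.
case=> [x y us _ _ _|t' b' A' k' u Q pQ Q2 nu st _]; first by rewrite cards3.
have [x xR erx] := bouquet_nb st; have := pQ; case=> uA uQ sQ _ cnQ.
move: (xR); rewrite in_setD in_setU1 negb_or => /andP[/andP[xu xQ] xA].
have eur : e u r by have /setP/(_ r) := nu; rewrite in_nb setU11 => /andP[].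
exists x, u; split; rewrite // 1?es //; split=> //.
have /setP/(_ x) := nu; rewrite in_nb xA in_setU1 (negbTE xQ) orbF /= => ->.
by apply: contraTF erx => /eqP->; rewrite ei.
Qed.

(** Without r, or without the neighbours of r when r is x or y, the graph is a
    disjoint union of cliques, and [cluster_extend] applies. *)
Lemma bouquet_pair r t b A k x y : bouquet r t b A k -> x \in A -> y \in A -> x != y -> e x y = false ->
  exists S, [/\ S \subset A, indep e S, #|S| = k & [set x; y] \subset S].
Proof.
move=> st; have rA := bouquet_mem st; have al := bouquet_alpha st; have clA := bouquet_cluster st.
have atr z : z \in A -> z != r -> e r z = false ->
    exists S, [/\ S \subset A, indep e S, #|S| = k & [set r; z] \subset S].
  move=> zA zr erz; have := bouquet_contain st; have := bouquet_k st.
  case: k st al => // k st al _ /= c0.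
  have zB : z \in A :\: cn e A r by rewrite in_setD in_cn (negbTE zr) erz andbF.
  have [S0 [sS0 iS0 cS0]] := cnt_witness (e := e) (A := A :\: cn e A r) (k := k)
    ltac:(by rewrite c0 expn_gt0).
  have [||||S [sS iS cS zS]] := @cluster_extend (A :\: cn e A r) S0 [set z] k _ _ sS0 iS0 cS0.
  - by apply: clusterS clA; apply: setDS; rewrite sub1set in_cn eqxx.
  - exact: (alpha_del es ei rA al).
  - by rewrite sub1set.
  - by apply/indepP => p q; rewrite !inE => /eqP-> /eqP->; apply: ei.
  exists (r |: S); split.
  - by rewrite subUset sub1set rA (subset_trans sS) // subsetDl.
  - exact: (indep_add es ei sS).
  - by rewrite cardsU1 (notin_del_cn sS) cS.
  - by apply: setUS.
move=> xA yA xy exy; case: (eqVneq x r) => [xr|xr].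
  by subst x; apply: atr; rewrite // eq_sym.
case: (eqVneq y r) => [yr|yr].
  by subst y; rewrite setUC; apply: atr; rewrite // es.
have [S0 [sS0 iS0 cS0]] := cnt_witness (e := e) (A := A :\ r) (k := k)
    ltac:(by rewrite (bouquet_avoid st) !muln_gt0 !expn_gt0).
have [|||S [sS iS cS PS]] := @cluster_extend (A :\ r) S0 [set x; y] k clA _ sS0 iS0 cS0.
- by apply: alpha_leS al; apply: subsetDl.
- by rewrite subUset !sub1set !inE xr yr xA yA.
- apply/indepP => p q; rewrite !inE => /orP[] /eqP-> /orP[] /eqP->; rewrite ?ei //.
  by rewrite es.
by exists S; split=> //; apply: subset_trans sS (subsetDl _ _).
Qed.

End Cluster.

(** * Arithmetic of the equality case *)

(** A lower bound for the number of sets that avoid a vertex p, in a tight graph of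
    order m to which a clique has been attached at p: the Moon-Moser number of
    m - 1, or 8/9 of it. Only the centre of a bouquet satisfies it when m is
    not 3, 5 or 6. *)
Definition central m J := if m %% 3 == 1 then 8 * g m.-1 <= 9 * J else g m.-1 <= J.

Lemma central_0 s J : central (3 * s) J = (g (3 * s).-1 <= J).
Proof. by rewrite /central mulnC modnMl. Qed.

Lemma central_1 s J : central (3 * s + 1) J = (8 * 3 ^ s <= 9 * J).
Proof. by rewrite /central [in _ %% 3]mulnC modnMDl addn1 /= g0. Qed.

Lemma central_2 s J : central (3 * s + 2) J = (g (3 * s + 1) <= J).
Proof. by rewrite /central mulnC modnMDl addn2 addn1 /=. Qed.

Ltac tcase := rewrite /bound0 /bound1 /bound2 /= ?eqSS;
  repeat (case: ifP => //= ?); powers; intros; try split; lia.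

Section EqArith.
Variables (n c : nat).
Hypotheses (n6 : 6 <= n) (tn : tight n c).

(** Equality in the estimate for a pendant edge, or for a merge. *)
Lemma bound_pair_eq c' I1 I2 : c' <= c -> 36 * I1 <= bound (n - 2) c' -> I2 <= g (n - 3) ->
  36 * (I1 + I2) = bound n c ->
  [/\ n %% 3 != 0, 36 * I1 = bound (n - 2) c', tight (n - 2) c' & central (n - 2) I2].
Proof.
move=> le; case: (split3 (ltnW n6)) => s nE; move: tn n6 le; rewrite nE {nE}.
- rewrite (_ : _ - 2 = 3 * s.+1 + 1); last lia.
  rewrite (_ : _ - 3 = 3 * s.+1); last lia.
  rewrite tight_0 bound_1 bound_0 tight_1 g0 central_1 => t _ le b1 b2 b3; exfalso.
  by move: t le b1 b2 b3; case: s => [|s]; tcase.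
- rewrite (_ : _ - 2 = 3 * s.+1 + 2); last lia.
  rewrite (_ : _ - 3 = 3 * s + 4); last lia.
  rewrite tight_1 bound_1 bound_2 tight_2 g1 central_2 [_ %% 3](_ : _ = 1); last lia.
  rewrite (_ : 3 * s.+1 + 1 = 3 * s + 4); last lia.
  by rewrite g1; tcase.
- rewrite (_ : _ - 2 = 3 * s.+1); last lia.
  rewrite (_ : _ - 3 = 3 * s + 2); last lia.
  rewrite tight_2 bound_2 bound_0 tight_0 g2 central_0 [_ %% 3](_ : _ = 2); last lia.
  rewrite (_ : (3 * s.+1).-1 = 3 * s + 2); last lia.
  by rewrite g2; tcase.
Qed.

(** Equality in the estimate for a pendant triangle. *)
Lemma bound_triangle_eq c' I1 J : c' + 1 <= c -> 36 * I1 <= bound (n - 3) c' ->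
  J <= g (n - 4) -> (low n c -> 9 * J <= 8 * g (n - 4)) -> 36 * (2 * I1 + J) = bound n c ->
  [/\ n != 7, 36 * I1 = bound (n - 3) c', tight (n - 3) c' & central (n - 3) J].
Proof.
move=> le; case: (split3 (ltnW n6)) => s nE.
- rewrite (low_0 c nE); move: tn n6 le; rewrite nE {nE}.
  rewrite (_ : _ - 3 = 3 * s.+1); last lia.
  rewrite (_ : _ - 4 = 3 * s + 2); last lia.
  rewrite [_ != _](_ : _ = true); last lia.
  rewrite !tight_0 !bound_0 g2 central_0 => t _ le b1 b2 _ b3.
  rewrite (_ : (3 * s.+1).-1 = 3 * s + 2); last lia.
  by rewrite g2; move: t le b1 b2 b3; tcase.
- rewrite (low_1 c nE); move: tn n6 le; rewrite nE {nE}.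
  rewrite (_ : _ - 3 = 3 * s.+1 + 1); last lia.
  rewrite (_ : _ - 4 = 3 * s.+1); last lia.
  rewrite !tight_1 !bound_1 g0 central_1 => t _ le b1 b2 b3 b4.
  have {}b3 := b3 t.
  move: t le b1 b2 b3 b4; case: s => [|s].
  by move=> t le b1 b2 b3 b4; exfalso; move: t le b1 b2 b3 b4; tcase.
  by rewrite [_ != _](_ : _ = true); [tcase | lia].
rewrite (low_2 c nE); move: tn n6 le; rewrite nE {nE}.
rewrite (_ : _ - 3 = 3 * s + 2); last lia.
rewrite (_ : _ - 4 = 3 * s + 1); last lia.
case: s => [|s]; first by move=> *; exfalso; lia.
rewrite [_ != _](_ : _ = true); last lia.
rewrite !tight_2 !bound_2 central_2 => t _ le.
rewrite (_ : 3 * s.+1 + 1 = 3 * s + 4); last lia.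
by rewrite g1 => b1 b2 _ b3; move: t le b1 b2 b3; tcase.
Qed.

(** Below the range of tightness the bound is smaller. *)
Lemma bound_tight c' : c' <= c -> bound n c <= bound n c' -> tight n c'.
Proof.
case: (split3 (ltnW n6)) => s nE; move: tn n6; rewrite nE.
- by rewrite !tight_0 !bound_0; tcase.
- by rewrite !tight_1; lia.
by rewrite !tight_2 !bound_2; tcase.
Qed.

End EqArith.

Lemma g_lt m : 1 < m -> g m.-1 < g m.
Proof.
move=> m1; have [s [->|[->|->]]] : exists s, m = 3 * s + 2 \/ m = 3 * s.+1 \/ m = 3 * s + 4.
  have := divn_eq m 3; have := ltn_pmod m (isT : 0 < 3).
  case: (m %% 3) => [|[|[|]]] // _ E.
  - by exists (m %/ 3).-1; lia.
  - by exists (m %/ 3).-1; lia.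
  by exists (m %/ 3); lia.
- rewrite g2 (_ : _.-1 = 3 * s + 1); last lia.
  by have := g1_le s; powers; lia.
- by rewrite g0 (_ : _.-1 = 3 * s + 2) ?g2; [powers; lia | lia].
by rewrite g1 (_ : _.-1 = 3 * s.+1) ?g0; [powers; lia | lia].
Qed.

Lemma central_lt m J : 3 <= m -> m != 4 -> J <= g (m - 2) -> ~~ central m J.
Proof.
move=> m3 m4 le; rewrite /central; case: ifP => m1; rewrite -ltnNge.
  have [s mE] : exists s, m = 3 * s.+2 + 1 by exists (m %/ 3 - 2); lia.
  subst m.
  move: le; rewrite (_ : 3 * s.+2 + 1 - 2 = 3 * s.+1 + 2); last lia.
  rewrite (_ : (3 * s.+2 + 1).-1 = 3 * s.+2); last lia.
  by rewrite g0 g2; powers; lia.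
apply: leq_ltn_trans le _; rewrite (_ : m - 2 = m.-1.-1); last lia.
by apply: g_lt; lia.
Qed.

(** The number J stands for the sets that avoid a vertex other than the centre:
    g (m - 2) bounds those that also avoid the centre, and 2 ^ t counts those
    that contain it. *)
Lemma central_other t b m J : m = 3 + 3 * t + 2 * b -> b <= 2 -> J <= g (m - 2) + 2 ^ t ->
  central m J -> m \in [:: 3; 5; 6].
Proof.
have gE q : 3 * q.+1 + 1 = 3 * q + 4 by lia.
move=> mE; case: b mE => [|[|[|//]]] mE _.
- have -> : m = 3 * t.+1 by lia.
  have E1 : (3 * t.+1).-1 = 3 * t + 2 by lia.
  have E2 : 3 * t.+1 - 2 = 3 * t + 1 by lia.
  rewrite central_0 E1 E2 g2 {E1 E2}.
  case: t {mE} => [|[|t]] //; rewrite gE g1 => l1 l2; exfalso.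
  by move: l1 l2; powers; lia.
- have -> : m = 3 * t.+1 + 2 by lia.
  have E1 : 3 * t.+1 + 2 - 2 = 3 * t.+1 by lia.
  rewrite central_2 gE g1 E1 g0 {E1}.
  case: t {mE} => [|t] // l1 l2; exfalso.
  by move: l1 l2; powers; lia.
have -> : m = 3 * t.+2 + 1 by lia.
have E1 : 3 * t.+2 + 1 - 2 = 3 * t.+1 + 2 by lia.
rewrite central_1 E1 g2 => l1 l2.
by exfalso; move: l1 l2; powers; lia.
Qed.

(** * Bouquets on three and six vertices *)

Section SmallBouquets.
Variables (V : finType) (e : rel V).
Hypotheses (es : symmetric e) (ei : irreflexive e).
Implicit Types (A B C D P Q R S T W : {set V}) (p r u v w x y z : V) (k t b : nat).

Lemma bouquet_clique3 A p : #|A| = 3 -> (forall x y, x \in A -> y \in A -> x != y -> e x y) ->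
  p \in A -> bouquet e p 0 0 A 1.
Proof.
move=> A3 cl pA; have /cards2P[y [z [yz E]]] : #|A :\ p| == 2.
  by move: A3; rewrite (cardsD1 p) pA add1n => -[->].
have : y \in A :\ p by rewrite E !inE eqxx.
have : z \in A :\ p by rewrite E !inE eqxx orbT.
rewrite !in_setD1 => /andP[zp zA] /andP[yp yA].
have -> : A = [set p; y; z] by rewrite -(setD1K pA) E setUA.
apply: bouquet_base; [|by apply: cl; rewrite // eq_sym|by apply: cl; rewrite // eq_sym|exact: cl].
by rewrite /= !inE negb_or !(eq_sym p) yp zp yz.
Qed.

Lemma triangles_clique A : triangles e A -> #|A| = 3 ->
  forall x y, x \in A -> y \in A -> x != y -> e x y.
Proof.
move=> tA A3 x y xA yA xy; have [a [b [ab _ nx]]] := tA x xA.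
have : y \in nb e A x; last by rewrite in_nb => /andP[].
have -> : nb e A x = A :\ x; last by rewrite in_setD1 eq_sym xy.
apply/eqP; rewrite eqEcard; apply/andP; split.
  apply/subsetP => z zx; have [zA _ _ zx'] := nb_memP es ei zx.
  by rewrite in_setD1 zx' zA.
by rewrite nx cards2 ab; move: A3; rewrite (cardsD1 x) xA add1n => -[->].
Qed.

Lemma bouquet_three A k p : alpha_le e A k -> #|A| = 3 ->
  36 * cnt e A k = bound #|A| (ncyc e A) -> tight #|A| (ncyc e A) -> p \in A -> bouquet e p 0 0 A k.
Proof.
move=> al A3; have A3' : #|A| = 3 * 1 by rewrite A3.
rewrite A3' bound_0 tight_0 /bound0 => cE c1 pA; rewrite ltnNge c1 /= !expn1 in cE.
case: (triangles_or_few es ei al A3') => [tA|]; last by rewrite g0 expn1; narith.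
have cl := triangles_clique tA A3.
suff -> : k = 1 by apply: bouquet_clique3.
have [S [sS iS cS]] := cnt_witness (e := e) (A := A) (k := k) ltac:(narith).
apply/eqP; rewrite eqn_leq; apply/andP; split.
  rewrite -cS leqNgt; apply/negP => /card_gt1P[x [y [xS yS xy]]].
  by have := cl x y (subsetP sS _ xS) (subsetP sS _ yS) xy; move/indepP: iS => ->.
rewrite lt0n; apply: contraTneq pA => k0; rewrite k0 in al.
by rewrite (alpha_le0 ei al) inE.
Qed.

Lemma bouquet0 r A k : bouquet e r 0 0 A k -> exists x y,
  [/\ uniq [:: r; x; y], e r x, e r y, e x y & A = [set r; x; y] /\ k = 1].
Proof.
move E0 : {1}0 => t0; move E1 : 0 => b0 st; case: st E0 E1 => [x y|t b A' k' u Q pQ Q2 _ _].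
  by move=> us rx ry xy _ _; exists x, y.
by have [_ _ _ /andP[Q0 Q3] _] := pQ; case: #|Q| Q0 Q2 => [|[|[|]]] //=; rewrite addn1.
Qed.

Lemma bouquet_last r A k : bouquet e r 1 0 A k -> exists u Q x y,
  [/\ pendant e A u Q, #|Q| = 2, nb e A u = r |: Q & uniq [:: r; x; y]] /\
  [/\ e r x, e r y, e x y, A :\: (u |: Q) = [set r; x; y] & k = 2].
Proof.
move E1 : {1}1 => t0; move E0 : {1}0 => b0 st; case: st E1 E0 => //.
move=> t b A' k' u Q pQ Q2 nu st E1 E0.
have [_ _ _ /andP[Q0 Q3] _] := pQ.
have QE : #|Q| = 2 by move: E0; case: #|Q| Q0 Q2 => [|[|[|]]] //; rewrite /= addn1.
rewrite QE /= addn1 in E1; rewrite QE /= addn0 in E0; case: E1 => E1.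
move: st; rewrite -E1 -E0 => /bouquet0[x [y [us rx ry xy [AE kE]]]].
by exists u, Q, x, y; rewrite kE.
Qed.

Lemma nb_rest A u Q r x w : pendant e A u Q -> nb e A u = r |: Q ->
  x \in A :\: (u |: Q) -> x != r -> w \in A -> e x w -> w \in A :\: (u |: Q).
Proof.
move=> [uA uQ sQ _ cnQ] nu; rewrite !in_setD => /andP[xQ xA] xr wA exw; rewrite wA andbT.
apply: contra xQ; rewrite !in_setU1 => /orP[/eqP wu|wQ].
  have /setP/(_ x) := nu; rewrite in_nb xA -wu es exw in_setU1 (negbTE xr) /= => /esym->.
  by rewrite orbT.
by have := cnQ w wQ => /setP/(_ x); rewrite in_cn xA es exw orbT in_setU1 => /esym.
Qed.

(** Two triangles joined by an edge: both ends of the edge are centres, and the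
    other vertices have degree 2. *)
Lemma bouquet_six A k r p : bouquet e r 1 0 A k -> p \in A -> 2 < #|nb e A p| -> bouquet e p 1 0 A k.
Proof.
move=> st pA; case: (eqVneq p r) => [-> //|pr] d3.
have [u [Q [x [y [[pQ Q2 nu us] [erx ery exy RE kE]]]]]] := bouquet_last st.
have [uA uQ sQ _ cnQ] := pQ.
have rR : r \in A :\: (u |: Q) by rewrite RE !inE eqxx.
have rA : r \in A by move: rR; rewrite in_setD => /andP[].
have sR : [set r; x; y] \subset A by rewrite -RE subsetDl.
have sR' z : z \in [set r; x; y] -> z \in A := subsetP sR z.
move: (us); rewrite /= !inE negb_or => /and3P[/andP[rx ry] xy _].
have cnxy z : z \in [set x; y] -> cn e A z = [set r; x; y].
  move=> zxy; have zR : z \in [set r; x; y] by move: zxy; rewrite !inE => /orP[->|->]; rewrite ?orbT.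
  have zr : z != r by move: zxy; rewrite !inE => /orP[] /eqP->; rewrite eq_sym.
  apply/setP => w; rewrite in_cn; apply/idP/idP.
    case/orP=> [/eqP->|/andP[wA ezw]] //; rewrite -RE.
    by apply: (nb_rest pQ nu _ zr wA ezw); rewrite RE.
  case: (eqVneq w z) => //= wz wR; rewrite sR' //=.
  move: zxy wR wz; rewrite !inE -orbA => /orP[] /eqP-> /or3P[] /eqP->; rewrite ?eqxx //.
  - by rewrite es.
  - by rewrite es.
  by rewrite es.
have d2 z B : cn e A z = B -> #|B| = 3 -> z = p -> False.
  by move=> E B3 zp; move: d3; rewrite -ltnS -zp -(card_cn ei) E B3.
have pxy : p \notin [set x; y].
  by apply/negP => pxy; apply: (d2 p _ (cnxy p pxy)) => //; apply: cards3.
have pQ' : p \notin Q.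
  by apply/negP => pQ'; apply: (d2 p _ (cnQ p pQ')) => //; rewrite cardsU1 uQ Q2.
have pu : p = u.
  apply/eqP/negPn/negP => pu; have : p \in A :\: (u |: Q).
    by rewrite in_setD in_setU1 negb_or pu pQ' pA.
  by rewrite RE -setUA in_setU1 (negbTE pr) (negbTE pxy).
have A' : A :\: (r |: [set x; y]) = u |: Q.
  by rewrite setUA -RE setDDr setDv set0U; apply/setIidPr; apply: (pendant_sub pQ).
have rxy : r \notin [set x; y] by rewrite !inE negb_or rx ry.
have c2 : #|[set x; y]| = 2 by rewrite cards2 xy.
have -> : 1 = 0 + (#|[set x; y]| == 2) by rewrite c2.
have -> : bouquet e p (0 + (#|[set x; y]| == 2)) 0 A k =
  bouquet e p (0 + (#|[set x; y]| == 2)) (0 + (#|[set x; y]| == 1)) A k by rewrite c2.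
rewrite pu kE; apply: (@bouquet_add _ _ _ _ _ _ _ r); rewrite ?c2 //.
- split; rewrite ?c2 //.
    by apply: subset_trans sR; rewrite -setUA subsetUr.
  by move=> q /cnxy->; rewrite setUA.
- apply/setP => w; rewrite in_nb in_setU1; apply/andP/idP.
    case=> wA erw; case: (boolP (w \in u |: Q)) => [|wQ].
      rewrite in_setU1 => /orP[->//|wQ]; have : r \in u |: Q; last first.
        by move: rR; rewrite in_setD => /andP[/negbTE->].
      by rewrite -(cnQ w wQ) in_cn rA es erw orbT.
    have : w \in A :\: (u |: Q) by rewrite in_setD wQ.
    rewrite RE -setUA in_setU1 => /orP[/eqP wr|->]; last by rewrite orbT.
    by rewrite wr ei in erw.
  case/orP=> [/eqP->|]; first by split=> //; have /setP/(_ r) := nu; rewrite in_nb setU11 es => /andP[].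
  by rewrite !inE => /orP[] /eqP->; split=> //; apply: sR'; rewrite !inE eqxx ?orbT.
rewrite A'; apply: bouquet_clique3; rewrite ?setU11 ?cardsU1 ?uQ ?Q2 //.
by move=> a b aQ bQ ab; apply: (pendant_adj es pQ).
Qed.

End SmallBouquets.

(** * Tight graphs on five vertices *)

Section FiveVertices.
Variables (V : finType) (e : rel V).
Hypotheses (es : symmetric e) (ei : irreflexive e).
Implicit Types (A B C D P Q R S T W : {set V}) (a b c d p r u v w x y z : V) (k t : nat).

Lemma cnt1 A : cnt e A 1 = #|A|.
Proof.
rewrite -(card_imset _ (@set1_inj V)); apply: eq_card => S; rewrite inE.
apply/and3P/imsetP => [[sS _ /cards1P[x Sx]]|[x xA ->]].
  by exists x => //; apply: (subsetP sS); rewrite Sx inE.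
rewrite sub1set xA cards1; split=> //.
by apply/indepP => y z; rewrite !inE => /eqP-> /eqP->; apply: ei.
Qed.

Lemma conn_clique A : (forall x y, x \in A -> y \in A -> x != y -> e x y) -> conn e A.
Proof.
move=> cl B sB /set0Pn[x xB] H; apply/eqP; rewrite eqEsubset sB /=.
apply/subsetP => y yA; case: (eqVneq x y) => [<- //|xy].
by apply: (H x) => //; apply: cl => //; apply: (subsetP sB).
Qed.

Lemma bouquet_one_edge A p x y u q : p \in A -> uniq [:: x; y; u; q] ->
  A :\ p = [set x; y; u; q] -> e x y -> e u q ->
  (forall a b : V, a \in [set x; y] -> b \in [set u; q] -> e a b = false) ->
  A :\: cn e A p = [set q] -> bouquet e p 0 1 A 2.
Proof.
move=> pA us Ap exy euq no nq.
move: (us); rewrite /= !inE !negb_or -!andbA => /and5P[xy xu xq yu /and3P[yq uq _]].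
have inA z : z \in A -> [|| z == p, z == x, z == y, z == u | z == q].
  move=> zA; case: (eqVneq z p) => //= zp; have : z \in A :\ p by rewrite in_setD1 zp.
  by rewrite Ap !inE -!orbA.
have Ain z : z \in [:: x; y; u; q] -> z != p /\ z \in A.
  move=> zI; have : z \in A :\ p by rewrite Ap !inE -!orbA; move: zI; rewrite !inE.
  by rewrite in_setD1 => /andP[].
have [xp xA] := Ain x ltac:(by rewrite !inE eqxx).
have [yp yA] := Ain y ltac:(by rewrite !inE eqxx !orbT).
have [up uA] := Ain u ltac:(by rewrite !inE eqxx !orbT).
have [qp qA] := Ain q ltac:(by rewrite !inE eqxx !orbT).
have adj z : z \in A -> z != p -> e p z = (z != q).
  move=> zA zp; have /setP/(_ z) := nq; rewrite in_setD in_cn zA (negbTE zp) /= andbT inE.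
  by move=> <-; rewrite negbK.
have epx : e p x by rewrite adj.
have epy : e p y by rewrite adj.
have epu : e p u by rewrite adj.
have epq : e p q = false by rewrite adj // eqxx.
have [nxu nxq] : e x u = false /\ e x q = false by split; apply: no; rewrite !inE eqxx ?orbT.
have [nyu nyq] : e y u = false /\ e y q = false by split; apply: no; rewrite !inE eqxx ?orbT.
have c1 : #|[set q]| = 1 by rewrite cards1.
have -> : bouquet e p 0 1 A 2 = bouquet e p (0 + (#|[set q]| == 2)) (0 + (#|[set q]| == 1)) A 2.
  by rewrite c1.
apply: (@bouquet_add _ _ _ _ _ _ _ u); rewrite ?c1 //.
- split; rewrite ?c1 ?sub1set ?inE //.
  move=> z; rewrite inE => /eqP->; apply/setP => w; rewrite in_cn !inE.
  case: (eqVneq w q) => [->|wq] /=; first by rewrite orbT.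
  rewrite orbF; apply/andP/eqP => [[/inA]|->]; last by rewrite es.
  by case/or4P=> [/eqP->|/eqP->|/eqP->|/orP[/eqP->|/eqP wq']] //; rewrite 1?es ?epq ?nxq ?nyq //;
    rewrite wq' eqxx in wq.
- apply/setP => w; rewrite in_nb !inE; apply/andP/orP.
    case=> /inA; case/or4P=> [/eqP->|/eqP->|/eqP->|/orP[/eqP->|/eqP->]]; rewrite ?eqxx; auto.
    + by rewrite es nxu.
    + by rewrite es nyu.
    by rewrite ei.
  by case=> /eqP-> //; rewrite es.
have -> : A :\: [set u; q] = [set p; x; y].
  apply/setP => w; rewrite !inE -!orbA; apply/andP/or3P.
    case=> uqw /inA; move: uqw; rewrite negb_or => /andP[/negbTE-> /negbTE->].
    by rewrite !orbF => /or3P.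
  by case=> /eqP->; rewrite negb_or ?pA ?xA ?yA ?(eq_sym p) ?up ?qp ?xu ?xq ?yu ?yq.
by apply: bouquet_base; rewrite //= !inE negb_or !(eq_sym p) xp yp xy.
Qed.

Lemma indep_two_edges x y z w S : indep e S -> S \subset [set x; y; z; w] -> e x y -> e z w ->
  #|S| <= 2.
Proof.
move=> iS sS exy ezw; have sub : S \subset (S :&: [set x; y]) :|: (S :&: [set z; w]).
  by rewrite -setIUr subsetI subxx setUA.
apply: leq_trans (subset_leq_card sub) _; rewrite cardsU.
have le1 a b : e a b -> #|S :&: [set a; b]| <= 1.
  move=> eab; rewrite leqNgt; apply/negP => /card_gt1P[c [d []]].
  rewrite !inE => /andP[cS cab] /andP[dS dab] cd.
  have ecd : e c d by case/orP: cab cd => /eqP->; case/orP: dab => /eqP->; rewrite ?eqxx // es.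
  by move/indepP: iS => /(_ c d cS dS); rewrite ecd.
by have := le1 x y exy; have := le1 z w ezw; narith.
Qed.

(** Without p there are four vertices that attain the Moon-Moser number. If they
    form a K4 there are too many cycles; if they form two edges, then p misses
    exactly one vertex. *)
Lemma bouquet_five A k p : conn e A -> alpha_le e A k -> #|A| = 5 ->
  36 * cnt e A k = bound #|A| (ncyc e A) -> tight #|A| (ncyc e A) ->
  p \in A -> 4 <= cnt e (A :\ p) k -> bouquet e p 0 1 A k.
Proof.
move=> cA al A5; have A5' : #|A| = 3 * 1 + 2 by rewrite A5.
rewrite A5' bound_2 tight_2 /bound2 /= => cE /andP[c1 c7] pA c4.
rewrite ltnNge c1 c7 /= !expn1 in cE; have {cE} cE : cnt e A k = 5 by narith.
have A4 : #|A :\ p| = 4 by move: A5; rewrite (cardsD1 p) pA add1n => -[].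
have alp : alpha_le e (A :\ p) k by apply: alpha_leS al; apply: subsetDl.
case: (four_vertices es ei alp A4 c4) => [cl|[x [y [z [w [us AE exy ezw no]]]]]].
  exfalso; have k1 : k <= 1.
    have [S [sS iS <-]] := cnt_witness (e := e) (A := A :\ p) (k := k) ltac:(narith).
    rewrite leqNgt; apply/negP => /card_gt1P[x [y [xS yS xy]]].
    by have := cl x y (subsetP sS _ xS) (subsetP sS _ yS) xy; move/indepP: iS => ->.
  have clA x y : x \in A -> y \in A -> x != y -> e x y.
    move=> xA yA xy; apply/negPn/negP => nxy.
    have : #|[set x; y]| <= k; last by rewrite cards2 xy; narith.
    apply: al; first by rewrite subUset !sub1set xA.
    by apply/indepP => a b; rewrite !inE => /orP[] /eqP-> /orP[] /eqP->;
      rewrite ?ei // ?(es y); apply/negbTE.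
  have nbp : nb e A p = A :\ p.
    apply/setP => x; rewrite in_nb in_setD1; case: (boolP (x \in A)) => xA; rewrite /= ?andbF // andbT.
    by case: (eqVneq x p) => [->|xp]; [rewrite ei | rewrite clA // eq_sym].
  have := ncyc_noncut es ei (conn_clique cl) pA; rewrite nbp A4.
  have [a [b [c [d [us sA]]]]] := four_elements A4.
  move: us (sA); rewrite /= !inE !negb_or -!andbA !subUset !sub1set -!andbA.
  case/and5P=> ab ac ad bc /and3P[bd cd _] /and4P[aA bA cA' dA].
  have := @ncyc_K4 _ e es ei (A :\ p) set0 a b c d (sub0set _).
  rewrite !inE => /(_ isT isT isT sA).
  move/(_ ltac:(exact: cl) ltac:(exact: cl) ltac:(exact: cl) ltac:(exact: cl) ltac:(exact: cl)
    ltac:(exact: cl)).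
  by have : 'C(4, 2) = 6 by []; narith.
have in4 a : a \in [:: x; y; z; w] -> a \in A.
  move=> aI; have : a \in A :\ p by rewrite AE !inE -!orbA; move: aI; rewrite !inE.
  by rewrite in_setD1 => /andP[].
have kE : k = 2.
  apply/eqP; rewrite eqn_leq; apply/andP; split.
    have [S [sS iS <-]] := cnt_witness (e := e) (A := A :\ p) (k := k) ltac:(narith).
    by rewrite AE in sS; apply: (indep_two_edges iS sS exy ezw).
  have xz : x != z by move: us; rewrite /= !inE !negb_or -!andbA => /and5P[].
  have <- : #|[set x; z]| = 2 by rewrite cards2 xz.
  apply: al; first by rewrite subUset !sub1set !in4 // !inE eqxx ?orbT.
  have exz : e x z = false by apply: no; rewrite !inE eqxx.
  by apply/indepP => a b; rewrite !inE => /orP[] /eqP-> /orP[] /eqP->; rewrite ?ei // es.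
subst k; have le4 := cnt_le_g es ei alp; rewrite A4 g_vals in le4.
have := cnt_del es ei 1 pA; rewrite cE cnt1 => E5.
have /cards1P[q qE] : #|A :\: cn e A p| == 1 by apply/eqP; narith.
have : q \in A :\: cn e A p by rewrite qE inE.
rewrite in_setD in_cn negb_or => /andP[/andP[qp _] qA].
have : q \in A :\ p by rewrite in_setD1 qp.
have us' s : perm_eq s [:: x; y; z; w] -> uniq s by move/perm_uniq->.
have no' (a b : V) : a \in [set z; w] -> b \in [set x; y] -> e a b = false.
  by move=> aI bI; rewrite es no.
rewrite AE !inE -!orbA => /or4P[] /eqP qq; rewrite {q}qq in qE qp qA.
- apply: (@bouquet_one_edge A p z w y x) => //.
  + by apply: us'; apply/permP => P /=; narith.
  + by rewrite AE; apply/setP => a; rewrite !inE; case: (a == x); case: (a == y); case: (a == z); case: (a == w).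
  + by rewrite es.
  by move=> a b aI; rewrite setUC; apply: no'.
- apply: (@bouquet_one_edge A p z w x y) => //.
  + by apply: us'; apply/permP => P /=; narith.
  by rewrite AE; apply/setP => a; rewrite !inE; case: (a == x); case: (a == y); case: (a == z); case: (a == w).
- apply: (@bouquet_one_edge A p x y w z) => //.
  + by apply: us'; apply/permP => P /=; narith.
  + by rewrite AE; apply/setP => a; rewrite !inE; case: (a == x); case: (a == y); case: (a == z); case: (a == w).
  + by rewrite es.
  by move=> a b aI; rewrite setUC; apply: no.
by apply: (@bouquet_one_edge A p x y z w).
Qed.

End FiveVertices.

(** * Tight graphs are bouquets *)

Section Equality.
Variables (V : finType).
Implicit Types (e : rel V) (A B C D P Q R S T W : {set V}) (p r u v w x y z : V) (k t : nat).

Definition extremal e A k :=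
  [/\ conn e A, alpha_le e A k, tight #|A| (ncyc e A) & 36 * cnt e A k = bound #|A| (ncyc e A)].

(** By induction the graph is a bouquet, with some centre r. A vertex other than
    the centre of a bouquet is on too many sets for [central], except in the
    small cases, where p can be the centre as well. *)
Lemma bouquet_centre e A k p : symmetric e -> irreflexive e -> extremal e A k ->
  p \in A -> central #|A| (cnt e (A :\ p) k) -> 2 < #|A| -> #|A| != 4 ->
  (5 < #|A| -> exists r t b, b <= 2 /\ bouquet e r t b A k) ->
  exists t b, b <= 2 /\ bouquet e p t b A k.
Proof.
move=> es ei [cA al tA cE] pA ce A3 A4 H.
have [A3'|[A5|A6]] : #|A| = 3 \/ #|A| = 5 \/ 5 < #|A| by move: A3 A4; clear; lia.
- by exists 0, 0; split=> //; apply: bouquet_three.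
- exists 0, 1; split=> //; apply: bouquet_five => //.
  by move: ce; rewrite A5 (_ : 5 = 3 * 1 + 2) // central_2.
have [r [t [b [b2 st]]]] := H A6; case: (eqVneq p r) => [->|pr]; first by exists t, b.
have k0 := bouquet_k st; have rA := bouquet_mem st.
have rAp : r \in A :\ p by rewrite in_setD1 eq_sym pr.
have cE1 : cnt e (A :\ p) k = cnt e (A :\ p :\ r) k + cnt e ((A :\ p) :\: cn e (A :\ p) r) k.-1.
  by case: k k0 {st al cE ce H} => // k _; rewrite (cnt_del es ei _ rAp).
have le1 : cnt e (A :\ p :\ r) k <= g (#|A| - 2).
  apply: (cnt_le_gn es ei).
    by apply: alpha_leS al; apply: subset_trans (subsetDl _ _) (subsetDl _ _).
  by move: (cardsD1 p A) (cardsD1 r (A :\ p)); rewrite pA rAp; narith.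
have le2 := cntS e k.-1 (del_cn_sub e A p r); rewrite (bouquet_contain es ei st) in le2.
have AE := bouquet_card st.
have := central_other AE b2 (J := cnt e (A :\ p) k) ltac:(narith) ce.
rewrite !inE => /or3P[] /eqP A6'; [by rewrite A6' in A6|by rewrite A6' in A6|].
have [t1 b0] : t = 1 /\ b = 0 by move: AE b2; rewrite A6'; clear; lia.
subst t b; exists 1, 0; split=> //; apply: (bouquet_six es ei st pA).
have [_ [_ [_ [_ [_ [_ _ _ _ k2]]]]]] := bouquet_last st; subst k.
move: ce; rewrite A6' (_ : 6 = 3 * 2) // central_0 /= gS g_vals => ce.
have := bouquet_total es ei st; rewrite (cnt_del es ei 1 pA) cnt1 // (card_del_cn ei pA) A6'.
by rewrite !expn1 expn0; narith.
Qed.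

Section Step.
Variables (e : rel V) (A : {set V}) (k : nat).
Hypotheses (es : symmetric e) (ei : irreflexive e) (A6 : 5 < #|A|) (ex : extremal e A k.+1).
Hypothesis smaller : forall e' A' k', symmetric e' -> irreflexive e' -> 5 < #|A'| < #|A| ->
  extremal e' A' k' -> exists r t b, b <= 2 /\ bouquet e' r t b A' k'.

Let cA : conn e A. Proof. by case: ex. Qed.
Let al : alpha_le e A k.+1. Proof. by case: ex. Qed.
Let tA : tight #|A| (ncyc e A). Proof. by case: ex. Qed.
Let cE : 36 * cnt e A k.+1 = bound #|A| (ncyc e A). Proof. by case: ex. Qed.
Let A5 : 5 <= #|A|. Proof. exact: ltnW. Qed.

Lemma smaller_bound (e' : rel V) (A' : {set V}) k' : symmetric e' -> irreflexive e' ->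
  0 < #|A'| < #|A| -> conn e' A' -> alpha_le e' A' k' ->
  36 * cnt e' A' k' <= bound #|A'| (ncyc e' A').
Proof. by move=> es' ei' /andP[A0 _] cA' al'; apply: cnt_bound. Qed.

Lemma strict_step : ~ (36 * cnt e A k.+1 + tight #|A| (ncyc e A) <= bound #|A| (ncyc e A)).
Proof. by rewrite cE tA addn1 ltnn. Qed.

(** In a disjoint union of cliques, no vertex is adjacent to two nonadjacent
    vertices x and w. If x and w are both neighbours of a, say, then any
    neighbour of b is nonadjacent to one of them. *)
Lemma fold_nbs v a b : v \in A -> a != b -> e a b = false -> nb e A v = [set a; b] ->
  1 < #|nb e A a| -> 1 < #|nb e A b| -> cluster e (A :\: cn e A v) ->
  (exists x w, [/\ x \in A :\: cn e A v, w \in A :\: cn e A v, fold e a b a x, fold e a b a w &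
     x != w /\ e x w = false]) ->
  exists z1 z2, [/\ z1 \in A :\: cn e A v, z2 \in A :\: cn e A v, e a z1, e b z2 & e z1 z2 = false].
Proof.
move=> vA ab eab nv na nb' cl [x [w [xD wD fx fw [xw exw]]]].
have eba : e b a = false by rewrite es.
rewrite !fold_at // in fx fw.
have nbr (c d : V) : [set c; d] = [set a; b] -> 1 < #|nb e A c| -> exists2 z, z \in A :\: cn e A v & e c z.
  move=> cd nc; have [z zc zv] : exists2 z, z \in nb e A c & z != v.
    case/card_gt1P: nc => z [z' [zc zc' zz]]; case: (eqVneq z v) => [E|zv]; last by exists z.
    by exists z' => //; rewrite -E eq_sym.
  have [zA ecz _ _] := nb_memP es ei zc; exists z => //.
  rewrite in_setD zA andbT /cn in_setU1 (negbTE zv) nv -cd /= !inE.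
  have ecc : forall c' d', c' \in [set a; b] -> d' \in [set a; b] -> e c' d' = false.
    by move=> c' d'; rewrite !inE => /orP[] /eqP-> /orP[] /eqP->.
  by apply: contraTN ecz => /orP[] /eqP->; rewrite ecc // -cd !inE eqxx ?orbT.
have [za zaD eaza] := nbr a b erefl na.
have [zb zbD ebzb] := nbr b a ltac:(exact: setUC) nb'.
have pick z : z \in A :\: cn e A v -> exists2 z', z' \in [set x; w] & e z' z = false.
  move=> zD; case exz: (e x z); last by exists x; rewrite // !inE eqxx.
  case ewz: (e w z); last by exists w; rewrite // !inE eqxx orbT.
  by have := cl x z w xD zD wD exz; rewrite (es z) ewz xw exw => /(_ isT isT).
have inD z' : z' \in [set x; w] -> z' \in A :\: cn e A v by rewrite in_set2 => /orP[] /eqP->.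
case/orP: fx => [eax|ebx]; case/orP: fw => [eaw|ebw].
- have [z' z'I ez] := pick zb zbD; exists z', zb; split; [exact: inD|by []| |by []|by []].
  by move: z'I; rewrite !inE => /orP[] /eqP->.
- by exists x, w.
- by exists w, x; split=> //; rewrite es.
have [z' z'I ez] := pick za zaD; exists za, z'; split; [by []|exact: inD|by []| |by rewrite es].
by move: z'I; rewrite !inE => /orP[] /eqP->.
Qed.

(** Merging is never tight. The merged graph would be a bouquet with centre a;
    then there is a maximum independent set with neighbours of both a and b
    before merging, and [cnt_fold_del_strict] applies. *)
Lemma fold_strict v a b : v \in A -> a != b -> e a b = false -> nb e A v = [set a; b] ->
  1 < #|nb e A a| -> 1 < #|nb e A b| -> False.
Proof.
move=> vA ab eab nv na nb'; have eba : e b a = false by rewrite es.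
have := cnt_del es ei k vA.
have le1 := cnt_fold_del es ei vA ab eab nv al.
have [le2 _ _] := step_fold es ei cA A5 al smaller_bound vA ab eab nv.
set A' := A :\: [set v; b] in le1.
have cF : #|A'| = #|A| - 2 := card_fold ei vA nv.
have cA' := conn_fold es ei ab vA nv cA.
have al' := alpha_fold es ei vA eab nv al.
have fs := fold_sym es a b; have fi := fold_irr ei eba.
have le3 := smaller_bound fs fi (A' := A') (k' := k) ltac:(rewrite cF; narith) cA' al'.
have le4 := ncyc_fold es ei vA ab nv; rewrite -/A' cF in le3 le4.
have le5 := bound_pair (ncyc e A) A5.
have le6 := bound_mono (#|A| - 2) le4.
move=> cD; have cE' := cE.
have sumE : 36 * (cnt (fold e a b) A' k + cnt e (A :\: cn e A v) k) = bound #|A| (ncyc e A).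
  by narith.
have delE : cnt e (A :\ v) k.+1 = cnt (fold e a b) A' k by narith.
have [n0 cE1 t1 ce1] := bound_pair_eq A6 tA le4 le3 le2 sumE.
have A'a : A' :\ a = A :\: cn e A v := fold_del nv.
have aA' : a \in A'.
  have : a \in nb e A v by rewrite nv !inE eqxx.
  case/(nb_memP es ei) => aA _ _ av; rewrite in_setD !inE negb_or av ab aA //.
(* N[v] is v, a and b, and away from a merging changes nothing *)
have cD' : cnt (fold e a b) (A' :\ a) k = cnt e (A :\: cn e A v) k.
  rewrite A'a; apply: eq_cnt => x y; rewrite -A'a !in_setD1 => /andP[xa _] /andP[ya _].
  exact: fold_off.
have ex' : extremal (fold e a b) A' k by split; rewrite ?cF.
have [||||t [c [c2 st]]] := bouquet_centre fs fi ex' aA'.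
- by rewrite cF cD'.
- by rewrite cF; narith.
- by rewrite cF; apply: contraNneq n0 => E; have -> : #|A| = 6 by move: E; clear; lia.
- by move=> A'6; apply: smaller => //; rewrite A'6 cF; narith.
have cl : cluster e (A :\: cn e A v).
  move=> x y z xD yD zD; have nota q : q \in A :\: cn e A v -> q != a.
    by rewrite -A'a in_setD1 => /andP[].
  have := bouquet_cluster fs st; rewrite A'a => /(_ x y z xD yD zD).
  by rewrite !fold_off ?nota.
have [x [w [xA' wA' fx fw [xw fxw]]]] := bouquet_two_nbs fs fi st ltac:(rewrite cF; narith).
have inD q : q \in A' -> fold e a b a q -> q \in A :\: cn e A v.
  by move=> qA' fq; rewrite -A'a in_setD1 qA' andbT; apply: contraTneq fq => ->; rewrite fi.
have [z1 [z2 [z1D z2D ez1 ez2 ez]]] : exists z1 z2, [/\ z1 \in A :\: cn e A v,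
    z2 \in A :\: cn e A v, e a z1, e b z2 & e z1 z2 = false].
  apply: fold_nbs => //; exists x, w; split; rewrite ?inD //; split=> //.
  have nota q : q \in A :\: cn e A v -> q != a by rewrite -A'a in_setD1 => /andP[].
  by move: fxw; rewrite fold_off ?nota ?inD.
have [S0 [sS0 iS0 cS0]] := cnt_witness (e := e) (A := A :\: cn e A v) (k := k)
  ltac:(by rewrite -cD' (bouquet_avoid fs fi st) !muln_gt0 !expn_gt0).
have [||S [sS iS cS PS]] := cluster_extend es ei cl (alpha_del es ei vA al) sS0 iS0 cS0
  (P := [set z1; z2]).
- by rewrite subUset !sub1set z1D z2D.
- by apply/indepP => p q; rewrite !inE => /orP[] /eqP-> /orP[] /eqP->; rewrite ?ei // es.
move: PS; rewrite subUset !sub1set => /andP[z1S z2S].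
have := cnt_fold_del_strict es ei vA ab eab nv al sS iS cS z1S ez1 z2S ez2.
by rewrite -/A' delE ltnn.
Qed.

(** The neighbour p of u outside the clique is the centre of the rest. There is
    no second neighbour, since the sets that contain u would be too few. *)
Lemma pendant_bouquet u Q : pendant e A u Q -> conn e (A :\: (u |: Q)) -> #|Q| <= 2 ->
  extremal e (A :\: (u |: Q)) k -> central #|A :\: (u |: Q)| (cnt e (A :\: cn e A u) k) ->
  2 < #|A :\: (u |: Q)| -> #|A :\: (u |: Q)| != 4 ->
  exists r t b, [/\ b <= 2, #|A :\: (u |: Q)| = 3 + 3 * t + 2 * b &
    bouquet e r (t + (#|Q| == 2)) (b + (#|Q| == 1)) A k.+1].
Proof.
set R := A :\: (u |: Q) => pQ cR Q2 exR ceR R3 R4.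
have [p [pR eup pn]] := pendant_next cA A5 pQ.
have [uA uQ sQ /andP[Q0 _] cnQ] := pQ.
have sub q : q \in R -> e u q -> A :\: cn e A u \subset R :\ q.
  move=> qR euq; rewrite subsetD1 setDS ?(pendant_cn es pQ) //.
  by rewrite in_setD in_cn euq; move: qR; rewrite in_setD => /andP[_ ->]; rewrite orbT.
have cR' : #|R| < #|A|.
  by rewrite (card_pendant pQ); move: A5; clear; narith.
have [||t [b [b2 st]]] := bouquet_centre es ei exR pR _ R3 R4.
- have := cntS e k (sub p pR eup); move: ceR; rewrite /central; case: ifP => _; narith.
- by move=> R6; apply: smaller => //; rewrite R6.
exists p, t, b; split=> //; first exact: (bouquet_card st).
apply: (@bouquet_add _ _ _ _ _ _ _ u Q) => //; apply/setP => x; rewrite in_nb in_setU1.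
case: (eqVneq x p) => [->|xp] /=; first by move: pR; rewrite eup in_setD => /andP[_ ->].
case: (boolP (x \in Q)) => xQ.
  rewrite (subsetP sQ) //=; apply: (pendant_adj es pQ); rewrite ?setU11 ?inE ?xQ ?orbT //.
  by apply: contraNneq uQ => ->.
apply/negbTE/negP => /andP[xA eux].
have xR : x \in R.
  rewrite in_setD in_setU1 negb_or xQ xA !andbT.
  by apply: contraTneq eux => ->; rewrite ei.
have := central_lt R3 R4 (J := cnt e (A :\: cn e A u) k); rewrite ceR => H.
have : cnt e (A :\: cn e A u) k <= g (#|R| - 2); last by move/H.
apply: (cnt_le_gn es ei); first exact: (alpha_del es ei uA al).
apply: leq_trans (_ : #|R :\ p :\ x| <= _).
  apply: subset_leq_card; rewrite subsetD1 (sub p) //= in_setD in_cn eux.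
  by rewrite xA orbT.
by move: (cardsD1 p R) (cardsD1 x (R :\ p)); rewrite in_setD1 xp xR pR; narith.
Qed.

Lemma bouquet_step_pendant u Q : pendant e A u Q -> conn e (A :\: (u |: Q)) ->
  exists r t b, b <= 2 /\ bouquet e r t b A k.+1.
Proof.
move=> pQ cR; have := pendant_card3 pQ; rewrite -ltnS => /andP[Q0 Q3].
have cRE := card_pendant pQ.
have alR := pendant_alpha es ei pQ al.
have lR : 36 * cnt e (A :\: (u |: Q)) k <= bound #|A :\: (u |: Q)| (ncyc e (A :\: (u |: Q))).
  by apply: cnt_bound => //; rewrite cRE; move: A6 Q3; clear; lia.
have lJ := pendant_u_bound es ei cA A5 al pQ.
have cE' := cE; rewrite (cnt_pendant es ei pQ al) in cE'.
have [Q1|[Q2|Q3']] : #|Q| = 1 \/ #|Q| = 2 \/ #|Q| = 3 by narith.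
- rewrite Q1 mul1n in cE' lJ; rewrite cRE Q1 in lR.
  have [n0 e1 t1 c1] := bound_pair_eq A6 tA (ncyc_rest e A u Q) lR lJ cE'.
  have [|||||r [t [b [b2 cb st]]]] := pendant_bouquet pQ cR; rewrite ?Q1 ?cRE ?Q1 //.
  + by split; rewrite ?cRE ?Q1.
  + by move: A6; clear; lia.
  + by apply: contraNneq n0 => E; have -> : #|A| = 6 by move: E; clear; lia.
  rewrite cRE Q1 in cb; rewrite Q1 in st; exists r, (t + (1 == 2)), (b + (1 == 1)); split=> //.
  by move: cb n0 A6 b2; rewrite /=; clear; lia.
- rewrite Q2 in cE' lJ; rewrite cRE Q2 in lR.
  have l3 := pendant_ncyc2 es ei pQ Q2 (subsetDl A (u |: Q)) (disjoint_rest A u Q).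
  have [n7 e1 t1 c1] := bound_triangle_eq A6 tA l3 lR lJ
    (few_after_triangle es ei cA A5 al pQ Q2) cE'.
  have [|||||r [t [b [b2 cb st]]]] := pendant_bouquet pQ cR; rewrite ?Q2 ?cRE ?Q2 //.
  + by split; rewrite ?cRE ?Q2.
  + by move: A6; clear; lia.
  + by apply: contraNneq n7 => E; apply/eqP; move: E; clear; lia.
  by rewrite Q2 in st; exists r, (t + (2 == 2)), (b + (2 == 1)); split; rewrite //= addn0.
by case: (strict_step); apply: (step_K4 es ei cA A5 al smaller_bound pQ cR Q3').
Qed.

End Step.

(** In the bouquet that is left after the deletion, x and y lie in a common
    maximum independent set, which is lost when the edge is put back. *)
Lemma dele_strict e A k x y r t b : symmetric e -> irreflexive e -> x \in A -> y \in A -> e x y ->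
  bouquet (dele e x y) r t b A k -> cnt e A k < cnt (dele e x y) A k.
Proof.
move=> es ei xA yA exy st; have xy : x != y by apply: contraTneq exy => ->; rewrite ei.
have ds := dele_sym x y es; have di := dele_irr x y ei.
have dxy : dele e x y x y = false by rewrite /dele !eqxx andbF.
have [S [sS iS cS]] := bouquet_pair ds di st xA yA xy dxy.
rewrite subUset !sub1set => /andP[xS yS].
apply: proper_card; apply/properP; split.
  apply/subsetP => T; rewrite !inE => /and3P[-> iT ->]; rewrite andbT /=.
  apply/indepP => p q pT qT; move/indepP: iT => /(_ p q pT qT) epq.
  by rewrite /dele epq.
exists S; rewrite inE sS cS eqxx ?iS //= andbT.
by apply/indepP => /(_ x y xS yS); rewrite exy.
Qed.

Theorem cnt_bound_eq e A k : symmetric e -> irreflexive e -> 5 < #|A| -> extremal e A k ->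
  exists r t b, b <= 2 /\ bouquet e r t b A k.
Proof.
move: {2}#|A|.+1 (ltnSn #|A|) => n; elim: n e A k => // n IHn e A k nA.
move: {2}#|[set p : V * V | e p.1 p.2]|.+1 (ltnSn #|[set p : V * V | e p.1 p.2]|) => m.
elim: m e k => // m IHm e k em es ei A6 ex.
have A5 : 5 <= #|A| by apply: ltnW.
have [cA al tA cE] := ex.
case: k al ex cE => [|k] al ex cE; first by rewrite (alpha_le0 ei al) cards0 in A6.
have smaller (e' : rel V) (A' : {set V}) k' : symmetric e' -> irreflexive e' ->
    5 < #|A'| < #|A| -> extremal e' A' k' -> exists r t b, b <= 2 /\ bouquet e' r t b A' k'.
  by move=> es' ei' /andP[A'6 A'A] ex'; apply: IHn => //; apply: leq_trans A'A _.
have strict := strict_step ex.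
case: (reduce es ei cA A5).
- move=> x y xA yA exy cd ald; have sub := @dele_sub _ e x y.
  have ds := dele_sym x y es; have di := dele_irr x y ei.
  have l1 := cnt_sub_rel A k.+1 sub.
  have l2 := cnt_bound ds di (ltnW (ltnW (ltnW (ltnW (ltnW A6))))) cd (ald _ al).
  have l3 := ncyc_sub_rel A sub.
  have l4 := bound_mono #|A| l3.
  have [r [t [b [b2 st]]]] : exists r t b, b <= 2 /\ bouquet (dele e x y) r t b A k.+1.
    have exd : extremal (dele e x y) A k.+1.
      split; [exact: cd|exact: ald|apply: (bound_tight A6 tA l3)|]; narith.
    refine (IHm (dele e x y) k.+1 _ ds di A6 exd).
    apply: leq_trans (dele_fewer exy) _; exact: em.
  by have := dele_strict es ei xA yA exy st; narith.
- move=> v vA cv d4; case: strict.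
  exact: (step_deg4 es ei A5 al (@smaller_bound A) vA cv d4).
- move=> v a b vA ab eab nv na nb'.
  by case: (fold_strict es ei A6 ex smaller vA ab eab nv na nb').
- move=> v w x y vA wA cv d3 nw us exy; case: strict.
  exact: (step_matching es ei A5 al (@smaller_bound A) vA wA cv d3 nw us exy).
- by move=> u Q pQ cR; apply: (bouquet_step_pendant es ei A6 ex smaller pQ cR).
- move=> u Q1 Q2 p1 p2 dQ; case: strict.
  exact: (step_cut es ei A5 al p1 p2 dQ).
Qed.

End Equality.

(** * Labelled bouquets *)

(** A label ((s, i), j) stands for vertex j of the i-th attached clique with s
    vertices; the central triangle has (0, 0) in place of (s, i). Vertex 0 of
    each clique is the one joined to the centre. *)
Definition label := ((nat * nat) * nat)%type.

Definition block (c : nat * nat) m : seq label := [seq (c, j) | j <- iota 0 m].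

Definition labels t b : seq label := block (0, 0) 3 ++
  flatten [seq block (3, i) 3 | i <- iota 0 t] ++ flatten [seq block (2, i) 2 | i <- iota 0 b].

Definition label_adj (p q : label) : bool :=
  if p.1 == q.1 then p.2 != q.2
  else [&& p.2 == 0, q.2 == 0 & (p.1 == (0, 0)) || (q.1 == (0, 0))].

Lemma mem_block c m p : (p \in block c m) = (p.1 == c) && (p.2 < m).
Proof.
apply/mapP/andP => [[j + ->]|[/eqP <- lt]]; first by rewrite mem_iota.
by exists p.2; rewrite ?mem_iota //; case: p {lt}.
Qed.

Lemma mem_labels t b p : (p \in labels t b) =
  [|| (p.1 == (0, 0)) && (p.2 < 3), [&& p.1.1 == 3, p.1.2 < t & p.2 < 3] |
      [&& p.1.1 == 2, p.1.2 < b & p.2 < 2]].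
Proof.
have mem_blocks s h : (p \in flatten [seq block (s, i) s | i <- iota 0 h]) =
    [&& p.1.1 == s, p.1.2 < h & p.2 < s].
  apply/flatten_mapP/and3P => [[i + ]|[/eqP e1 lt1 lt2]].
    by rewrite mem_iota mem_block => lt /andP[/eqP-> ->] /=.
  by exists p.1.2; rewrite ?mem_iota // mem_block lt2 andbT -e1; case: p.1 => *.
by rewrite !mem_cat mem_block !mem_blocks.
Qed.

Lemma size_labels t b : size (labels t b) = 3 + 3 * t + 2 * b.
Proof.
have size_blocks s h : size (flatten [seq block (s, i) s | i <- iota 0 h]) = s * h.
  rewrite size_flatten /shape -map_comp (@eq_map _ _ _ (fun=> s)); last first.
    by move=> i; rewrite /= size_map size_iota.
  by rewrite mulnC -{2}(size_iota 0 h); elim: (iota 0 h) => //= a l ->; rewrite mulSn.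
by rewrite !size_cat !size_blocks size_map size_iota; lia.
Qed.

Lemma label_adj_sym : symmetric label_adj.
Proof.
move=> p q; rewrite /label_adj eq_sym; case: ifP => _; first by rewrite eq_sym.
by rewrite orbC andbCA.
Qed.

Section Labelling.
Variables (V : finType) (e : rel V).
Hypotheses (es : symmetric e) (ei : irreflexive e).
Implicit Types (A B Q R S T : {set V}) (p r u v w x y z : V) (k t : nat) (f : V -> label).

(** An isomorphism from A to the standard bouquet; that all labels occur follows
    from the cardinality. *)
Record labelled f A t b : Prop := Labelled {
  label_inj : {in A &, injective f};
  label_mem : forall x, x \in A -> f x \in labels t b;
  label_card : #|A| = 3 + 3 * t + 2 * b;
  label_edge : forall x y, x \in A -> y \in A -> e x y = label_adj (f x) (f y) }.

Lemma label_onto f A t b l : labelled f A t b -> l \in labels t b -> exists2 x, x \in A & f x = l.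
Proof.
move=> [fI fm cA _] lL; have us : uniq (map f (enum A)).
  rewrite map_inj_in_uniq ?enum_uniq // => x y; rewrite !mem_enum; exact: fI.
have sub : {subset map f (enum A) <= labels t b}.
  by move=> _ /mapP[x xA ->]; apply: fm; rewrite mem_enum in xA.
have [_ E] := uniq_min_size us sub ltac:(by rewrite size_map -cardE cA size_labels).
by move: lL; rewrite -E => /mapP[x]; rewrite mem_enum => xA ->; exists x.
Qed.

(** The last attached clique gets a new number; its vertex u comes first. *)
Lemma bouquet_labelled r t b A k : bouquet e r t b A k ->
  exists2 f, labelled f A t b & f r = ((0, 0), 0).
Proof.
elim=> [x y us erx ery exy|t' b' A' k' u Q pQ Q2 nu st [f lf fr]].
  have mem z : z \in [set r; x; y] -> z \in [:: r; x; y] by rewrite !inE -!orbA.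
  have inj : {in [set r; x; y] &, injective (index^~ [:: r; x; y])}.
    by move=> z w /mem zI /mem wI E; rewrite -(nth_index r zI) -(nth_index r wI); congr nth.
  exists (fun z => ((0, 0), index z [:: r; x; y])); last by rewrite /= eqxx.
  split.
  - by move=> z w zI wI [] /inj; apply.
  - move=> z /mem; rewrite -index_mem => zI.
    by rewrite mem_labels; apply/orP; left; apply/andP; split.
  - by rewrite cards3.
  move=> z w zI wI; rewrite /label_adj !eqxx (inj_in_eq inj) //.
  case: (eqVneq z w) => [->|]; first by rewrite ei.
  by move: zI wI; rewrite !inE -!orbA => /or3P[] /eqP-> /or3P[] /eqP->; rewrite ?eqxx // es.
have [uA uQ sQ /andP[Q0 Q3] cnQ] := pQ; have [fI fm cR fe] := lf.
pose c := if #|Q| == 2 then (3, t') else (2, b').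
pose ix z := index z (u :: enum Q).
have mem z : z \in u |: Q -> z \in u :: enum Q by rewrite in_cons mem_enum in_setU1.
have ixI : {in u |: Q &, injective ix}.
  by move=> z w /mem zI /mem wI E; rewrite -(nth_index u zI) -(nth_index u wI); congr nth.
have ix0 z : z \in u |: Q -> (ix z == 0) = (z == u).
  by move=> zQ; rewrite -(inj_in_eq ixI) ?setU11 // /ix /= eqxx.
have QE : #|Q| = 1 \/ #|Q| = 2 by narith.
have cL j : j < #|Q|.+1 -> (c, j) \in labels (t' + (#|Q| == 2)) (b' + (#|Q| == 1)).
  rewrite mem_labels /c; case: QE => -> /= lt; first by rewrite !addn1 /= ltnSn lt ?orbT.
  by rewrite !addn1 /= ltnSn lt ?orbT.
have cN : c \notin map fst (labels t' b').
  apply/mapP => -[p + cp]; rewrite mem_labels -cp /c.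
  by case: ifP => _ /=; rewrite ltnn /= ?andbF ?orbF.
have c0 : (c == (0, 0)) = false by rewrite /c; case: ifP.
have notc z : z \in A' :\: (u |: Q) -> ((f z).1 == c) = false.
  by move=> zR; apply: contraNF cN => /eqP<-; apply: map_f; apply: fm.
have inR z : z \in A' -> z \notin u |: Q -> z \in A' :\: (u |: Q) by move=> zA zQ; rewrite in_setD zQ.
have rR := bouquet_mem st.
have cross z w : z \in u |: Q -> w \in A' :\: (u |: Q) -> e z w = label_adj (c, ix z) (f w).
  move=> zQ wR; rewrite /label_adj /= eq_sym notc // c0 /= ix0 //.
  have wA : w \in A' by move: wR; rewrite in_setD => /andP[].
  have wQ : w \notin u |: Q by move: wR; rewrite in_setD => /andP[].
  have -> : ((f w).2 == 0) && ((f w).1 == (0, 0)) = (w == r).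
    by rewrite -(inj_in_eq fI) // fr andbC; case: (f w).
  move: zQ; rewrite in_setU1; case: (eqVneq z u) => [->|zu] /= zQ.
    have /setP/(_ w) := nu; rewrite in_nb wA in_setU1 /= => ->.
    by move: wQ; rewrite in_setU1 negb_or => /andP[_ /negbTE->]; rewrite orbF.
  by apply: contraNF wQ => ezw; rewrite -(cnQ z zQ) in_cn wA ezw orbT.
exists (fun z => if z \in u |: Q then (c, ix z) else f z); last first.
  by move: rR; rewrite in_setD => /andP[/negbTE-> _].
split.
- move=> z w zA wA; case: ifP => zQ; case: ifP => wQ.
  + by case=> /ixI; apply.
  + by move/(congr1 fst)/esym/eqP; rewrite notc // inR ?wQ.
  + by move/(congr1 fst)/eqP; rewrite notc // inR ?zQ.
  by apply: fI; apply: inR; rewrite ?zQ ?wQ.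
- move=> z zA; case: ifP => zQ; last first.
    have := fm z (inR z zA (negbT zQ)); rewrite !mem_labels.
    case/or3P=> [->//|/and3P[-> lt ->]|/and3P[-> lt ->]].
      by rewrite (leq_trans lt (leq_addr _ _)) orbT.
    by rewrite (leq_trans lt (leq_addr _ _)) !orbT.
  apply: cL; have := mem z zQ; rewrite -index_mem -/(ix z) /= => lt.
  by rewrite cardE.
- move: cR; rewrite (card_pendant pQ); have := subset_leq_card (pendant_sub pQ).
  rewrite cardsU1 uQ; case: QE => E; rewrite E /=; move: (#|A'|) (t') (b'); clear; lia.
move=> z w zA wA; case: ifP => zQ; case: ifP => wQ.
- rewrite /label_adj !eqxx (inj_in_eq ixI) //; case: (eqVneq z w) => [->|zw]; first by rewrite ei.
  by rewrite (pendant_adj es pQ).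
- by apply: cross => //; rewrite inR ?wQ.
- by rewrite es label_adj_sym; apply: cross => //; rewrite inR ?zQ.
by apply: fe; apply: inR; rewrite ?zQ ?wQ.
Qed.
End Labelling.

(** * From a labelling to a bouquet *)

(** Splitting off the last attached clique, a triangle or an edge according to m. *)
Lemma labels_split (t b m : nat) (p : label) : (m == 2) || (m == 3) ->
  (p \in labels (t + (m == 3)) (b + (m == 2))) =
  (p \in labels t b) || (p \in block (m, if m == 3 then t else b) m).
Proof.
rewrite !mem_labels mem_block; case: p => [[a i] j] /=; rewrite !xpair_eqE.
case/orP=> /eqP-> /=; rewrite !addn1 addn0 (ltnS i) (leq_eqVlt i).
  move: (a == 0) (i == 0) (a == 2) (a == 3) (j < 2) (j < 3) => a0 i0 a2 a3 j2 j3.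
  by move: (i == b) (i < b) (i < t); case: a2; case: j2; case: a3 => [] [] [] []; rewrite ?orbT ?orbF.
move: (a == 0) (i == 0) (a == 2) (a == 3) (j < 2) (j < 3) => a0 i0 a2 a3 j2 j3.
by move: (i == t) (i < b) (i < t); case: a3; case: j3; case: a2 => [] [] [] []; rewrite ?orbT ?orbF.
Qed.

Lemma labels_new (t b m : nat) (p : label) : (m == 2) || (m == 3) -> p \in labels t b ->
  p.1 != (m, if m == 3 then t else b).
Proof.
rewrite mem_labels; case: p => [[a i] j] m23 /=; rewrite !xpair_eqE; apply: contraTN.
case/andP=> /eqP-> /eqP->; move: m23.
by case/orP=> /eqP-> /=; rewrite ltnn /= ?andbF.
Qed.

Section Labelling.
Variables (V : finType) (e : rel V).
Hypotheses (es : symmetric e) (ei : irreflexive e).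
Implicit Types (A B Q R S T : {set V}) (p r u v w x y z : V) (k t : nat) (f : V -> label).

(** The vertices with the last clique number form a pendant clique together. *)
Lemma labelled_peel f A (t b m : nat) r : (m == 2) || (m == 3) -> r \in A -> f r = ((0, 0), 0) ->
  labelled e f A (t + (m == 3)) (b + (m == 2)) ->
  exists u Q, [/\ pendant e A u Q, #|Q| = m.-1, nb e A u = r |: Q, r \in A :\: (u |: Q) &
    labelled e f (A :\: (u |: Q)) t b].
Proof.
move=> m23 rA fr lf; have [fI fm cA fe] := lf.
pose c := (m, if m == 3 then t else b).
have c0 : (c == (0, 0)) = false by rewrite /c; case/orP: m23 => /eqP->.
have m0 : 0 < m by case/orP: m23 => /eqP->.
have onto j : j < m -> exists2 x, x \in A & f x = (c, j).
  move=> jm; apply: (label_onto lf); rewrite labels_split // mem_block /= eqxx jm.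
  by rewrite orbT.
have [u uA fu] := onto 0 m0.
pose Q := [set z in A | ((f z).1 == c) && ((f z).2 != 0)].
have uQE : u |: Q = [set z in A | (f z).1 == c].
  apply/setP => z; rewrite !inE; case: (eqVneq z u) => [->|zu] /=; first by rewrite uA fu eqxx.
  case: (boolP (z \in A)) => //= zA; case: eqP => //= fz.
  apply: contraNneq zu => fz0; apply/eqP/fI => //.
  by rewrite fu -fz -fz0 -surjective_pairing.
have uQ : u \notin Q by rewrite inE fu eqxx !andbF.
have QE : #|Q| = m.-1.
  suff /perm_size : perm_eq (map f (enum Q)) [seq (c, j) | j <- iota 1 m.-1].
    by rewrite !size_map size_iota -cardE.
  apply: uniq_perm.
  - rewrite map_inj_in_uniq ?enum_uniq // => x y.
    by rewrite !mem_enum !inE => /andP[xA _] /andP[yA _]; apply: fI.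
  - by rewrite map_inj_uniq ?iota_uniq // => i j [].
  move=> l; apply/mapP/mapP => [[x + ->]|[j + ->]].
    rewrite mem_enum inE => /and3P[xA /eqP fx fx0]; exists (f x).2.
      rewrite mem_iota lt0n fx0 add1n prednK //.
      have := fm x xA; rewrite labels_split // mem_block fx eqxx /= => /orP[lx|//].
      by have := labels_new m23 lx; rewrite fx eqxx.
    by rewrite -fx -surjective_pairing.
  rewrite mem_iota add1n prednK // => /andP[j0 jm]; have [x xA fx] := onto j jm.
  by exists x; rewrite // mem_enum inE xA fx eqxx -lt0n j0.
have sQ : Q \subset A by apply/subsetP => z; rewrite inE => /andP[].
have inC z : z \in u |: Q -> z \in A /\ (f z).1 = c by rewrite uQE inE => /andP[? /eqP].
have notC z : z \in A -> z \notin u |: Q -> (f z).1 == c = false.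
  by move=> zA; rewrite uQE inE zA => /negbTE.
have clC z w : z \in u |: Q -> w \in u |: Q -> e z w = (z != w).
  move=> zC wC; have [zA fz] := inC z zC; have [wA fw] := inC w wC.
  rewrite fe // /label_adj fz fw eqxx -(inj_in_eq fI) //.
  by rewrite [f z]surjective_pairing [f w]surjective_pairing fz fw xpair_eqE eqxx.
have rC : r \notin u |: Q by rewrite uQE inE fr eq_sym c0 andbF.
exists u, Q; split=> //.
- split=> //; first by rewrite QE; case/orP: m23 => /eqP->.
  move=> q qQ; have qC : q \in u |: Q by rewrite in_setU1 qQ orbT.
  have [qA fq] := inC q qC.
  apply/setP => z; rewrite in_cn; case: (boolP (z \in u |: Q)) => [zC|zC].
    by have [zA _] := inC z zC; rewrite zA clC // (eq_sym q) /=; case: eqP.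
  case: (eqVneq z q) => [zq|_] /=; first by rewrite zq qC in zC.
  case: (boolP (z \in A)) => //= zA; rewrite fe // /label_adj fq eq_sym notC //.
  by move: qQ; rewrite inE => /and3P[_ _ /negbTE->].
- apply/setP => z; rewrite in_nb in_setU1.
  have uC : u \in u |: Q := setU11 _ _.
  case: (boolP (z \in u |: Q)) => [zC|zC].
    have [zA _] := inC z zC; rewrite zA clC //.
    case: (eqVneq z r) => [zr|_] /=; first by rewrite -zr zC in rC.
    by move: zC; rewrite in_setU1; case: (eqVneq z u) => [->|] //=; rewrite (negbTE uQ).
  have -> : z \in Q = false by apply: contraNF zC => zQ; rewrite in_setU1 zQ orbT.
  rewrite orbF; case: (boolP (z \in A)) => zA; last by case: eqP => // zr; rewrite zr rA in zA.
  rewrite fe // /label_adj fu /= eq_sym notC //= c0 /= -(inj_in_eq fI) // fr.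
  by case: (f z) => ? ?; rewrite andbC.
- by rewrite in_setD rC.
split.
- by move=> x y; rewrite !in_setD => /andP[_ xA] /andP[_ yA]; apply: fI.
- move=> x; rewrite in_setD => /andP[xC xA].
  by have := fm x xA; rewrite labels_split // mem_block notC // orbF.
- rewrite cardsD (setIidPr _); last by rewrite subUset sub1set uA sQ.
  by rewrite cardsU1 uQ QE cA; case/orP: m23 => /eqP-> /=; clear; lia.
by move=> x y; rewrite !in_setD => /andP[_ xA] /andP[_ yA]; apply: fe.
Qed.

Lemma labelled_bouquet f A t b : labelled e f A t b -> exists r k, bouquet e r t b A k.
Proof.
move=> lf; have [r rA fr] := label_onto lf (l := ((0, 0), 0)) ltac:(by rewrite mem_labels).
exists r; elim: t b A lf rA => [|t IHt].
  elim=> [|b IHb] A lf rA.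
    exists 1; have [fI fm cA fe] := lf; apply: bouquet_clique3 => // x y xA yA xy.
    rewrite fe // /label_adj; move: (fm x xA) (fm y yA); rewrite !mem_labels !ltn0 !andbF !orbF.
    case/andP=> /eqP fx _ /andP[/eqP fy _]; rewrite fx fy eqxx.
    apply: contra xy => /eqP E; apply/eqP/fI => //.
    by rewrite [f x]surjective_pairing [f y]surjective_pairing fx fy E.
  have [|u [Q [pQ cQ nu rR lR]]] := @labelled_peel f A 0 b 2 r isT rA fr.
    by rewrite addn1.
  have [k st] := IHb _ lR rR; exists k.+1.
  by have := bouquet_add pQ _ nu st; rewrite cQ /= addn1; apply.
move=> b A lf rA; have [|u [Q [pQ cQ nu rR lR]]] := @labelled_peel f A t b 3 r isT rA fr.
  by rewrite addn1 addn0.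
have [k st] := IHt _ _ lR rR; exists k.+1.
by have := bouquet_add pQ _ nu st; rewrite cQ /= addn1 addn0; apply.
Qed.

End Labelling.

(** * The extremal graph and the theorem *)

Section RootFirst.
Variables (V : finType) (e : rel V) (comp : V -> nat * nat) (idx : V -> nat).
Hypotheses (eE : forall x y, e x y = (comp x == comp y) && (x != y))
  (idxI : forall x y, comp x = comp y -> idx x = idx y -> x = y)
  (idx_lt : forall x, idx x < (comp x).1).

Lemma connect_blocks x y : connect e x y = (comp x == comp y).
Proof.
apply/idP/eqP => [/connectP[p + ->]|E].
  by elim: p x => //= z p IHp x /andP[]; rewrite eE => /andP[/eqP-> _] /IHp.
by case: (eqVneq x y) => [->//|xy]; apply: connect1; rewrite eE E eqxx.
Qed.

(** Renumbers a clique so that its root, which may be any of its vertices, becomes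
    vertex 0. *)
Definition root_idx x := if x \in roots e then 0 else if idx x == 0 then idx (root e x) else idx x.

Let csym : connect_sym e.
Proof. by move=> x y; rewrite !connect_blocks eq_sym. Qed.

Let comp_root x : comp (root e x) = comp x.
Proof. by apply/esym/eqP; rewrite -connect_blocks connect_root. Qed.

Let rootE x y : comp x = comp y -> root e x = root e y.
Proof. by move=> E; apply/eqP; rewrite (root_connect csym) connect_blocks E. Qed.

Lemma root_idx0 x : (root_idx x == 0) = (x \in roots e).
Proof.
rewrite /root_idx; case: ifP => // xr; case: ifP => // /eqP i0.
apply: contraFF xr => /eqP r0; apply/eqP/idxI; first exact: comp_root.
by rewrite r0 i0.
Qed.

Lemma root_idx_lt x : root_idx x < (comp x).1.
Proof.
rewrite /root_idx; case: ifP => _; first exact: leq_ltn_trans (idx_lt x).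
by case: ifP => _ //; rewrite -(comp_root x).
Qed.

Lemma root_idx_inj x y : comp x = comp y -> root_idx x = root_idx y -> x = y.
Proof.
move=> E; have rE := rootE E; have cr := comp_root x; have cr' := comp_root y.
case: (boolP (x \in roots e)) => xr; case: (boolP (y \in roots e)) => yr.
- by move: xr yr; rewrite !inE /= => /eqP xr /eqP yr; rewrite -xr -yr rE.
- by move=> I; move: yr; rewrite -root_idx0 -I root_idx0 xr.
- by move=> I; move: xr; rewrite -root_idx0 I root_idx0 yr.
rewrite /root_idx (negbTE xr) (negbTE yr); case: eqP => x0; case: eqP => y0.
- by move=> _; apply: idxI; rewrite ?x0 ?y0.
- move=> I; case/negP: yr; apply/eqP; apply: idxI => //.
  by rewrite -I rE.
- move=> I; case/negP: xr; apply/eqP; apply: idxI => //.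
  by rewrite I rE.
exact: idxI.
Qed.

End RootFirst.

Section Extremal.
Variables (t b : nat).

(** The cliques attached in the extremal graph. *)
Definition hanging := disjoint_union (copies t (complete_graph 3)) (copies b (complete_graph 2)).

Definition hanging_block (x : hanging) : nat * nat :=
  match x with inl p => (3, val p.1) | inr p => (2, val p.1) end.

Definition hanging_idx (x : hanging) : nat :=
  match x with inl p => val p.2 | inr p => val p.2 end.

Lemma hanging_edge (x y : hanging) :
  sedge x y = (hanging_block x == hanging_block y) && (x != y).
Proof.
by case: x y => [[i j]|[i j]] [[i' j']|[i' j']];
  rewrite //= /copies_edge /= /complete_edge xpair_eqE eqxx /= val_eqE;
  case: (eqVneq i i') => //= ->; congr negb; rewrite [RHS]/eq_op /= xpair_eqE eqxx.
Qed.

Lemma hanging_idx_inj (x y : hanging) :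
  hanging_block x = hanging_block y -> hanging_idx x = hanging_idx y -> x = y.
Proof.
by case: x y => [[i j]|[i j]] [[i' j']|[i' j']] //= [/val_inj->] /val_inj->.
Qed.

Lemma hanging_idx_lt (x : hanging) : hanging_idx x < (hanging_block x).1.
Proof. by case: x => [[i j]|[i j]] /=. Qed.

Definition star_label (x : star 3 hanging) : label :=
  match x with
  | inl i => ((0, 0), val i)
  | inr y => (hanging_block y, root_idx (@sedge hanging) hanging_idx y)
  end.

Lemma star_graph_labelled : labelled (@sedge (star 3 hanging)) star_label [set: star 3 hanging] t b.
Proof.
have inj := root_idx_inj hanging_edge hanging_idx_inj.
have lt := root_idx_lt hanging_edge hanging_idx_lt.
have r0 := root_idx0 hanging_edge hanging_idx_inj.
have b0 y : (hanging_block y == (0, 0)) = false by case: y => [[? ?]|[? ?]].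
split.
- move=> [i|x] [j|y] _ _ //=.
  + by case=> /val_inj->.
  + by case=> /eqP; rewrite eq_sym b0.
  + by case=> /eqP; rewrite b0.
  by case=> bE iE; rewrite (inj x y).
- move=> [i|x] _; rewrite mem_labels /=; first by rewrite ltn_ord.
  by have := lt x; case: x => [[i j]|[i j]] /= ->; rewrite ltn_ord ?orbT.
- by rewrite cardsT !card_sum !card_prod !card_ord; lia.
move=> [i|x] [j|y] _ _; rewrite /label_adj /=.
- by [].
- by rewrite [(0, 0) == _]eq_sym b0 r0 andbT.
- by rewrite b0 r0 orbT andbT andbC.
have /= -> := hanging_edge x y; case: eqP => [bE|_] /=; last by rewrite !b0 /= !andbF.
congr negb; apply/eqP/eqP => [->//|].
exact: inj.
Qed.

End Extremal.

Section Isomorphism.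
Variables (G H : sgraph).

(** Two vertices correspond if they have the same label. *)
Lemma labelled_iso f f' t b : labelled (@sedge G) f [set: G] t b ->
  labelled (@sedge H) f' [set: H] t b -> sg_iso G H.
Proof.
move=> lf lf'; have [fI fm fc fe] := lf; have [fI' fm' fc' fe'] := lf'.
have [y0 _ _] := label_onto lf' (l := ((0, 0), 0)) ltac:(by rewrite mem_labels).
pose h x := odflt y0 [pick y | f' y == f x].
have hE x : f' (h x) = f x.
  rewrite /h; case: pickP => [y /eqP //|no].
  by have [y _ yE] := label_onto lf' (fm x (in_setT x)); have := no y; rewrite yE eqxx.
exists h; last by move=> x y; rewrite fe' ?inE // !hE -fe ?inE.
apply: inj_card_bij => [x y E|]; last by rewrite -!cardsT fc fc'.
by apply: fI; rewrite ?inE // -!hE E.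
Qed.

Lemma iso_labelled f' t b : sg_iso G H -> labelled (@sedge H) f' [set: H] t b ->
  exists f, labelled (@sedge G) f [set: G] t b.
Proof.
case=> h hb hm [fI fm fc fe]; exists (f' \o h); split.
- by move=> x y _ _ /= /fI E; apply: (bij_inj hb); apply: E; rewrite inE.
- by move=> x _; apply: fm; rewrite inE.
- by rewrite cardsT (bij_eq_card hb) -cardsT.
by move=> x y _ _; rewrite /= -fe ?inE // hm.
Qed.

Lemma num_max_indepE k : alpha_le (@sedge G) [set: G] k -> 0 < cnt (@sedge G) [set: G] k ->
  num_max_indep G = cnt (@sedge G) [set: G] k.
Proof.
move=> al /cnt_witness[S0 [_ iS0 cS0]]; apply: eq_card => S; rewrite !inE subsetT /=.
rewrite /maximum_independent; case iS: (independent S); last first.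
  by symmetry; rewrite -[indep _ _]/(independent S) iS.
rewrite -[indep _ _]/(independent S) iS /=; apply/forallP/eqP => [/(_ S0)/implyP/(_ iS0)|cS S'].
  by rewrite cS0 => le; apply/eqP; rewrite eqn_leq le al ?subsetT.
by apply/implyP => iS'; rewrite cS al ?subsetT.
Qed.

Lemma num_cyclesE : num_cycles G = ncyc (@sedge G) [set: G].
Proof.
apply: eq_card => F; rewrite !inE; apply: eq_existsb => k; apply: eq_existsb => c.
have -> : all (mem [set: G]) c by apply/allP => x _; rewrite inE.
by [].
Qed.

Lemma sg_connected_conn : sg_connected G -> conn (@sedge G) [set: G].
Proof.
move=> cG; apply: conn_of_connect => x y _ _.
by rewrite (eq_connect (e' := @sedge G)) // => a c; rewrite /= !inE !andbT.
Qed.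

Lemma alpha_le_exists : exists2 k, alpha_le (@sedge G) [set: G] k & 0 < cnt (@sedge G) [set: G] k.
Proof.
have i0 : indep (@sedge G) (set0 : {set G}) by apply/indepP => x y; rewrite inE.
case: (arg_maxnP (fun S : {set G} => #|S|) i0) => S iS maxS.
exists #|S|; first by move=> T _ iT; apply: maxS.
by apply: cnt_ge1; rewrite ?subsetT.
Qed.

End Isomorphism.

Theorem theorem4p2 (n r0 : nat) (G : sgraph) :
  n = 3 * r0 + 1 -> 7 <= n ->
  #|G| = n -> sg_connected G -> num_cycles G < r0 + 6 ->
  num_max_indep G <= 8 * 3 ^ (r0 - 2) + 2 ^ (r0 - 2) /\
  (num_max_indep G = 8 * 3 ^ (r0 - 2) + 2 ^ (r0 - 2) <->
   sg_iso G (extremal_graph r0)).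
Proof.
move=> nE n7 cG /sg_connected_conn conG; rewrite num_cyclesE => cyc.
have es := @sedge_sym G; have ei := @sedge_irr G.
have {}cG : #|[set: G]| = 3 * r0 + 1 by rewrite cardsT cG.
have [k al c0] := alpha_le_exists G; rewrite (num_max_indepE al c0).
have [s r0E] : exists s, r0 = s.+2 by exists (r0 - 2); lia.
have sE : r0 - 2 = s by rewrite r0E; lia.
have bE : bound #|[set: G]| (ncyc (@sedge G) [set: G]) = 36 * (8 * 3 ^ s + 2 ^ s).
  by rewrite cG bound_1 /bound1 cyc r0E /= !expnS; lia.
have T : tight #|[set: G]| (ncyc (@sedge G) [set: G]) by rewrite cG tight_1.
rewrite sE; split; first by have := cnt_bound es ei _ conG al; rewrite bE cG leq_pmul2l //; apply; lia.
have [f' lH] : exists f', labelled (@sedge (extremal_graph r0)) f' [set: extremal_graph r0] s 2.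
  by rewrite -sE; exists (@star_label (r0 - 2) 2); apply: star_graph_labelled.
split=> [cE|iso].
  have [||r [t [b [b2 st]]]] := cnt_bound_eq es ei (A := [set: G]) (k := k).
  - by rewrite cG; lia.
  - by split; rewrite // cE bE.
  have := bouquet_card st; rewrite cG => E.
  have [tE bE'] : t = s /\ b = 2 by lia.
  subst t b; have [f lf _] := bouquet_labelled es ei st.
  exact: labelled_iso lf lH.
have [f lf] := iso_labelled iso lH.
have [r [k' st]] := labelled_bouquet lf.
have al' := bouquet_alpha es st.
have tot := bouquet_total es ei st.
have c0' : 0 < cnt (@sedge G) [set: G] k' by rewrite tot addn_gt0 expn_gt0 orbT.
(* k and k' are both the independence number of G *)
by rewrite -(num_max_indepE al c0) (num_max_indepE al' c0') tot; lia.
Qed.
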